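(* Let $\kappa\in\mathbb{R}$ and let $u_0$ be such that $m_0:=\mu(u_0)-u_{0xx}\in H^1(\mathbb{S})$. If $m_0+\kappa$ does not change sign on $\mathbb{S}$ (that is, $m_0+\kappa\ge0$ on $\mathbb{S}$ or $m_0+\kappa\le0$ on $\mathbb{S}$), then the strong solution $u(t)$ of the generalized periodic Camassa-Holm ($\mu$-CH) initial-value problem with initial data $u_0$ exists permanently in time (i.e. its maximal existence time is $+\infty$).
   Context: $\mathbb{S}=\mathbb{R}/\mathbb{Z}$, $\mu(f)=\int_{\mathbb{S}}f\,dx$. The $\mu$-CH initial-value problem (with parameter $\kappa\in\mathbb{R}$) is, for functions $u(t,x)$ that are $1$-periodic in $x$, $$u_t+uu_x+\partial_xP=0,\qquad (\mu-\partial_x^2)P=2\mu(u)u+\tfrac12u_x^2+2\kappa u,\qquad u(0,x)=u_0(x),$$ equivalently $\mu(u_t)-u_{xxt}+2\mu(u)u_x+2\kappa u_x=2u_xu_{xx}+uu_{xxx}$, $u(0,x)=u_0(x)$. Here $(\mu-\partial_x^2)P:=\mu(P)-P_{xx}$, which is an isomorphism $H^{s}(\mathbb{S})\to H^{s-2}(\mathbb{S})$. A strong solution on $[0,T)$ is $u\in C([0,T),H^s(\mathbb{S}))\cap C^1([0,T),H^{s-1}(\mathbb{S}))$, $s>3/2$, satisfying the problem. For every $u_0\in H^s(\mathbb{S})$, $s>3/2$, there is a unique strong solution with a maximal existence time $T=T(u_0)\in(0,\infty]$ (independent of $s$). *)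

(* Defs.v *)
From Stdlib Require Import Reals ZArith.
From Coquelicot Require Import Coquelicot.
Open Scope R_scope.

(** Functions on the circle R/Z are 1-periodic functions on R. *)
Definition periodic1 (f : R -> R) : Prop := forall x, f (x + 1) = f x.

Definition mu (f : R -> R) : R := RInt f 0 1.

(** The integral over the circle of [f x * exp (- 2 i pi k x)]. *)
Definition fourier (f : R -> R) (k : Z) : C :=
  (RInt (fun x => f x * cos (2 * PI * IZR k * x)) 0 1,
   - RInt (fun x => f x * sin (2 * PI * IZR k * x)) 0 1).

Definition sobolev_term (s : R) (f : R -> R) (k : Z) : R :=
  Rpower (1 + IZR k ^ 2) s * Cmod (fourier f k) ^ 2.

(** The terms over [Z], grouped as [k = n] and [k = - n - 1] for [n >= 0];
    they are nonnegative, so the grouping affects neither convergence nor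
    the sum. *)
Definition sobolev_series (s : R) (f : R -> R) (n : nat) : R :=
  sobolev_term s f (Z.of_nat n) + sobolev_term s f (- Z.of_nat n - 1).

(** The space H^s of the circle, used only for [s > 1/2]: each class then has
    exactly one continuous representative, and the space is identified with
    the set of these representatives. *)
Definition in_H (s : R) (f : R -> R) : Prop :=
  periodic1 f /\ (forall x, continuous f x) /\ ex_series (sobolev_series s f).

Definition H_norm (s : R) (f : R -> R) : R := sqrt (Series (sobolev_series s f)).

Definition time_dom (T : Rbar) (t : R) : Prop := 0 <= t /\ Rbar_lt t T.

(** [u] belongs to C([0,T), H^s); values of [u] outside [0,T) are irrelevant. *)
Definition C0_H (s : R) (T : Rbar) (u : R -> R -> R) : Prop :=
  forall t, time_dom T t ->
    in_H s (u t) /\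
    filterlim (fun r => H_norm s (fun x => u r x - u t x))
      (within (time_dom T) (locally t)) (locally 0).

(** [v] is the derivative of [u : [0,T) -> H^s], one-sided at [t = 0]. *)
Definition is_time_derive_H (s : R) (T : Rbar) (u v : R -> R -> R) : Prop :=
  forall t, time_dom T t ->
    filterlim (fun r => H_norm s (fun x => (u r x - u t x) / (r - t) - v t x))
      (within (time_dom T) (locally' t)) (locally 0).

(** [ex_derive_n f 2] would not imply that [f] itself is differentiable. *)
Definition twice_derivable (f : R -> R) : Prop :=
  forall x, ex_derive f x /\ ex_derive (Derive f) x.

(** The operator [mu - d^2/dx^2]. *)
Definition mu_op (f : R -> R) (x : R) : R := mu f - Derive_n f 2 x.

(** [P] is the inverse image under [mu_op] of
    [2 mu(w) w + w_x^2 / 2 + 2 kappa w]. For [w] in H^s with [s > 3/2] this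
    right-hand side is continuous, hence [P] is of class C^2. *)
Definition is_pressure (kappa : R) (w P : R -> R) : Prop :=
  periodic1 P /\ twice_derivable P /\
  forall x, mu_op P x =
    2 * mu w * w x + / 2 * (Derive w x) ^ 2 + 2 * kappa * w x.

(** For [s > 3/2] every term of the equation is a continuous function of [x],
    so that equality in H^(s-1) is pointwise equality. *)
Definition strong_solution (kappa s : R) (u0 : R -> R) (T : Rbar)
    (u : R -> R -> R) : Prop :=
  Rbar_lt 0 T /\
  C0_H s T u /\
  (exists u_t : R -> R -> R,
     C0_H (s - 1) T u_t /\
     is_time_derive_H (s - 1) T u u_t /\
     forall t, time_dom T t ->
       exists P : R -> R,
         is_pressure kappa (u t) P /\
         forall x, u_t t x + u t x * Derive (u t) x + Derive P x = 0) /\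
  (forall x, u 0 x = u0 x).

Definition max_existence_time (kappa s : R) (u0 : R -> R) : Rbar :=
  Lub_Rbar (fun T : R => exists u, strong_solution kappa s u0 T u).

(* Main.v *)
(** Let [nu = m0 + kappa] and [lam] its integral over the circle. Along the flow [q] of [u]
    one has [(m + kappa)(q) q_x^2 = nu], while [mu(u)] is conserved; so [phi = ln q_x] and
    [V = u_x(q)] satisfy [phi_t = V], [V_x = lam exp(phi) - nu exp(-phi)], [mu(V exp(phi)) = 0].
    This is an ordinary differential equation for [phi] in the space of continuous functions.
    As [nu] has a sign, [nu = lam rho] with a probability density [rho], and the right-hand side
    becomes [lam] times the difference of the probability densities [exp(phi)] and
    [rho exp(-phi)]. Once these two densities are normalised explicitly, the vector field is
    bounded and globally Lipschitz, hence the flow exists for all times, and the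
    normalisations turn out to be conserved.

    Undoing the change of variables gives [u], [u_x] and [m + kappa] in terms of [phi] and of the
    inverse [qinv] of [q]. Fourier coefficients are differentiated in time in Lagrangian
    coordinates. Continuity in time with values in [H^3] reduces to that of
    [nu(qinv) exp(-2 phi(qinv))] in [H^1], which is obtained by splitting the Fourier series of
    [nu] and by Bessel's inequality. *)

Require Import Defs.
From Stdlib Require Import Reals Lra Lia ZArith.
From Coquelicot Require Import Coquelicot.
Open Scope R_scope.

(** Write [n = m + kappa]. The equation becomes $n_t + u n_x + 2 u_x n = 0$, so $n(q) q_x^2$ is
    constant along the flow; differentiating [V = u_x(q)] in [x] gives $(\mu(u) - m)(q)\,q_x$, and
    the zero mean of $u_x$ fixes the constant of integration. The obstacle to global existence is
    the growth of the exponentials: without normalisation the field is only locally Lipschitz. The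
    sign of [nu] makes both sources positive weights, and multiplying a positive weight by a factor
    near 1 changes its normalised density by a factor near 1, whatever its size. The second obstacle
    is regularity: [nu] is only in $H^1$, so the evolution of [m] is not differentiated pointwise.
    Its integrals against smooth functions become, in Lagrangian coordinates, integrals of the fixed
    [nu] against a factor that is $C^1$ in time. Sobolev estimates are proved on finite blocks of
    Fourier coefficients, with bounds independent of the length of the block; convergence of the
    series follows from these bounds. *)

Definition cont (f : R -> R) : Prop := forall x, continuous f x.

Definition cont2 (f : R -> R -> R) : Prop := forall t x, continuity_2d_pt f t x.

(** * Continuous functions of one real variable *)

Lemma cont_const (c : R) : cont (fun _ => c).
Proof. intros x; apply continuous_const. Qed.

Lemma cont_id : cont (fun x => x).
Proof. intros x; apply continuous_id. Qed.

Lemma cont_plus (f g : R -> R) : cont f -> cont g -> cont (fun x => f x + g x).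
Proof. intros Hf Hg x; apply (continuous_plus f g); auto. Qed.

Lemma cont_opp (f : R -> R) : cont f -> cont (fun x => - f x).
Proof. intros Hf x; apply (continuous_opp f); auto. Qed.

Lemma cont_minus (f g : R -> R) : cont f -> cont g -> cont (fun x => f x - g x).
Proof. intros Hf Hg x; apply (continuous_minus f g); auto. Qed.

Lemma cont_mult (f g : R -> R) : cont f -> cont g -> cont (fun x => f x * g x).
Proof. intros Hf Hg x; apply (continuous_mult f g); auto. Qed.

Lemma cont_pow (f : R -> R) (n : nat) : cont f -> cont (fun x => f x ^ n).
Proof.
  intros Hf; induction n as [|n IH]; simpl.
  - apply cont_const.
  - apply cont_mult; auto.
Qed.

Lemma cont_div (f : R -> R) (c : R) : cont f -> cont (fun x => f x / c).
Proof. intros Hf; unfold Rdiv; apply cont_mult; [exact Hf | apply cont_const]. Qed.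

Lemma cont_comp (g f : R -> R) : cont g -> cont f -> cont (fun x => g (f x)).
Proof. intros Hg Hf x; apply (continuous_comp f g); auto. Qed.

Lemma cont_derive (f df : R -> R) : (forall x, is_derive f x (df x)) -> cont f.
Proof. intros H x; apply (ex_derive_continuous f); exists (df x); apply H. Qed.

Lemma cont_exp : cont exp.
Proof. apply (cont_derive exp exp); intros x; apply is_derive_exp. Qed.

Lemma cont_sin : cont sin.
Proof. apply (cont_derive sin cos); intros x; apply is_derive_sin. Qed.

Lemma cont_cos : cont cos.
Proof. apply (cont_derive cos (fun x => - sin x)); intros x; apply is_derive_cos. Qed.

Lemma cont_Rabs : cont Rabs.
Proof. intros x; apply continuous_Rabs. Qed.

Lemma cont_continuity_pt (f : R -> R) (x : R) : cont f -> continuity_pt f x.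
Proof. intros H; apply continuity_pt_filterlim; apply H. Qed.

Lemma cont_eps (f : R -> R) (x : R) (e : R) : cont f -> 0 < e ->
  exists d, 0 < d /\ forall y, Rabs (y - x) < d -> Rabs (f y - f x) < e.
Proof.
  intros H He.
  destruct (proj1 (filterlim_locally f (f x)) (H x) (mkposreal e He)) as [d Hd].
  exists d; split; [apply cond_pos|].
  intros y Hy; apply (Hd y); exact Hy.
Qed.

Lemma eps_cont (f : R -> R) :
  (forall x e, 0 < e ->
    exists d, 0 < d /\ forall y, Rabs (y - x) < d -> Rabs (f y - f x) < e) -> cont f.
Proof.
  intros H x; apply filterlim_locally; intros e.
  destruct (H x e (cond_pos e)) as [d [Hd H1]].
  exists (mkposreal d Hd); intros y Hy; apply H1; exact Hy.
Qed.

(** Equations between Coquelicot integrals are typed in the carrier of a structure; [ring] only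
    recognises them once this type is replaced by [R]. *)
Ltac toR :=
  unfold minus, plus, opp, scal; simpl; unfold mult; simpl;
  match goal with |- @eq _ ?a ?b => change (@eq R a b) end.

Ltac rng := toR; first [ring | lra].

Ltac cnt := repeat match goal with
  | |- cont (fun _ => ?c) => apply (cont_const c)
  | |- cont (fun x => x) => apply cont_id
  | |- cont (fun x => @?f x + @?g x) => apply (cont_plus f g)
  | |- cont (fun x => @?f x - @?g x) => apply (cont_minus f g)
  | |- cont (fun x => - @?f x) => apply (cont_opp f)
  | |- cont (fun x => @?f x * @?g x) => apply (cont_mult f g)
  | |- cont (fun x => @?f x / ?c) => apply (cont_div f c)
  | |- cont (fun x => @?f x ^ ?n) => apply (cont_pow f n)
  | |- cont (fun x => exp (@?f x)) => apply (cont_comp exp f cont_exp)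
  | |- cont (fun x => sin (@?f x)) => apply (cont_comp sin f cont_sin)
  | |- cont (fun x => cos (@?f x)) => apply (cont_comp cos f cont_cos)
  | |- cont (fun x => Rabs (@?f x)) => apply (cont_comp Rabs f cont_Rabs)
  | |- cont (fun x => ?g x) => match goal with H : cont ?h |- _ => constr_eq g h; exact H end
  | _ => assumption
  | H : cont ?h |- cont (fun x => ?h (@?f x)) => apply (cont_comp h f H)
  end.

(** * Riemann integrals of continuous functions *)

Lemma ex_RInt_cont (f : R -> R) (a b : R) : cont f -> ex_RInt f a b.
Proof. intros H; apply (@ex_RInt_continuous R_CompleteNormedModule); intros z _; apply H. Qed.

Lemma RInt_plus_cont (f g : R -> R) (a b : R) : cont f -> cont g ->
  RInt (fun x => f x + g x) a b = RInt f a b + RInt g a b.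
Proof. intros; apply (RInt_plus f g); apply ex_RInt_cont; auto. Qed.

Lemma RInt_minus_cont (f g : R -> R) (a b : R) : cont f -> cont g ->
  RInt (fun x => f x - g x) a b = RInt f a b - RInt g a b.
Proof. intros; apply (RInt_minus f g); apply ex_RInt_cont; auto. Qed.

Lemma RInt_opp_cont (f : R -> R) (a b : R) : cont f ->
  RInt (fun x => - f x) a b = - RInt f a b.
Proof. intros; apply (RInt_opp f); apply ex_RInt_cont; auto. Qed.

Lemma RInt_scal_cont (c : R) (f : R -> R) (a b : R) : cont f ->
  RInt (fun x => c * f x) a b = c * RInt f a b.
Proof. intros; apply (RInt_scal f a b c); apply ex_RInt_cont; auto. Qed.

Lemma RInt_const_R (c a b : R) : RInt (fun _ => c) a b = (b - a) * c.
Proof. apply (RInt_const a b c). Qed.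

Lemma RInt_ext_R (f g : R -> R) (a b : R) : (forall x, f x = g x) -> RInt f a b = RInt g a b.
Proof. intros H; apply RInt_ext; intros; apply H. Qed.

Lemma RInt_Chasles_cont (f : R -> R) (a b c : R) : cont f ->
  RInt f a b + RInt f b c = RInt f a c.
Proof. intros H; apply (RInt_Chasles f); apply ex_RInt_cont; auto. Qed.

Lemma RInt_le_cont (f g : R -> R) (a b : R) : a <= b -> cont f -> cont g ->
  (forall x, a <= x <= b -> f x <= g x) -> RInt f a b <= RInt g a b.
Proof.
  intros Hab Hf Hg H; apply RInt_le; auto using ex_RInt_cont.
  intros x Hx; apply H; lra.
Qed.

Lemma RInt_ge_0_cont (f : R -> R) (a b : R) : a <= b -> cont f ->
  (forall x, a <= x <= b -> 0 <= f x) -> 0 <= RInt f a b.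
Proof.
  intros Hab Hf H.
  rewrite <- (Rmult_0_r (b - a)), <- RInt_const_R.
  apply RInt_le_cont; auto; cnt.
Qed.

Lemma RInt_abs_le_cont (f : R -> R) (a b M : R) : cont f ->
  (forall x, Rmin a b <= x <= Rmax a b -> Rabs (f x) <= M) ->
  Rabs (RInt f a b) <= Rabs (b - a) * M.
Proof.
  intros Hf H.
  destruct (Rle_dec a b) as [Hab|Hab].
  - rewrite (Rabs_pos_eq (b - a)) by lra.
    apply abs_RInt_le_const; auto using ex_RInt_cont.
    intros x Hx; apply H; rewrite Rmin_left, Rmax_right; lra.
  - assert (E : RInt f a b = - RInt f b a)
      by (symmetry; apply (opp_RInt_swap f), ex_RInt_cont; auto).
    rewrite E, Rabs_Ropp, <- (Rabs_Ropp (b - a)), (Rabs_pos_eq (- (b - a))) by lra.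
    replace (- (b - a)) with (a - b) by ring.
    apply abs_RInt_le_const; [lra | auto using ex_RInt_cont |].
    intros x Hx; apply H; rewrite Rmin_right, Rmax_left; lra.
Qed.

(** * The fundamental theorem of calculus and rules of differentiation *)

Lemma RInt_FTC (F f : R -> R) (a b : R) :
  (forall x, is_derive F x (f x)) -> cont f -> RInt f a b = F b - F a.
Proof.
  intros HF Hf; apply is_RInt_unique.
  apply (is_RInt_derive F f); intros; [apply HF | apply Hf].
Qed.

Lemma is_derive_prim (f : R -> R) (a x : R) : cont f ->
  is_derive (fun y => RInt f a y) x (f x).
Proof.
  intros Hf; apply (is_derive_RInt f _ a); [|apply Hf].
  apply filter_forall; intros y; apply (RInt_correct f), ex_RInt_cont; auto.
Qed.

Lemma cont_prim (f : R -> R) (a : R) : cont f -> cont (fun x => RInt f a x).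
Proof. intros Hf; apply (cont_derive _ f); intros x; apply is_derive_prim; auto. Qed.

Lemma RInt_shift (f : R -> R) (a b c : R) : cont f ->
  RInt (fun x => f (x + c)) a b = RInt f (a + c) (b + c).
Proof.
  intros Hf.
  transitivity (RInt f 0 (b + c) - RInt f 0 (a + c)).
  - apply (RInt_FTC (fun x => RInt f 0 (x + c))); [|cnt].
    intros x; evar_last.
    + apply (is_derive_comp (fun y => RInt f 0 y) (fun x => x + c)).
      * apply is_derive_prim; auto.
      * auto_derive; [auto | reflexivity].
    + toR; ring.
  - pose proof (RInt_Chasles_cont f 0 (a + c) (b + c) Hf); lra.
Qed.

Lemma is_derive_mult_R (f g : R -> R) (x df dg : R) :
  is_derive f x df -> is_derive g x dg ->
  is_derive (fun y => f y * g y) x (df * g x + f x * dg).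
Proof. intros Hf Hg; apply (is_derive_mult f g x df dg Hf Hg); intros; apply Rmult_comm. Qed.

Lemma is_derive_comp_R (f g : R -> R) (x df dg : R) :
  is_derive f (g x) df -> is_derive g x dg -> is_derive (fun y => f (g y)) x (df * dg).
Proof.
  intros Hf Hg; evar_last; [apply (is_derive_comp f g); eauto|].
  toR; ring.
Qed.

Lemma is_derive_plus_R (f g : R -> R) (x df dg : R) :
  is_derive f x df -> is_derive g x dg -> is_derive (fun y => f y + g y) x (df + dg).
Proof. intros; apply (is_derive_plus f g); auto. Qed.

Lemma is_derive_minus_R (f g : R -> R) (x df dg : R) :
  is_derive f x df -> is_derive g x dg -> is_derive (fun y => f y - g y) x (df - dg).
Proof. intros; apply (is_derive_minus f g); auto. Qed.

Lemma is_derive_const_R (c x : R) : is_derive (fun _ => c) x 0.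
Proof. apply (is_derive_const c x). Qed.

Lemma is_derive_scal_R (c : R) (f : R -> R) (x df : R) :
  is_derive f x df -> is_derive (fun y => c * f y) x (c * df).
Proof. intros; apply (is_derive_scal f x c df); auto. Qed.

Lemma is_derive_exp_R (f : R -> R) (x df : R) :
  is_derive f x df -> is_derive (fun y => exp (f y)) x (df * exp (f x)).
Proof.
  intros H; rewrite Rmult_comm; apply (is_derive_comp_R exp); auto; apply is_derive_exp.
Qed.

Lemma is_derive_eq (f : R -> R) (x a b : R) : is_derive f x a -> a = b -> is_derive f x b.
Proof. intros H <-; exact H. Qed.

Lemma RInt_by_parts (f df g dg : R -> R) (a b : R) :
  (forall x, is_derive f x (df x)) -> (forall x, is_derive g x (dg x)) ->
  cont df -> cont dg ->
  RInt (fun x => df x * g x) a b = f b * g b - f a * g a - RInt (fun x => f x * dg x) a b.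
Proof.
  intros Hf Hg Cdf Cdg.
  assert (Cf : cont f) by (apply (cont_derive f df); auto).
  assert (Cg : cont g) by (apply (cont_derive g dg); auto).
  rewrite <- (RInt_FTC (fun x => f x * g x) (fun x => df x * g x + f x * dg x) a b).
  - rewrite RInt_plus_cont; [rng | cnt | cnt].
  - intros x; apply is_derive_mult_R; auto.
  - cnt.
Qed.

Lemma is_derive_zero_const (f : R -> R) : (forall x, is_derive f x 0) -> forall x y, f x = f y.
Proof.
  intros H x y.
  assert (E : RInt (fun _ => 0) x y = f y - f x) by (apply RInt_FTC; [auto | cnt]).
  rewrite RInt_const_R in E; lra.
Qed.

Lemma MVT_R (f df : R -> R) (a b : R) : (forall x, is_derive f x (df x)) ->
  exists c, Rmin a b <= c <= Rmax a b /\ f b - f a = df c * (b - a).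
Proof.
  intros H; destruct (MVT_gen f a b df) as [c [H1 H2]]; auto.
  - intros x _; apply cont_continuity_pt, (cont_derive f df); auto.
  - exists c; auto.
Qed.

Lemma cont_bounded (f : R -> R) (a b : R) : a <= b -> cont f ->
  exists B, 0 < B /\ forall x, a <= x <= b -> Rabs (f x) <= B.
Proof.
  intros Hab Hf.
  destruct (continuity_ab_maj (fun x => Rabs (f x)) a b Hab) as [m [Hm _]].
  - intros c _; apply (cont_continuity_pt (fun x => Rabs (f x))); cnt.
  - exists (Rabs (f m) + 1); split; [pose proof (Rabs_pos (f m)); lra|].
    intros x Hx; specialize (Hm x Hx); lra.
Qed.

(** * Periodic functions *)

Lemma periodic1_mult (f g : R -> R) : periodic1 f -> periodic1 g -> periodic1 (fun x => f x * g x).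
Proof. intros Hf Hg x; rewrite Hf, Hg; ring. Qed.

Lemma periodic1_IZR (f : R -> R) : periodic1 f -> forall (k : Z) x, f (x + IZR k) = f x.
Proof.
  intros Hf.
  assert (Hn : forall n x, f (x + INR n) = f x).
  { induction n as [|n IH]; intros x.
    - simpl; f_equal; ring.
    - rewrite S_INR, <- Rplus_assoc, Hf; apply IH. }
  intros k x; destruct (Z_le_dec 0 k) as [Hk|Hk].
  - rewrite <- (Z2Nat.id k) by lia; rewrite <- INR_IZR_INZ; apply Hn.
  - rewrite <- (Hn (Z.to_nat (- k)) (x + IZR k)).
    rewrite INR_IZR_INZ, Z2Nat.id, opp_IZR by lia.
    f_equal; ring.
Qed.

Lemma unit_shift (x : R) : exists (k : Z) y, 0 <= y < 1 /\ x = y + IZR k.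
Proof.
  destruct (archimed x) as [H1 H2].
  exists (up x - 1)%Z, (x - IZR (up x - 1)); rewrite minus_IZR; split; lra.
Qed.

Lemma periodic1_ind (f : R -> R) (P : R -> Prop) : periodic1 f ->
  (forall x, 0 <= x <= 1 -> P (f x)) -> forall x, P (f x).
Proof.
  intros Hf H x; destruct (unit_shift x) as [k [y [Hy ->]]].
  rewrite periodic1_IZR; auto; apply H; lra.
Qed.

Lemma RInt_periodic1 (f : R -> R) (a : R) : periodic1 f -> cont f ->
  RInt f a (a + 1) = RInt f 0 1.
Proof.
  intros Pf Cf.
  assert (E : RInt f 1 (a + 1) = RInt f 0 a).
  { rewrite <- (RInt_ext_R (fun x => f (x + 1)) f 0 a) by apply Pf.
    rewrite RInt_shift by auto; f_equal; ring. }
  pose proof (RInt_Chasles_cont f a 0 (a + 1) Cf).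
  pose proof (RInt_Chasles_cont f a 0 a Cf).
  pose proof (RInt_Chasles_cont f 0 1 (a + 1) Cf).
  pose proof (RInt_point a f) as E0; change zero with 0 in E0.
  lra.
Qed.

Lemma periodic1_prim (f : R -> R) (a : R) : periodic1 f -> cont f -> RInt f 0 1 = 0 ->
  periodic1 (fun x => RInt f a x).
Proof.
  intros Pf Cf H x.
  rewrite <- (RInt_Chasles_cont f a x (x + 1)), (RInt_periodic1 f x), H by auto; rng.
Qed.

Lemma periodic1_derive (f df : R -> R) : periodic1 f ->
  (forall x, is_derive f x (df x)) -> periodic1 df.
Proof.
  intros Pf H x.
  assert (H1 : is_derive f x (df (x + 1) * 1)).
  { apply (is_derive_ext (fun y => f (y + 1))); [exact Pf|].
    apply (is_derive_comp_R f (fun y => y + 1)); [apply H|].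
    auto_derive; [auto | reflexivity]. }
  rewrite <- (is_derive_unique _ _ _ (H x)), (is_derive_unique _ _ _ H1); ring.
Qed.

Lemma RInt_by_parts_periodic1 (f df g dg : R -> R) :
  (forall x, is_derive f x (df x)) -> (forall x, is_derive g x (dg x)) ->
  cont df -> cont dg -> periodic1 f -> periodic1 g ->
  RInt (fun x => df x * g x) 0 1 = - RInt (fun x => f x * dg x) 0 1.
Proof.
  intros Hf Hg Cf Cg Pf Pg; rewrite (RInt_by_parts f df g dg); auto.
  rewrite <- (Pf 0), <- (Pg 0), Rplus_0_l; rng.
Qed.

Lemma RInt_derive_periodic1 (f df : R -> R) :
  (forall x, is_derive f x (df x)) -> cont df -> periodic1 f -> RInt df 0 1 = 0.
Proof.
  intros Hf Cf Pf; rewrite (RInt_FTC f); auto.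
  rewrite <- (Pf 0), Rplus_0_l; rng.
Qed.

(** The primitive vanishing at [x] is nondecreasing, and periodic because the total integral is 0,
    so it is zero within distance 1 of [x]; its derivative at [x], which is [f x], is then 0. *)
Lemma RInt_eq_0_nonneg (f : R -> R) : periodic1 f -> cont f -> (forall x, 0 <= f x) ->
  RInt f 0 1 = 0 -> forall x, f x = 0.
Proof.
  intros Pf Cf Hf H x.
  set (G := fun y => RInt f x y).
  assert (PG : periodic1 G) by (apply periodic1_prim; auto).
  assert (G0 : G x = 0) by (unfold G; apply (RInt_point x f)).
  assert (Hmono : forall y z, y <= z -> G y <= G z).
  { intros y z Hyz; unfold G; rewrite <- (RInt_Chasles_cont f x y z) by auto.
    pose proof (RInt_ge_0_cont f y z Hyz Cf (fun w _ => Hf w)); lra. }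
  assert (Hz : forall y, Rabs (y - x) < 1 -> G y = 0).
  { intros y Hy; apply Rabs_lt_between in Hy.
    pose proof (Hmono y (x + 1)); pose proof (Hmono (x + -1) y).
    rewrite PG in *.
    assert (G (x + -1) = 0) by (rewrite <- (PG (x + -1)), <- G0; f_equal; ring).
    lra. }
  assert (D : is_derive G x 0).
  { apply (is_derive_ext_loc (fun _ => 0)); [|apply is_derive_const_R].
    exists (mkposreal 1 Rlt_0_1); intros y Hy; symmetry; apply Hz; exact Hy. }
  rewrite <- (is_derive_unique _ _ _ D); symmetry.
  apply is_derive_unique, is_derive_prim; auto.
Qed.

(** * Jointly continuous functions of two variables *)

(** Continuity on the product space gives access to the composition lemmas for filters, while the
    epsilon-delta form of [cont2] serves the estimates. *)
Lemma cont2_spec (f : R -> R -> R) : cont2 f <->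
  forall p : R * R, continuous (fun p => f (fst p) (snd p)) p.
Proof.
  split.
  - intros H [t x]; exact (proj1 (continuity_2d_pt_filterlim f t x) (H t x)).
  - intros H t x; exact (proj2 (continuity_2d_pt_filterlim f t x) (H (t, x))).
Qed.

Lemma cont2_ext (f g : R -> R -> R) : (forall t x, f t x = g t x) -> cont2 f -> cont2 g.
Proof.
  intros H Hf; apply cont2_spec; intros p.
  apply (continuous_ext (fun p => f (fst p) (snd p))); [intros; apply H|].
  apply cont2_spec; auto.
Qed.

Lemma cont2_comp2 (h f g : R -> R -> R) : cont2 h -> cont2 f -> cont2 g ->
  cont2 (fun t x => h (f t x) (g t x)).
Proof.
  intros Hh Hf Hg; apply cont2_spec; intros p.
  apply (continuous_comp_2 (fun p => f (fst p) (snd p)) (fun p => g (fst p) (snd p)) h).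
  - apply cont2_spec; auto.
  - apply cont2_spec; auto.
  - apply (proj1 (cont2_spec h) Hh).
Qed.

Lemma cont2_fst (f : R -> R) : cont f -> cont2 (fun t _ => f t).
Proof.
  intros Hf; apply cont2_spec; intros p.
  apply (continuous_comp fst f); [apply continuous_fst | apply Hf].
Qed.

Lemma cont2_snd (f : R -> R) : cont f -> cont2 (fun _ x => f x).
Proof.
  intros Hf; apply cont2_spec; intros p.
  apply (continuous_comp snd f); [apply continuous_snd | apply Hf].
Qed.

Lemma cont2_comp (g : R -> R) (f : R -> R -> R) : cont g -> cont2 f -> cont2 (fun t x => g (f t x)).
Proof.
  intros Hg Hf; apply cont2_spec; intros p.
  apply (continuous_comp (fun p => f (fst p) (snd p)) g); [apply cont2_spec; auto | apply Hg].
Qed.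

Lemma cont2_plus (f g : R -> R -> R) : cont2 f -> cont2 g -> cont2 (fun t x => f t x + g t x).
Proof.
  intros Hf Hg t x; exact (continuity_2d_pt_plus f g t x (Hf t x) (Hg t x)).
Qed.

Lemma cont2_opp (f : R -> R -> R) : cont2 f -> cont2 (fun t x => - f t x).
Proof. intros Hf t x; exact (continuity_2d_pt_opp f t x (Hf t x)). Qed.

Lemma cont2_minus (f g : R -> R -> R) : cont2 f -> cont2 g -> cont2 (fun t x => f t x - g t x).
Proof.
  intros Hf Hg t x; exact (continuity_2d_pt_minus f g t x (Hf t x) (Hg t x)).
Qed.

Lemma cont2_mult (f g : R -> R -> R) : cont2 f -> cont2 g -> cont2 (fun t x => f t x * g t x).
Proof.
  intros Hf Hg t x; exact (continuity_2d_pt_mult f g t x (Hf t x) (Hg t x)).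
Qed.

Lemma cont2_div (f : R -> R -> R) (c : R) : cont2 f -> cont2 (fun t x => f t x / c).
Proof. intros Hf; apply cont2_mult; [exact Hf | apply cont2_fst, cont_const]. Qed.

Lemma cont2_pow (f : R -> R -> R) (n : nat) : cont2 f -> cont2 (fun t x => f t x ^ n).
Proof.
  intros Hf; induction n as [|n IH]; simpl.
  - apply cont2_fst, cont_const.
  - apply cont2_mult; auto.
Qed.

Lemma cont2_swap (f : R -> R -> R) : cont2 f -> cont2 (fun x t => f t x).
Proof.
  intros Hf; apply (cont2_comp2 f (fun _ t => t) (fun x _ => x)); auto.
  - apply (cont2_snd (fun x => x)), cont_id.
  - apply (cont2_fst (fun x => x)), cont_id.
Qed.

Lemma cont2_slice (f : R -> R -> R) (t : R) : cont2 f -> cont (f t).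
Proof.
  intros Hf; apply eps_cont; intros x e He.
  destruct (Hf t x (mkposreal e He)) as [d Hd].
  exists d; split; [apply cond_pos|]; intros y Hy; apply (Hd t y); auto.
  rewrite Rminus_diag, Rabs_R0; apply cond_pos.
Qed.

Lemma cont2_slice_l (f : R -> R -> R) (x : R) : cont2 f -> cont (fun t => f t x).
Proof. intros Hf; apply (cont2_slice (fun x t => f t x)), cont2_swap, Hf. Qed.

Ltac cnt2 := repeat match goal with
  | |- cont2 (fun t x => @?f t x + @?g t x) => apply (cont2_plus f g)
  | |- cont2 (fun t x => @?f t x - @?g t x) => apply (cont2_minus f g)
  | |- cont2 (fun t x => - @?f t x) => apply (cont2_opp f)
  | |- cont2 (fun t x => @?f t x * @?g t x) => apply (cont2_mult f g)
  | |- cont2 (fun t x => @?f t x / ?c) => apply (cont2_div f c)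
  | |- cont2 (fun t x => @?f t x ^ ?n) => apply (cont2_pow f n)
  | |- cont2 (fun t x => exp (@?f t x)) => apply (cont2_comp exp f cont_exp)
  | |- cont2 (fun t x => sin (@?f t x)) => apply (cont2_comp sin f cont_sin)
  | |- cont2 (fun t x => cos (@?f t x)) => apply (cont2_comp cos f cont_cos)
  | |- cont2 (fun t _ => @?f t) => apply (cont2_fst f); solve [cnt]
  | |- cont2 (fun _ x => @?f x) => apply (cont2_snd f); solve [cnt]
  | |- cont2 (fun t x => ?g t x) =>
      match goal with H : cont2 ?h |- _ => constr_eq g h; exact H end
  | _ => assumption
  | H : cont ?h |- cont2 (fun t x => ?h (@?f t x)) => apply (cont2_comp h f H)
  end.

(** Compactness of the interval makes continuity in the first variable uniform in the second. *)
Lemma cont2_unif (f : R -> R -> R) (t a b e : R) : cont2 f -> 0 < e ->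
  exists d, 0 < d /\ forall r, Rabs (r - t) < d ->
    forall x, a <= x <= b -> Rabs (f r x - f t x) < e.
Proof.
  intros Hf He.
  destruct (uniform_continuity_2d_1d' f a b t (fun x _ => Hf t x) (mkposreal e He)) as [d Hd].
  pose proof (cond_pos d) as Hd0.
  exists d; split; [exact Hd0|].
  intros r Hr x Hx; apply Rabs_lt_between in Hr.
  apply Hd; try lra.
  rewrite Rminus_diag, Rabs_R0; exact Hd0.
Qed.

Lemma cont2_bounded (f : R -> R -> R) (t : R) : cont2 f ->
  exists d B, 0 < d /\ 0 < B /\ forall r, Rabs (r - t) < d ->
    forall x, 0 <= x <= 1 -> Rabs (f r x) <= B.
Proof.
  intros Hf.
  destruct (cont2_unif f t 0 1 1 Hf Rlt_0_1) as [d [Hd H]].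
  destruct (cont_bounded (f t) 0 1 Rle_0_1 (cont2_slice f t Hf)) as [B [HB HB']].
  exists d, (B + 1); split; [exact Hd|]; split; [lra|].
  intros r Hr x Hx; specialize (H r Hr x Hx); specialize (HB' x Hx).
  replace (f r x) with (f r x - f t x + f t x) by ring.
  pose proof (Rabs_triang (f r x - f t x) (f t x)); lra.
Qed.

Lemma cont2_RInt (f : R -> R -> R) (a : R) : cont2 f -> cont2 (fun t x => RInt (f t) a x).
Proof.
  intros Hf t x [e He]; simpl.
  (* For [y] within 1 of [x], the integration interval is shorter than [L] and lies inside the
     enlarged interval of uniform closeness. Moving the integrand and moving the endpoint then cost
     at most [e / 2] each. *)
  set (L := Rabs (x - a) + 1).
  assert (HL : 0 < L) by (unfold L; pose proof (Rabs_pos (x - a)); lra).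
  assert (He' : 0 < e / (2 * L)) by (apply Rdiv_lt_0_compat; lra).
  destruct (cont2_unif f t (Rmin a x - 1) (Rmax a x + 1) _ Hf He') as [d1 [Hd1 H1]].
  destruct (cont_eps (fun y => RInt (f t) a y) x (e / 2)) as [d2 [Hd2 H2]];
    [apply cont_prim, cont2_slice, Hf | lra |].
  assert (Hd : 0 < Rmin 1 (Rmin d1 d2)) by (repeat apply Rmin_pos; lra).
  exists (mkposreal _ Hd); simpl; intros r y Hr Hy.
  assert (Hr1 : Rabs (r - t) < d1).
  { eapply Rlt_le_trans; [apply Hr|]; eapply Rle_trans; [apply Rmin_r | apply Rmin_l]. }
  assert (Hy2 : Rabs (y - x) < d2).
  { eapply Rlt_le_trans; [apply Hy|]; eapply Rle_trans; [apply Rmin_r | apply Rmin_r]. }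
  assert (Hy1 : Rabs (y - x) < 1) by (eapply Rlt_le_trans; [apply Hy | apply Rmin_l]).
  specialize (H2 y Hy2).
  assert (E : Rabs (RInt (fun z => f r z - f t z) a y) <= Rabs (y - a) * (e / (2 * L))).
  { apply RInt_abs_le_cont.
    - apply cont_minus; apply cont2_slice; auto.
    - intros z Hz; left; apply H1; auto.
      apply Rabs_lt_between in Hy1.
      revert Hz; unfold Rmin, Rmax; repeat destruct Rle_dec; lra. }
  assert (E' : Rabs (y - a) * (e / (2 * L)) <= L * (e / (2 * L))).
  { apply Rmult_le_compat_r; [lra|]; unfold L.
    replace (y - a) with ((y - x) + (x - a)) by ring.
    pose proof (Rabs_triang (y - x) (x - a)); lra. }
  replace (L * (e / (2 * L))) with (e / 2) in E' by (field; lra).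
  rewrite RInt_minus_cont in E by (apply cont2_slice; auto).
  replace (RInt (f r) a y - RInt (f t) a x) with
    ((RInt (f r) a y - RInt (f t) a y) + (RInt (f t) a y - RInt (f t) a x)) by rng.
  eapply Rle_lt_trans; [apply Rabs_triang|]; lra.
Qed.

Lemma cont2_RInt_l (f : R -> R -> R) (a : R) : cont2 f ->
  cont2 (fun t x => RInt (fun s => f s x) a t).
Proof. intros Hf; apply (cont2_swap (fun x t => _)), cont2_RInt, cont2_swap, Hf. Qed.

Lemma cont_RInt_param (f : R -> R -> R) (a b : R) : cont2 f -> cont (fun t => RInt (f t) a b).
Proof. intros Hf; apply (cont2_slice_l (fun t x => RInt (f t) a x)), cont2_RInt, Hf. Qed.

Lemma is_derive_RInt_param_cont (f ft : R -> R -> R) (a b t : R) :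
  (forall t x, is_derive (fun s => f s x) t (ft t x)) -> (forall t, cont (f t)) -> cont2 ft ->
  is_derive (fun s => RInt (f s) a b) t (RInt (ft t) a b).
Proof.
  intros H Hf Hft.
  assert (E : forall s x, Derive (fun z => f z x) s = ft s x)
    by (intros; apply is_derive_unique, H).
  rewrite <- (RInt_ext_R (fun x => Derive (fun z => f z x) t)) by apply E.
  apply (is_derive_RInt_param f).
  - apply filter_forall; intros s x _; exists (ft s x); apply H.
  - intros x _; apply (cont2_ext ft); [symmetry; apply E | exact Hft].
  - apply filter_forall; intros s; apply ex_RInt_cont; auto.
Qed.

(** * A nonlocal ordinary differential equation on the circle *)

Lemma cont_inv (f : R -> R) : cont f -> (forall x, f x <> 0) -> cont (fun x => / f x).
Proof. intros Hf H x; apply (continuous_comp f Rinv); [apply Hf | apply continuous_Rinv, H]. Qed.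

Lemma RInt_abs_le_fun (f g : R -> R) (a b : R) : a <= b -> cont f -> cont g ->
  (forall x, a <= x <= b -> Rabs (f x) <= g x) -> Rabs (RInt f a b) <= RInt g a b.
Proof.
  intros Hab Cf Cg H; apply Rabs_le_between; split.
  - rewrite <- RInt_opp_cont by auto; apply RInt_le_cont; auto; [cnt|].
    intros x Hx; specialize (H x Hx); apply Rabs_le_between in H; lra.
  - apply RInt_le_cont; auto.
    intros x Hx; specialize (H x Hx); apply Rabs_le_between in H; lra.
Qed.

(** * Normalised densities and their stability under multiplicative perturbations *)

Definition dens (w : R -> R) (x : R) : R := w x / RInt w 0 1.

Section Density.

Variables (w : R -> R).
Hypotheses (Cw : cont w) (w_ge0 : forall x, 0 <= w x) (w_pos : 0 < RInt w 0 1).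

Lemma cont_dens : cont (dens w).
Proof. unfold dens; cnt. Qed.

Lemma dens_ge0 (x : R) : 0 <= dens w x.
Proof. apply Rdiv_le_0_compat; auto. Qed.

Lemma RInt_dens : RInt (dens w) 0 1 = 1.
Proof.
  rewrite (RInt_ext_R _ (fun x => / RInt w 0 1 * w x))
    by (intros; unfold dens, Rdiv; apply Rmult_comm).
  rewrite RInt_scal_cont by auto; apply Rinv_l; lra.
Qed.

Lemma RInt_dens_bounds (x : R) : 0 <= x <= 1 -> 0 <= RInt (dens w) 0 x <= 1.
Proof.
  intros Hx; split.
  - apply RInt_ge_0_cont; [lra | apply cont_dens | intros; apply dens_ge0].
  - pose proof (RInt_Chasles_cont (dens w) 0 x 1 cont_dens) as H.
    rewrite RInt_dens in H.
    pose proof (RInt_ge_0_cont (dens w) x 1 (proj2 Hx) cont_dens (fun y _ => dens_ge0 y)).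
    lra.
Qed.

End Density.

Section DensityCompare.

Variables (w1 w2 : R -> R) (E : R).
Hypotheses (C1 : cont w1) (C2 : cont w2).
Hypotheses (w1_ge0 : forall x, 0 <= w1 x).
Hypotheses (w1_pos : 0 < RInt w1 0 1) (w2_pos : 0 < RInt w2 0 1).
Hypotheses (w1_le : forall x, 0 <= x <= 1 -> w1 x <= E * w2 x)
  (w2_le : forall x, 0 <= x <= 1 -> w2 x <= E * w1 x).

(** One factor [E] compares the numerators, the other the total masses that divide them. *)
Lemma dens_ratio (x : R) : 0 <= x <= 1 -> dens w1 x <= E ^ 2 * dens w2 x.
Proof.
  intros Hx; unfold dens.
  assert (I : RInt w2 0 1 <= E * RInt w1 0 1).
  { rewrite <- RInt_scal_cont by auto; apply RInt_le_cont; auto; [lra | cnt]. }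
  specialize (w1_le x Hx).
  assert (0 <= E) by (apply Rnot_lt_le; intros HE; nra).
  apply (Rmult_le_reg_r (RInt w1 0 1 * RInt w2 0 1)); [nra|].
  replace (w1 x / RInt w1 0 1 * (RInt w1 0 1 * RInt w2 0 1)) with (w1 x * RInt w2 0 1)
    by (field; lra).
  replace (E ^ 2 * (w2 x / RInt w2 0 1) * (RInt w1 0 1 * RInt w2 0 1))
    with ((E * w2 x) * (E * RInt w1 0 1)) by (field; lra).
  apply Rmult_le_compat; auto; lra.
Qed.

End DensityCompare.

Section DensityClose.

Variables (w1 w2 : R -> R) (E : R).
Hypotheses (C1 : cont w1) (C2 : cont w2).
Hypotheses (w1_ge0 : forall x, 0 <= w1 x) (w2_ge0 : forall x, 0 <= w2 x).
Hypotheses (w1_pos : 0 < RInt w1 0 1) (w2_pos : 0 < RInt w2 0 1).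
Hypotheses (w1_le : forall x, 0 <= x <= 1 -> w1 x <= E * w2 x)
  (w2_le : forall x, 0 <= x <= 1 -> w2 x <= E * w1 x).

(** Comparing the two total masses in both directions shows that [E] is positive and cannot be below
    1. *)
Lemma ratio_ge1 : 1 <= E ^ 2.
Proof.
  assert (I1 : RInt w2 0 1 <= E * RInt w1 0 1).
  { rewrite <- RInt_scal_cont by auto; apply RInt_le_cont; auto; [lra | cnt]. }
  assert (I2 : RInt w1 0 1 <= E * RInt w2 0 1).
  { rewrite <- RInt_scal_cont by auto; apply RInt_le_cont; auto; [lra | cnt]. }
  assert (H : 0 < E) by (apply Rnot_le_lt; intros HE; nra).
  assert (1 <= E) by (apply Rnot_lt_le; intros HE; nra).
  nra.
Qed.

(** The error is relative: it is measured by the densities themselves, so that it integrates to a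
    bound free of their pointwise size. *)
Lemma dens_close (x : R) : 0 <= x <= 1 ->
  Rabs (dens w1 x - dens w2 x) <= (E ^ 2 - 1) * (dens w1 x + dens w2 x).
Proof.
  intros Hx.
  pose proof (dens_ratio w1 w2 E C1 C2 w1_ge0 w1_pos w2_pos w1_le w2_le x Hx).
  pose proof (dens_ratio w2 w1 E C2 C1 w2_ge0 w2_pos w1_pos w2_le w1_le x Hx).
  pose proof (dens_ge0 w1 w1_ge0 w1_pos x).
  pose proof (dens_ge0 w2 w2_ge0 w2_pos x).
  pose proof ratio_ge1.
  apply Rabs_le_between; nra.
Qed.

Lemma RInt_dens_close (x : R) : 0 <= x <= 1 ->
  Rabs (RInt (dens w1) 0 x - RInt (dens w2) 0 x) <= E ^ 2 - 1.
Proof.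
  intros Hx.
  assert (D1 := cont_dens w1 C1); assert (D2 := cont_dens w2 C2).
  pose proof (RInt_dens_bounds w1 C1 w1_ge0 w1_pos x Hx) as B1.
  pose proof (RInt_dens_bounds w2 C2 w2_ge0 w2_pos x Hx) as B2.
  assert (I1 : RInt (dens w1) 0 x <= E ^ 2 * RInt (dens w2) 0 x).
  { rewrite <- RInt_scal_cont by auto; apply RInt_le_cont; [lra | auto | cnt |].
    intros y Hy; apply dens_ratio; auto; lra. }
  assert (I2 : RInt (dens w2) 0 x <= E ^ 2 * RInt (dens w1) 0 x).
  { rewrite <- RInt_scal_cont by auto; apply RInt_le_cont; [lra | auto | cnt |].
    intros y Hy; apply dens_ratio; auto; lra. }
  pose proof ratio_ge1.
  apply Rabs_le_between; nra.
Qed.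

Lemma RInt_dens_mult_close (W1 W2 : R -> R) (eta b : R) : cont W1 -> cont W2 ->
  (forall x, 0 <= x <= 1 -> Rabs (W1 x - W2 x) <= eta) ->
  (forall x, 0 <= x <= 1 -> Rabs (W2 x) <= b) ->
  Rabs (RInt (fun x => dens w1 x * W1 x) 0 1 - RInt (fun x => dens w2 x * W2 x) 0 1)
    <= eta + 2 * b * (E ^ 2 - 1).
Proof.
  intros CW1 CW2 H1 H2.
  assert (D1 := cont_dens w1 C1); assert (D2 := cont_dens w2 C2).
  rewrite <- RInt_minus_cont by cnt.
  (* Each density has mass 1: hence the factor 1 on [eta], and the factor 2 from the sum of the two
     densities. *)
  replace (eta + 2 * b * (E ^ 2 - 1)) with
    (RInt (fun x => eta * dens w1 x + b * (E ^ 2 - 1) * (dens w1 x + dens w2 x)) 0 1).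
  - apply RInt_abs_le_fun; [lra | cnt | cnt |]; intros x Hx.
    replace (dens w1 x * W1 x - dens w2 x * W2 x) with
      (dens w1 x * (W1 x - W2 x) + (dens w1 x - dens w2 x) * W2 x) by ring.
    eapply Rle_trans; [apply Rabs_triang|]; rewrite !Rabs_mult.
    pose proof (dens_ge0 w1 w1_ge0 w1_pos x) as P1.
    rewrite (Rabs_pos_eq (dens w1 x)) by auto.
    apply Rplus_le_compat.
    + rewrite Rmult_comm; apply Rmult_le_compat_r; auto.
    + pose proof (dens_close x Hx).
      rewrite Rmult_comm, Rmult_assoc.
      apply Rmult_le_compat; auto using Rabs_pos.
  - rewrite RInt_plus_cont, !RInt_scal_cont, RInt_plus_cont by cnt.
    rewrite !RInt_dens by auto; rng.
Qed.

End DensityClose.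

(** * Geometric convergence, limits of jointly continuous functions and weighted integrals *)

Lemma geometric_limit (u : nat -> R) (C : R) :
  (forall n, Rabs (u (S n) - u n) <= C / 2 ^ n) ->
  forall n, Rabs (u n - Lim_seq u) <= 2 * C / 2 ^ n.
Proof.
  intros H.
  assert (P : forall n, 0 < 2 ^ n) by (intros; apply pow_lt; lra).
  assert (HC : 0 <= C).
  { specialize (H 0%nat); simpl in H; pose proof (Rabs_pos (u 1%nat - u 0%nat)); lra. }
  (* Subtracting the remaining tail [2 * C / 2 ^ (n + k)] makes the induction on [k] close
     exactly. *)
  assert (B : forall n k, Rabs (u (n + k)%nat - u n) <= 2 * C / 2 ^ n - 2 * C / 2 ^ (n + k)).
  { intros n; induction k as [|k IH].
    - rewrite Nat.add_0_r, Rminus_diag, Rabs_R0; lra.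
    - replace (n + S k)%nat with (S (n + k)) by lia.
      replace (u (S (n + k)) - u n)
        with ((u (S (n + k)) - u (n + k)%nat) + (u (n + k)%nat - u n)) by ring.
      eapply Rle_trans; [apply Rabs_triang|].
      specialize (H (n + k)%nat).
      replace (2 * C / 2 ^ S (n + k)) with (C / 2 ^ (n + k))
        by (simpl; field; apply Rgt_not_eq, P).
      lra. }
  assert (B' : forall n k, Rabs (u (n + k)%nat - u n) <= 2 * C / 2 ^ n).
  { intros n k; specialize (B n k).
    assert (0 <= 2 * C / 2 ^ (n + k)) by (apply Rdiv_le_0_compat; [lra | apply P]); lra. }
  assert (L : is_lim_seq (fun n => 2 * C / 2 ^ n) 0).
  { apply (is_lim_seq_ext (fun n => 2 * C * (/ 2) ^ n)).
    - intros n; rewrite pow_inv; reflexivity.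
    - replace (Finite 0) with (Rbar_mult (2 * C) 0) by (simpl; f_equal; ring).
      apply is_lim_seq_scal_l, is_lim_seq_geom; rewrite Rabs_pos_eq; lra. }
  assert (Ex : ex_finite_lim_seq u).
  { apply ex_lim_seq_cauchy_corr; intros e.
    apply is_lim_seq_spec in L; destruct (L (pos_div_2 e)) as [N HN].
    specialize (HN N (Nat.le_refl N)); rewrite Rminus_0_r in HN; simpl in HN.
    apply Rabs_lt_between in HN.
    exists N; intros n m Hn Hm.
    pose proof (B' N (n - N)%nat) as Bn; pose proof (B' N (m - N)%nat) as Bm.
    replace (N + (n - N))%nat with n in Bn by lia.
    replace (N + (m - N))%nat with m in Bm by lia.
    replace (u n - u m) with ((u n - u N) - (u m - u N)) by ring.
    eapply Rle_lt_trans; [apply Rabs_triang|]; rewrite Rabs_Ropp; lra. }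
  intros n; apply Lim_seq_correct' in Ex.
  assert (F : is_lim_seq (fun k => Rabs (u (k + n)%nat - u n)) (Rabs (Lim_seq u - u n))).
  { apply (is_lim_seq_abs _ (Finite (Lim_seq u - u n))), (is_lim_seq_minus' _ (fun _ => u n)).
    - apply (is_lim_seq_incr_n u n); exact Ex.
    - apply is_lim_seq_const. }
  rewrite <- Rabs_Ropp; replace (- (u n - Lim_seq u)) with (Lim_seq u - u n) by ring.
  apply (is_lim_seq_le (fun k => Rabs (u (k + n)%nat - u n)) (fun _ => 2 * C / 2 ^ n)
    (Rabs (Lim_seq u - u n)) (2 * C / 2 ^ n)); auto using is_lim_seq_const.
  intros k; rewrite Nat.add_comm; apply B'.
Qed.

Lemma geometric_zero (a C : R) : (forall n : nat, Rabs a <= C / 2 ^ n) -> a = 0.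
Proof.
  intros H; apply Rabs_eq_0, Rle_antisym; [|apply Rabs_pos].
  apply (is_lim_seq_le (fun _ => Rabs a) (fun n => C / 2 ^ n) (Rabs a) 0);
    auto using is_lim_seq_const.
  apply (is_lim_seq_ext (fun n => C * (/ 2) ^ n)).
  - intros n; rewrite pow_inv; reflexivity.
  - replace (Finite 0) with (Rbar_mult C 0) by (simpl; f_equal; ring).
    apply is_lim_seq_scal_l, is_lim_seq_geom; rewrite Rabs_pos_eq; lra.
Qed.

Lemma cont2_limit (f : nat -> R -> R -> R) (g : R -> R -> R) : (forall n, cont2 (f n)) ->
  (forall t e, 0 < e -> exists d n, 0 < d /\
    forall r x, Rabs (r - t) < d -> Rabs (f n r x - g r x) <= e) -> cont2 g.
Proof.
  intros Hf H t x [e He]; simpl.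
  destruct (H t (e / 4)) as [d [n [Hd Hn]]]; [lra|].
  assert (He2 : 0 < e / 2) by lra.
  destruct (Hf n t x (mkposreal _ He2)) as [d' Hd']; simpl in Hd'.
  assert (Hm : 0 < Rmin d d') by (apply Rmin_pos; [lra | apply cond_pos]).
  exists (mkposreal _ Hm); simpl; intros r y Hr Hy.
  specialize (Hd' r y (Rlt_le_trans _ _ _ Hr (Rmin_r _ _)) (Rlt_le_trans _ _ _ Hy (Rmin_r _ _))).
  pose proof (Hn r y (Rlt_le_trans _ _ _ Hr (Rmin_l _ _))) as A1.
  assert (A2 : Rabs (f n t x - g t x) <= e / 4)
    by (apply Hn; rewrite Rminus_diag, Rabs_R0; exact Hd).
  apply Rabs_lt_between in Hd'; apply Rabs_le_between in A1; apply Rabs_le_between in A2.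
  apply Rabs_lt_between; lra.
Qed.

(** Bielecki's weight: integrating $e^{2K|s|}$ gains a factor $1/(2K)$, which turns a Lipschitz
    constant [K] into a contraction by one half on the whole time axis instead of a short
    interval. *)
Lemma RInt_exp_weight (g : R -> R) (K D t : R) : 0 < K -> cont g ->
  (forall s, Rabs (g s) <= K * D * exp (2 * K * Rabs s)) ->
  Rabs (RInt g 0 t) <= D / 2 * exp (2 * K * Rabs t).
Proof.
  intros HK Cg H.
  assert (HD : 0 <= D).
  { specialize (H 0); rewrite Rabs_R0, Rmult_0_r, exp_0 in H.
    pose proof (Rabs_pos (g 0)); apply Rnot_lt_le; intros HD; nra. }
  destruct (Rle_dec 0 t) as [Ht|Ht].
  - rewrite (Rabs_pos_eq t) by auto.
    apply Rle_trans with (RInt (fun s => K * D * exp (2 * K * s)) 0 t).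
    + apply RInt_abs_le_fun; auto; [cnt|].
      intros s Hs; specialize (H s); rewrite (Rabs_pos_eq s) in H by lra; exact H.
    + rewrite (RInt_FTC (fun s => D / 2 * exp (2 * K * s))); [| |cnt].
      * rewrite Rmult_0_r, exp_0; lra.
      * intros s; auto_derive; [auto | field].
  - assert (E : RInt g 0 t = - RInt g t 0)
      by (symmetry; apply (opp_RInt_swap g), ex_RInt_cont; auto).
    rewrite E, Rabs_Ropp, (Rabs_left t) by lra.
    apply Rle_trans with (RInt (fun s => K * D * exp (2 * K * - s)) t 0).
    + apply RInt_abs_le_fun; auto; [lra | cnt |].
      intros s Hs; specialize (H s); rewrite (Rabs_left1 s) in H by lra; exact H.
    + rewrite (RInt_FTC (fun s => - (D / 2) * exp (2 * K * - s))); [| |cnt].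
      * rewrite Ropp_0, Rmult_0_r, exp_0; lra.
      * intros s; auto_derive; [auto | field].
Qed.

Lemma cont2_dens (w : R -> R -> R) : cont2 w -> (forall t, 0 < RInt (w t) 0 1) ->
  cont2 (fun t x => dens (w t) x).
Proof.
  intros Cw Hw; unfold dens, Rdiv; apply cont2_mult; [exact Cw|].
  apply (cont2_fst (fun t => / RInt (w t) 0 1)), cont_inv.
  - apply cont_RInt_param; exact Cw.
  - intros t; apply Rgt_not_eq, Hw.
Qed.

(** From $e^{2d}(1-2d) \le 1$ one gets $e^{2d} - 1 \le 2d\,e^{2d}$, and $e^{2d} \le e^2 \le 9$ for
    [d <= 1] gives the constant 18. *)
Lemma exp_double_bound (d : R) : 0 <= d <= 1 -> exp d ^ 2 - 1 <= 18 * d.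
Proof.
  intros Hd.
  replace (exp d ^ 2) with (exp (2 * d))
    by (simpl; rewrite Rmult_1_r, <- exp_plus; f_equal; ring).
  assert (H1 : 1 + - (2 * d) <= exp (- (2 * d))) by apply exp_ineq1_le.
  rewrite exp_Ropp in H1.
  assert (H2 : exp (2 * d) <= 9).
  { apply Rle_trans with (exp (1 + 1)).
    - destruct (Req_dec (2 * d) (1 + 1)) as [->|]; [lra | left; apply exp_increasing; lra].
    - rewrite exp_plus; pose proof exp_le_3; pose proof (exp_pos 1); nra. }
  pose proof (exp_pos (2 * d)) as H3.
  assert (H4 : exp (2 * d) * (1 + - (2 * d)) <= 1).
  { apply Rle_trans with (exp (2 * d) * / exp (2 * d)).
    - apply Rmult_le_compat_l; lra.
    - rewrite Rinv_r; lra. }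
  nra.
Qed.

(** * Picard iteration for the normalised vector field *)

Section Flow.

Variables (rho : R -> R) (lam : R).
Hypotheses (Crho : cont rho) (Prho : periodic1 rho) (rho_ge0 : forall x, 0 <= rho x)
  (rho_int : RInt rho 0 1 = 1).

(** In terms of the solution, [wp] is the Jacobian $q_x$, and [lam] times [wm] is $(m +
    \kappa)(q)\,q_x$ because $(m + \kappa)(q)\,q_x^2$ equals [nu]. *)
Definition wp (th : R -> R) (x : R) : R := exp (th x).
Definition wm (th : R -> R) (x : R) : R := rho x * exp (- th x).

(** Primitive of the normalised right-hand side of the equation for $V_x$. [Vf] corrects it by the
    constant for which the mean against [dens (wp th)] vanishes, as the mean of $u_x$ must. *)
Definition Wf (th : R -> R) (x : R) : R :=
  lam * RInt (fun y => dens (wp th) y - dens (wm th) y) 0 x.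

Definition Vf (th : R -> R) (x : R) : R :=
  Wf th x - RInt (fun y => dens (wp th) y * Wf th y) 0 1.

Lemma cont_wp (th : R -> R) : cont th -> cont (wp th).
Proof. intros; unfold wp; cnt. Qed.

Lemma cont_wm (th : R -> R) : cont th -> cont (wm th).
Proof. intros; unfold wm; cnt. Qed.

Lemma wp_ge0 (th : R -> R) (x : R) : 0 <= wp th x.
Proof. left; apply exp_pos. Qed.

Lemma wm_ge0 (th : R -> R) (x : R) : 0 <= wm th x.
Proof. apply Rmult_le_pos; [auto | left; apply exp_pos]. Qed.

Lemma wp_pos (th : R -> R) : cont th -> 0 < RInt (wp th) 0 1.
Proof.
  intros H; apply RInt_gt_0; [lra | intros; apply exp_pos |].
  intros x _; apply cont_wp, H.
Qed.

(** [rho] may vanish at some points, so positivity comes from its total mass 1 and from the lower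
    bound [exp (- B)] of the exponential on one period. *)
Lemma wm_pos (th : R -> R) : cont th -> 0 < RInt (wm th) 0 1.
Proof.
  intros H; destruct (cont_bounded th 0 1 Rle_0_1 H) as [B [HB HB']].
  apply Rlt_le_trans with (RInt (fun x => exp (- B) * rho x) 0 1).
  - rewrite RInt_scal_cont, rho_int, Rmult_1_r by auto; apply exp_pos.
  - apply RInt_le_cont; [lra | cnt | apply cont_wm, H |].
    intros x Hx; unfold wm; rewrite Rmult_comm; apply Rmult_le_compat_l; auto.
    specialize (HB' x Hx); apply Rabs_le_between in HB'.
    destruct (Req_dec B (th x)) as [->|]; [lra | left; apply exp_increasing; lra].
Qed.

Lemma cont_Wf (th : R -> R) : cont th -> cont (Wf th).
Proof.
  intros H; unfold Wf; apply cont_mult; [cnt|].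
  apply (cont_prim (fun y => _)), cont_minus; apply cont_dens; [apply cont_wp | apply cont_wm]; auto.
Qed.

Lemma cont_Vf (th : R -> R) : cont th -> cont (Vf th).
Proof. intros H; unfold Vf; apply cont_minus; [apply cont_Wf; auto | cnt]. Qed.

Lemma cont2_Vf (phi : R -> R -> R) : cont2 phi -> cont2 (fun t x => Vf (phi t) x).
Proof.
  intros H.
  assert (Hp : cont2 (fun t x => dens (wp (phi t)) x)).
  { apply cont2_dens; [unfold wp; cnt2 | intros; apply wp_pos, cont2_slice, H]. }
  assert (Hm : cont2 (fun t x => dens (wm (phi t)) x)).
  { apply cont2_dens; [unfold wm; cnt2 | intros; apply wm_pos, cont2_slice, H]. }
  assert (HW : cont2 (fun t x => Wf (phi t) x)).
  { unfold Wf; apply cont2_mult; [cnt2|].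
    apply (cont2_RInt (fun t y => dens (wp (phi t)) y - dens (wm (phi t)) y)); cnt2. }
  unfold Vf; apply cont2_minus; [exact HW|].
  apply (cont2_fst (fun t => _)).
  apply (cont_RInt_param (fun t y => dens (wp (phi t)) y * Wf (phi t) y)); cnt2.
Qed.

Lemma Vf_derive (th : R -> R) (x : R) : cont th ->
  is_derive (Vf th) x (lam * (dens (wp th) x - dens (wm th) x)).
Proof.
  intros H; unfold Vf; rewrite <- Rminus_0_r.
  apply is_derive_minus_R; [|apply is_derive_const_R].
  apply is_derive_scal_R, (is_derive_prim (fun y => _ - _)).
  apply cont_minus; apply cont_dens; [apply cont_wp | apply cont_wm]; auto.
Qed.

(** Both densities have mass 1, so their difference has mean zero and its primitive is periodic. *)
Lemma Vf_periodic1 (th : R -> R) : cont th -> periodic1 th -> periodic1 (Vf th).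
Proof.
  intros Ch Ph x.
  assert (Dp : cont (dens (wp th))) by (apply cont_dens, cont_wp, Ch).
  assert (Dm : cont (dens (wm th))) by (apply cont_dens, cont_wm, Ch).
  unfold Vf, Wf; f_equal; f_equal.
  apply (periodic1_prim (fun y => dens (wp th) y - dens (wm th) y)).
  - intros y; unfold dens, wp, wm; rewrite Ph, Prho; reflexivity.
  - cnt.
  - rewrite RInt_minus_cont, !RInt_dens; auto using cont_wp, cont_wm, wp_pos, wm_pos; rng.
Qed.

Lemma Vf_mean (th : R -> R) : cont th -> RInt (fun x => dens (wp th) x * Vf th x) 0 1 = 0.
Proof.
  intros H.
  assert (Dp : cont (dens (wp th))) by (apply cont_dens, cont_wp, H).
  pose proof (cont_Wf th H) as CW.
  set (c := RInt (fun y => dens (wp th) y * Wf th y) 0 1).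
  rewrite (RInt_ext_R _ (fun x => dens (wp th) x * Wf th x - c * dens (wp th) x))
    by (intros; unfold Vf, c; ring).
  rewrite RInt_minus_cont, RInt_scal_cont, RInt_dens by (auto using cont_wp, wp_pos; cnt).
  unfold c; rng.
Qed.

Lemma Wf_bound (th : R -> R) (x : R) : cont th -> 0 <= x <= 1 -> Rabs (Wf th x) <= Rabs lam.
Proof.
  intros H Hx.
  assert (Cp := cont_wp th H); assert (Cm := cont_wm th H).
  unfold Wf; rewrite RInt_minus_cont, Rabs_mult by (apply cont_dens; auto).
  rewrite <- (Rmult_1_r (Rabs lam)) at 2.
  apply Rmult_le_compat_l; [apply Rabs_pos|].
  pose proof (RInt_dens_bounds (wp th) Cp (wp_ge0 th) (wp_pos th H) x Hx).
  pose proof (RInt_dens_bounds (wm th) Cm (wm_ge0 th) (wm_pos th H) x Hx).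
  apply Rabs_le_between; lra.
Qed.

Lemma Vf_bound (th : R -> R) (x : R) : cont th -> 0 <= x <= 1 -> Rabs (Vf th x) <= 2 * Rabs lam.
Proof.
  intros H Hx.
  assert (Cp := cont_wp th H).
  assert (Dp := cont_dens _ Cp).
  pose proof (cont_Wf th H) as CW.
  pose proof (Wf_bound th x H Hx) as B1.
  assert (B2 : Rabs (RInt (fun y => dens (wp th) y * Wf th y) 0 1) <= Rabs lam).
  { apply Rle_trans with (RInt (fun y => Rabs lam * dens (wp th) y) 0 1).
    - apply RInt_abs_le_fun; [lra | cnt | cnt |]; intros y Hy.
      rewrite Rabs_mult, (Rabs_pos_eq (dens (wp th) y)), Rmult_comm
        by (apply dens_ge0; auto using wp_ge0, wp_pos).
      apply Rmult_le_compat_r; [apply dens_ge0; auto using wp_ge0, wp_pos|].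
      apply Wf_bound; auto.
    - rewrite RInt_scal_cont, RInt_dens by auto using wp_pos; lra. }
  unfold Vf; apply Rabs_le_between in B1; apply Rabs_le_between in B2.
  apply Rabs_le_between; lra.
Qed.

(** Both exponential weights change by a factor at most [exp d] when [th] moves by [d],
    so that the normalised densities, hence [Vf], are Lipschitz whatever the size of [th]. *)
Lemma Vf_lipschitz (th th' : R -> R) (d : R) : cont th -> cont th' ->
  (forall x, 0 <= x <= 1 -> Rabs (th x - th' x) <= d) ->
  forall x, 0 <= x <= 1 -> Rabs (Vf th x - Vf th' x) <= (108 * Rabs lam + 1) * d.
Proof.
  intros H H' Hd x Hx.
  assert (d0 : 0 <= d) by (eapply Rle_trans; [apply Rabs_pos | apply (Hd x Hx)]).
  pose proof (Rabs_pos lam) as Hl.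
  (* A displacement [d > 1] is covered by the uniform bound [2 * Rabs lam] on each velocity; the
     exponential estimate is applied for [d <= 1]. *)
  destruct (Rle_dec d 1) as [d1|d1].
  2:{ pose proof (Vf_bound th x H Hx) as B; pose proof (Vf_bound th' x H' Hx) as B'.
      apply Rabs_le_between in B; apply Rabs_le_between in B'.
      apply Rabs_le_between; nra. }
  assert (Emono : forall a b, a <= b -> exp a <= exp b).
  { intros a b [Hab| ->]; [left; apply exp_increasing; auto | lra]. }
  assert (P1 : forall y, 0 <= y <= 1 -> wp th y <= exp d * wp th' y).
  { intros y Hy; unfold wp; rewrite <- exp_plus; apply Emono.
    specialize (Hd y Hy); apply Rabs_le_between in Hd; lra. }
  assert (P2 : forall y, 0 <= y <= 1 -> wp th' y <= exp d * wp th y).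
  { intros y Hy; unfold wp; rewrite <- exp_plus; apply Emono.
    specialize (Hd y Hy); apply Rabs_le_between in Hd; lra. }
  assert (M1 : forall y, 0 <= y <= 1 -> wm th y <= exp d * wm th' y).
  { intros y Hy; unfold wm.
    replace (exp d * (rho y * exp (- th' y))) with (rho y * exp (d + - th' y))
      by (rewrite exp_plus; ring).
    apply Rmult_le_compat_l; auto; apply Emono.
    specialize (Hd y Hy); apply Rabs_le_between in Hd; lra. }
  assert (M2 : forall y, 0 <= y <= 1 -> wm th' y <= exp d * wm th y).
  { intros y Hy; unfold wm.
    replace (exp d * (rho y * exp (- th y))) with (rho y * exp (d + - th y))
      by (rewrite exp_plus; ring).
    apply Rmult_le_compat_l; auto; apply Emono.
    specialize (Hd y Hy); apply Rabs_le_between in Hd; lra. }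
  assert (Cp := cont_wp th H); assert (Cm := cont_wm th H).
  assert (Cp' := cont_wp th' H'); assert (Cm' := cont_wm th' H').
  assert (Zp := wp_pos th H); assert (Zm := wm_pos th H).
  assert (Zp' := wp_pos th' H'); assert (Zm' := wm_pos th' H').
  set (k := exp d ^ 2 - 1).
  assert (HW : forall y, 0 <= y <= 1 -> Rabs (Wf th y - Wf th' y) <= Rabs lam * (2 * k)).
  { intros y Hy; unfold Wf.
    rewrite !RInt_minus_cont by (apply cont_dens; auto).
    rewrite <- Rmult_minus_distr_l, Rabs_mult.
    apply Rmult_le_compat_l; auto.
    pose proof (RInt_dens_close _ _ _ Cp Cp' (wp_ge0 th) (wp_ge0 th') Zp Zp' P1 P2 y Hy) as A.
    pose proof (RInt_dens_close _ _ _ Cm Cm' (wm_ge0 th) (wm_ge0 th') Zm Zm' M1 M2 y Hy) as A'.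
    fold k in A, A'; apply Rabs_le_between in A; apply Rabs_le_between in A'.
    apply Rabs_le_between; lra. }
  pose proof (RInt_dens_mult_close _ _ _ Cp Cp' (wp_ge0 th) (wp_ge0 th') Zp Zp' P1 P2
    _ _ _ _ (cont_Wf th H) (cont_Wf th' H') HW (fun y Hy => Wf_bound th' y H' Hy)) as A.
  fold k in A.
  specialize (HW x Hx).
  pose proof (exp_double_bound d (conj d0 d1)) as Hk; fold k in Hk.
  apply Rabs_le_between in A; apply Rabs_le_between in HW.
  (* The primitive contributes [2 * k] and the weighted mean [2 * k + 2 * k], each times [Rabs lam];
     with [k <= 18 * d] this makes [108 * Rabs lam * d]. *)
  unfold Vf; apply Rabs_le_between; nra.
Qed.

Definition picard (phi : R -> R -> R) (t x : R) : R := RInt (fun s => Vf (phi s) x) 0 t.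

Lemma cont2_picard (phi : R -> R -> R) : cont2 phi -> cont2 (picard phi).
Proof.
  intros H; apply (cont2_RInt_l (fun s x => Vf (phi s) x)), cont2_Vf, H.
Qed.

Lemma picard_periodic1 (phi : R -> R -> R) : cont2 phi -> (forall t, periodic1 (phi t)) ->
  forall t, periodic1 (picard phi t).
Proof.
  intros C P t x; apply RInt_ext_R; intros s; apply Vf_periodic1; auto; apply cont2_slice, C.
Qed.

(** The Lipschitz constant of [Vf_lipschitz]; the summand 1 keeps it at least 1 even when [lam] is
    0. *)
Let K : R := 108 * Rabs lam + 1.

Lemma K_pos : 0 < K.
Proof. unfold K; pose proof (Rabs_pos lam); lra. Qed.

Lemma picard_contraction (phi psi : R -> R -> R) (D : R) : cont2 phi -> cont2 psi ->
  (forall t, periodic1 (phi t)) -> (forall t, periodic1 (psi t)) ->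
  (forall t x, Rabs (phi t x - psi t x) <= D * exp (2 * K * Rabs t)) ->
  forall t x, Rabs (picard phi t x - picard psi t x) <= D / 2 * exp (2 * K * Rabs t).
Proof.
  intros C1 C2 P1 P2 H t.
  assert (C1' := cont2_Vf phi C1); assert (C2' := cont2_Vf psi C2).
  apply (periodic1_ind (fun x => picard phi t x - picard psi t x)
    (fun z => Rabs z <= D / 2 * exp (2 * K * Rabs t))).
  { intros x; rewrite !picard_periodic1; auto. }
  intros x Hx; unfold picard.
  assert (S1 := cont2_slice_l _ x C1'); assert (S2 := cont2_slice_l _ x C2').
  simpl in S1, S2.
  rewrite <- RInt_minus_cont by auto.
  apply (RInt_exp_weight _ K); [apply K_pos | cnt |].
  intros s; rewrite Rmult_assoc; apply Vf_lipschitz; auto using cont2_slice.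
Qed.

Fixpoint iterate (n : nat) : R -> R -> R :=
  match n with
  | O => fun _ _ => 0
  | S n => picard (iterate n)
  end.

Lemma cont2_iterate (n : nat) : cont2 (iterate n).
Proof. induction n; simpl; [cnt2 | apply cont2_picard; auto]. Qed.

Lemma iterate_periodic1 (n : nat) (t : R) : periodic1 (iterate n t).
Proof.
  revert t; induction n; intros t; simpl.
  - intros x; reflexivity.
  - apply picard_periodic1; auto using cont2_iterate.
Qed.

Lemma iterate_step (n : nat) (t x : R) :
  Rabs (iterate (S n) t x - iterate n t x) <= 2 * Rabs lam * exp (2 * K * Rabs t) / 2 ^ n.
Proof.
  revert t x; induction n as [|n IH].
  - intros t; simpl iterate.
    apply (periodic1_ind (fun x => picard (fun _ _ => 0) t x - 0)
      (fun z => Rabs z <= 2 * Rabs lam * exp (2 * K * Rabs t) / 2 ^ 0)).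
    { intros x; rewrite (picard_periodic1 (fun _ _ => 0)); [reflexivity | cnt2 |].
      intros s y; reflexivity. }
    intros x Hx; rewrite Rminus_0_r; simpl; rewrite Rdiv_1_r.
    apply Rle_trans with (Rabs (t - 0) * (2 * Rabs lam)).
    + apply RInt_abs_le_cont; [cnt|].
      intros s _; apply Vf_bound; [cnt | auto].
    + rewrite Rminus_0_r, Rmult_comm; apply Rmult_le_compat_l.
      * pose proof (Rabs_pos lam); lra.
      * assert (1 <= K) by (unfold K; pose proof (Rabs_pos lam); lra).
        pose proof (Rabs_pos t); pose proof (exp_ineq1_le (2 * K * Rabs t)); nra.
  - intros t x.
    replace (2 * Rabs lam * exp (2 * K * Rabs t) / 2 ^ S n)
      with ((2 * Rabs lam / 2 ^ n) / 2 * exp (2 * K * Rabs t))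
      by (simpl; field; apply pow_nonzero; lra).
    apply (picard_contraction (iterate (S n)) (iterate n));
      auto using cont2_iterate, iterate_periodic1.
    intros s y; eapply Rle_trans; [apply IH|].
    apply Req_le; field; apply pow_nonzero; lra.
Qed.

(** [Lim_seq] is total with values in the extended reals, read here as a real number; [iterate_step]
    and [geometric_limit] show that the iterates do converge to this value. *)
Definition flow (t x : R) : R := Lim_seq (fun n => iterate n t x).

Lemma flow_close (n : nat) (t x : R) :
  Rabs (iterate n t x - flow t x) <= 4 * Rabs lam / 2 ^ n * exp (2 * K * Rabs t).
Proof.
  eapply Rle_trans.
  - apply (geometric_limit (fun n => iterate n t x) (2 * Rabs lam * exp (2 * K * Rabs t))).
    intros k; apply iterate_step.
  - apply Req_le; field; apply pow_nonzero; lra.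
Qed.

Lemma cont2_flow : cont2 flow.
Proof.
  apply (cont2_limit iterate); [apply cont2_iterate|].
  intros t e He.
  (* Times [r] within 1 of [t] satisfy [Rabs r <= Rabs t + 1], so [M] bounds the factor of $2^{-n}$
     in [flow_close] uniformly there. *)
  set (M := 4 * Rabs lam * exp (2 * K * (Rabs t + 1))).
  assert (HM : 0 <= M).
  { unfold M; pose proof (Rabs_pos lam); pose proof (exp_pos (2 * K * (Rabs t + 1))); nra. }
  destruct (pow_lt_1_zero (/ 2) ltac:(rewrite Rabs_pos_eq; lra) (e / (M + 1))) as [n Hn].
  { apply Rdiv_lt_0_compat; lra. }
  exists 1, n; split; [lra|]; intros r x Hr.
  specialize (Hn n (Nat.le_refl n)).
  rewrite Rabs_pos_eq in Hn by (apply pow_le; lra).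
  eapply Rle_trans; [apply flow_close|].
  assert (H1 : exp (2 * K * Rabs r) <= exp (2 * K * (Rabs t + 1))).
  { left; apply exp_increasing, Rmult_lt_compat_l; [pose proof K_pos; lra|].
    replace r with ((r - t) + t) by ring; pose proof (Rabs_triang (r - t) t); lra. }
  assert (H2 : 4 * Rabs lam / 2 ^ n * exp (2 * K * Rabs r) <= M * (/ 2) ^ n).
  { unfold M, Rdiv; rewrite pow_inv.
    assert (0 < / 2 ^ n) by (apply Rinv_0_lt_compat, pow_lt; lra).
    pose proof (Rabs_pos lam).
    replace (4 * Rabs lam * exp (2 * K * (Rabs t + 1)) * / 2 ^ n)
      with (4 * Rabs lam * / 2 ^ n * exp (2 * K * (Rabs t + 1))) by ring.
    apply Rmult_le_compat_l; [nra | exact H1]. }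
  eapply Rle_trans; [exact H2|].
  assert (0 <= (/ 2) ^ n) by (apply pow_le; lra).
  apply Rle_trans with ((M + 1) * (e / (M + 1))); [nra|].
  apply Req_le; field; lra.
Qed.

Lemma flow_periodic1 (t : R) : periodic1 (flow t).
Proof.
  intros x; unfold flow; f_equal; apply Lim_seq_ext; intros n; apply iterate_periodic1.
Qed.

(** For fixed [t] and [x], the flow and its Picard image are both within a multiple of $2^{-n}$ of
    [iterate (S n)]. *)
Lemma flow_fixed (t x : R) : flow t x = picard flow t x.
Proof.
  apply Rminus_diag_uniq.
  apply (geometric_zero _ (4 * Rabs lam * exp (2 * K * Rabs t))); intros n.
  pose proof (flow_close (S n) t x) as A.
  assert (B := picard_contraction (iterate n) flow _ (cont2_iterate n) cont2_flow
    (iterate_periodic1 n) flow_periodic1 (flow_close n) t x).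
  change (picard (iterate n)) with (iterate (S n)) in B.
  replace (flow t x - picard flow t x)
    with (- (iterate (S n) t x - flow t x) + (iterate (S n) t x - picard flow t x)) by ring.
  eapply Rle_trans; [apply Rabs_triang|]; rewrite Rabs_Ropp.
  eapply Rle_trans; [apply Rplus_le_compat; [exact A | exact B]|].
  apply Req_le; simpl; field; apply pow_nonzero; lra.
Qed.

Lemma flow_derive (t x : R) : is_derive (fun s => flow s x) t (Vf (flow t) x).
Proof.
  apply (is_derive_ext (fun s => picard flow s x)); [intros; symmetry; apply flow_fixed|].
  apply (is_derive_prim (fun s => Vf (flow s) x)).
  apply (cont2_slice_l (fun s x => Vf (flow s) x)), cont2_Vf, cont2_flow.
Qed.

Lemma flow_0 (x : R) : flow 0 x = 0.
Proof. rewrite flow_fixed; apply (RInt_point 0 (fun s => Vf (flow s) x)). Qed.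

Lemma cont_flow (t : R) : cont (flow t).
Proof. apply cont2_slice, cont2_flow. Qed.

Lemma dens_eq (w : R -> R) (x : R) : RInt w 0 1 <> 0 -> w x = RInt w 0 1 * dens w x.
Proof. intros H; unfold dens; field; exact H. Qed.

(** The time derivative is the total mass times the mean of the velocity against
    [dens (wp (flow t))], which [Vf] was built to annihilate. *)
Lemma flow_mass (t : R) : RInt (wp (flow t)) 0 1 = 1.
Proof.
  transitivity (RInt (wp (flow 0)) 0 1).
  - apply (is_derive_zero_const (fun t => RInt (wp (flow t)) 0 1)); clear t; intros t.
    eapply is_derive_eq.
    + apply (is_derive_RInt_param_cont (fun t => wp (flow t))
        (fun t x => Vf (flow t) x * exp (flow t x))).
      * intros s x; apply (is_derive_exp_R (fun s => flow s x)), flow_derive.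
      * intros s; apply cont_wp, cont_flow.
      * apply cont2_mult; [apply cont2_Vf, cont2_flow|].
        pose proof cont2_flow; cnt2.
    + assert (Z := wp_pos _ (cont_flow t)).
      rewrite (RInt_ext_R _
        (fun x => RInt (wp (flow t)) 0 1 * (dens (wp (flow t)) x * Vf (flow t) x))).
      * rewrite RInt_scal_cont, Vf_mean; [rng | apply cont_flow |].
        apply cont_mult; [apply cont_dens, cont_wp, cont_flow | apply cont_Vf, cont_flow].
      * intros x; change (exp (flow t x)) with (wp (flow t) x).
        rewrite (dens_eq (wp (flow t)) x) by lra; ring.
  - rewrite (RInt_ext_R _ (fun _ => 1)).
    + rewrite RInt_const_R; rng.
    + intros x; unfold wp; rewrite flow_0; apply exp_0.
Qed.

(** The time derivative is proportional to the mean of [V] against [dens (wm (flow t))]. Now $V V_x$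
    integrates to 0 over a period and $V_x$ is [lam] times the difference of the two densities, so
    [lam] times this mean equals [lam] times the mean against the other density, which is 0. *)
Lemma flow_mass_dual (t : R) : RInt (wm (flow t)) 0 1 = 1.
Proof.
  transitivity (RInt (wm (flow 0)) 0 1).
  - apply (is_derive_zero_const (fun t => RInt (wm (flow t)) 0 1)); clear t; intros t.
    assert (CV : cont2 (fun t x => Vf (flow t) x)) by (apply cont2_Vf, cont2_flow).
    assert (CVt : cont (Vf (flow t))) by (apply cont_Vf, cont_flow).
    assert (Dp := cont_dens _ (cont_wp _ (cont_flow t))).
    assert (Dm := cont_dens _ (cont_wm _ (cont_flow t))).
    eapply is_derive_eq.
    + apply (is_derive_RInt_param_cont (fun t => wm (flow t))
        (fun t x => rho x * (- Vf (flow t) x * exp (- flow t x)))).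
      * intros s x; apply is_derive_scal_R.
        apply (is_derive_exp_R (fun s => - flow s x)), (is_derive_opp (fun s => flow s x)).
        apply flow_derive.
      * intros s; apply cont_wm, cont_flow.
      * pose proof cont2_flow; cnt2.
    + assert (Z := wm_pos _ (cont_flow t)).
      rewrite (RInt_ext_R _
        (fun x => - RInt (wm (flow t)) 0 1 * (dens (wm (flow t)) x * Vf (flow t) x))).
      2:{ intros x.
          replace (rho x * (- Vf (flow t) x * exp (- flow t x)))
            with (- (wm (flow t) x * Vf (flow t) x)) by (unfold wm; ring).
          rewrite (dens_eq (wm (flow t)) x) by lra; ring. }
      rewrite RInt_scal_cont by cnt.
      apply Rmult_eq_0_compat_l.
      (* The identity can be divided by [lam] unless [lam = 0], in which case the velocity itself
         vanishes. *)
      destruct (Req_dec lam 0) as [L|L].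
      * rewrite (RInt_ext_R _ (fun _ => 0)); [rewrite RInt_const_R; rng|].
        intros x.
        assert (HV : forall x, Vf (flow t) x = 0).
        { intros y; unfold Vf, Wf; rewrite L, Rmult_0_l.
          rewrite (RInt_ext_R _ (fun _ => 0)) by (intros; ring).
          rewrite RInt_const_R; ring. }
        rewrite HV; ring.
      * apply (Rmult_eq_reg_l lam); auto; rewrite Rmult_0_r.
        assert (E : RInt (fun x => Vf (flow t) x *
          (lam * (dens (wp (flow t)) x - dens (wm (flow t)) x))) 0 1 = 0).
        { assert (E := RInt_by_parts_periodic1 (Vf (flow t)) _ (Vf (flow t)) _
            (fun x => Vf_derive _ x (cont_flow t)) (fun x => Vf_derive _ x (cont_flow t))
            ltac:(cnt) ltac:(cnt)
            (Vf_periodic1 _ (cont_flow t) (flow_periodic1 t))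
            (Vf_periodic1 _ (cont_flow t) (flow_periodic1 t))).
          assert (E' : RInt (fun x => lam * (dens (wp (flow t)) x - dens (wm (flow t)) x)
            * Vf (flow t) x) 0 1 = RInt (fun x => Vf (flow t) x *
            (lam * (dens (wp (flow t)) x - dens (wm (flow t)) x))) 0 1)
            by (apply RInt_ext_R; intros; ring).
          lra. }
        rewrite (RInt_ext_R _ (fun x => lam * (dens (wp (flow t)) x * Vf (flow t) x)
          - lam * (dens (wm (flow t)) x * Vf (flow t) x))) in E by (intros; ring).
        rewrite RInt_minus_cont, !RInt_scal_cont, Vf_mean in E
          by first [apply cont_flow | cnt].
        lra.
  - rewrite (RInt_ext_R _ rho); [exact rho_int|].
    intros x; unfold wm; rewrite flow_0, Ropp_0, exp_0; ring.
Qed.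

End Flow.

(** Both normalising integrals equal 1 at all times, so the normalised equation coincides with the
    original one along the flow. *)
Theorem lagrangian_flow (rho : R -> R) (lam : R) : cont rho -> periodic1 rho ->
  (forall x, 0 <= rho x) -> RInt rho 0 1 = 1 ->
  exists phi V : R -> R -> R,
    cont2 phi /\ cont2 V /\ (forall t, periodic1 (phi t)) /\ (forall t, periodic1 (V t)) /\
    (forall x, phi 0 x = 0) /\
    (forall t x, is_derive (fun s => phi s x) t (V t x)) /\
    (forall t x, is_derive (V t) x (lam * (exp (phi t x) - rho x * exp (- phi t x)))) /\
    (forall t, RInt (fun x => exp (phi t x)) 0 1 = 1) /\
    (forall t, RInt (fun x => V t x * exp (phi t x)) 0 1 = 0).
Proof.
  intros C P H0 H1.
  exists (flow rho lam), (fun t => Vf rho lam (flow rho lam t)).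
  assert (M := flow_mass rho lam C P H0 H1).
  assert (M' := flow_mass_dual rho lam C P H0 H1).
  refine (conj _ (conj _ (conj _ (conj _ (conj _ (conj _ (conj _ (conj _ _)))))))).
  - apply cont2_flow; auto.
  - apply cont2_Vf; auto; apply cont2_flow; auto.
  - intros t; apply flow_periodic1; auto.
  - intros t; apply Vf_periodic1; auto; [apply cont_flow | apply flow_periodic1]; auto.
  - intros x; apply flow_0; auto.
  - intros t x; apply flow_derive; auto.
  - intros t x; eapply is_derive_eq; [apply Vf_derive; auto; apply cont_flow; auto|].
    unfold dens; rewrite M, M', !Rdiv_1_r; reflexivity.
  - exact M.
  - intros t; eapply eq_trans; [|apply (Vf_mean rho lam C (flow rho lam t)), cont_flow; auto].
    apply RInt_ext_R; intros x; unfold dens; rewrite M, Rdiv_1_r; apply Rmult_comm.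
Qed.

(** * Fourier coefficients *)

(** The block of indices from [N] to [N + j - 1]. Unlike [sum_n] it can be empty, and blocks
    starting at [N] express the tail of a series without limits. *)
Fixpoint bsum (f : nat -> R) (N j : nat) : R :=
  match j with
  | O => 0
  | S j => bsum f N j + f (N + j)%nat
  end.

Lemma bsum_S (f : nat -> R) (N j : nat) : bsum f N (S j) = bsum f N j + f (N + j)%nat.
Proof. reflexivity. Qed.

Lemma bsum_le (f g : nat -> R) (N j : nat) :
  (forall n, (N <= n < N + j)%nat -> f n <= g n) -> bsum f N j <= bsum g N j.
Proof.
  induction j as [|j IH]; intros H; simpl; [lra|].
  apply Rplus_le_compat; [apply IH; intros n Hn|]; apply H; lia.
Qed.

Lemma bsum_ext (f g : nat -> R) (N j : nat) :
  (forall n, (N <= n < N + j)%nat -> f n = g n) -> bsum f N j = bsum g N j.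
Proof. intros H; apply Rle_antisym; apply bsum_le; intros n Hn; rewrite H; auto; lra. Qed.

Lemma bsum_scal (c : R) (f : nat -> R) (N j : nat) :
  bsum (fun n => c * f n) N j = c * bsum f N j.
Proof. induction j as [|j IH]; simpl; [ring | rewrite IH; ring]. Qed.

Lemma bsum_plus (f g : nat -> R) (N j : nat) :
  bsum (fun n => f n + g n) N j = bsum f N j + bsum g N j.
Proof. induction j as [|j IH]; simpl; [ring | rewrite IH; ring]. Qed.

Lemma bsum_split (f : nat -> R) (N j : nat) : bsum f 0 (N + j) = bsum f 0 N + bsum f N j.
Proof.
  induction j as [|j IH]; simpl.
  - rewrite Nat.add_0_r; ring.
  - rewrite Nat.add_succ_r; simpl; rewrite IH; ring.
Qed.

Lemma bsum_cons (f : nat -> R) (N j : nat) : bsum f N (S j) = f N + bsum f (S N) j.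
Proof.
  induction j as [|j IH].
  - simpl; rewrite Nat.add_0_r; ring.
  - change (bsum f N (S (S j))) with (bsum f N (S j) + f (N + S j)%nat).
    rewrite IH; simpl; rewrite Nat.add_succ_r; ring.
Qed.

Lemma sum_n_bsum (f : nat -> R) (n : nat) : sum_n f n = bsum f 0 (S n).
Proof.
  induction n as [|n IH].
  - rewrite sum_O; simpl; ring.
  - rewrite sum_Sn, IH; reflexivity.
Qed.

Lemma bsum_shift (f : nat -> R) (n : nat) : bsum f 1 n = bsum (fun k => f (S k)) 0 n.
Proof. induction n as [|n IH]; simpl; [reflexivity | rewrite IH; reflexivity]. Qed.

Lemma ex_series_bsum (f : nat -> R) (B : R) : (forall n, 0 <= f n) ->
  (forall j, bsum f 0 j <= B) -> ex_series f /\ Series f <= B.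
Proof.
  intros H0 HB.
  assert (E : ex_finite_lim_seq (sum_n f)).
  { apply ex_finite_lim_seq_incr with B; intros n.
    - rewrite sum_Sn; specialize (H0 (S n)); unfold plus; simpl; lra.
    - rewrite sum_n_bsum; apply HB. }
  split.
  - destruct E as [l Hl]; exists l; exact Hl.
  - apply Lim_seq_correct' in E.
    apply (is_lim_seq_le (sum_n f) (fun _ => B) (Series f) B); auto using is_lim_seq_const.
    intros n; rewrite sum_n_bsum; apply HB.
Qed.

Lemma bsum_bounded (f : nat -> R) : (forall n, 0 <= f n) -> ex_series f ->
  forall j, bsum f 0 j <= Series f.
Proof.
  intros H0 [l Hl] j.
  rewrite (is_series_unique _ _ Hl).
  assert (E : bsum f 0 j <= sum_n f j) by (rewrite sum_n_bsum; simpl; specialize (H0 j); lra).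
  eapply Rle_trans; [exact E|].
  apply (is_lim_seq_incr_compare (sum_n f) l Hl).
  intros n; rewrite sum_Sn; specialize (H0 (S n)); unfold plus; simpl; lra.
Qed.

Lemma bsum_tail (f : nat -> R) (e : R) : (forall n, 0 <= f n) -> ex_series f -> 0 < e ->
  exists N, forall n j, (N <= n)%nat -> bsum f n j <= e.
Proof.
  intros H0 Hs He; destruct Hs as [l Hl]; assert (Hs : ex_series f) by (exists l; auto).
  assert (Hl' : is_lim_seq (sum_n f) l) by exact Hl.
  apply is_lim_seq_spec in Hl'.
  destruct (Hl' (mkposreal e He)) as [N HN].
  exists (S N); intros n j Hn; simpl in HN.
  destruct n as [|n]; [lia|].
  specialize (HN n ltac:(lia)); rewrite sum_n_bsum in HN.
  pose proof (bsum_bounded f H0 Hs (S n + j)) as B.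
  rewrite bsum_split, (is_series_unique _ _ Hl) in B.
  apply Rabs_lt_between in HN; lra.
Qed.

Lemma uniform_cauchy_limit (u : nat -> R -> R) :
  (forall e, 0 < e -> exists N, forall n x, (N <= n)%nat -> Rabs (u n x - u N x) <= e) ->
  exists g, forall e, 0 < e ->
    exists N, forall n x, (N <= n)%nat -> Rabs (u n x - g x) <= e.
Proof.
  intros H.
  assert (Ex : forall x, ex_finite_lim_seq (fun n => u n x)).
  { intros x; apply ex_lim_seq_cauchy_corr; intros [e He]; simpl.
    destruct (H (e / 4)) as [N HN]; [lra|].
    exists N; intros n m Hn Hm.
    pose proof (HN n x Hn) as A1; pose proof (HN m x Hm) as A2.
    apply Rabs_le_between in A1; apply Rabs_le_between in A2; apply Rabs_lt_between; lra. }
  exists (fun x => Lim_seq (fun n => u n x)); intros e He.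
  destruct (H (e / 2)) as [N HN]; [lra|].
  exists N; intros n x Hn.
  specialize (Ex x); apply Lim_seq_correct' in Ex.
  assert (B : forall k, Rabs (u n x - u (k + N)%nat x) <= e).
  { intros k; pose proof (HN n x Hn) as A1; pose proof (HN (k + N)%nat x ltac:(lia)) as A2.
    apply Rabs_le_between in A1; apply Rabs_le_between in A2; apply Rabs_le_between; lra. }
  assert (F : is_lim_seq (fun k => Rabs (u n x - u (k + N)%nat x))
    (Rabs (u n x - Lim_seq (fun n => u n x)))).
  { apply (is_lim_seq_abs _ (Finite (u n x - Lim_seq (fun n => u n x)))).
    apply (is_lim_seq_minus' (fun _ => u n x)); [apply is_lim_seq_const|].
    apply (is_lim_seq_incr_n (fun k => u k x) N); exact Ex. }
  apply (is_lim_seq_le _ (fun _ => e) _ e B F (is_lim_seq_const e)).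
Qed.

(** * Trigonometric functions of integer frequency and their orthogonality *)

Definition cs (n : nat) (x : R) : R := cos (2 * PI * INR n * x).
Definition sn (n : nat) (x : R) : R := sin (2 * PI * INR n * x).

Definition cA (f : R -> R) (n : nat) : R := RInt (fun x => f x * cs n x) 0 1.
Definition cB (f : R -> R) (n : nat) : R := RInt (fun x => f x * sn n x) 0 1.

(** [en f n] is [Cmod (fourier f n) ^ 2]; for real functions the index [- n] gives the same
    value, so that natural indices suffice. *)
Definition en (f : R -> R) (n : nat) : R := cA f n ^ 2 + cB f n ^ 2.

Definition hw (n : nat) : R := 1 + INR n ^ 2.

Lemma cont_cs (n : nat) : cont (cs n).
Proof. unfold cs; cnt. Qed.

Lemma cont_sn (n : nat) : cont (sn n).
Proof. unfold sn; cnt. Qed.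

Lemma cos_2PI_IZR (k : Z) (x : R) : cos (x + 2 * PI * IZR k) = cos x.
Proof.
  assert (H : periodic1 (fun y => cos (2 * PI * y))).
  { intros y; replace (2 * PI * (y + 1)) with (2 * PI * y + 2 * PI) by ring.
    rewrite cos_plus, cos_2PI, sin_2PI; ring. }
  pose proof PI_RGT_0.
  pose proof (periodic1_IZR _ H k (x / (2 * PI))) as E; simpl in E.
  replace (2 * PI * (x / (2 * PI) + IZR k)) with (x + 2 * PI * IZR k) in E by (field; lra).
  rewrite E; f_equal; field; lra.
Qed.

Lemma sin_2PI_IZR (k : Z) (x : R) : sin (x + 2 * PI * IZR k) = sin x.
Proof.
  rewrite <- !cos_shift, <- (cos_2PI_IZR (- k) (PI / 2 - x)), opp_IZR.
  f_equal; ring.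
Qed.

Lemma cs_periodic1 (n : nat) : periodic1 (cs n).
Proof.
  intros x; unfold cs; rewrite INR_IZR_INZ, <- (cos_2PI_IZR (Z.of_nat n) (_ * x)).
  f_equal; ring.
Qed.

Lemma sn_periodic1 (n : nat) : periodic1 (sn n).
Proof.
  intros x; unfold sn; rewrite INR_IZR_INZ, <- (sin_2PI_IZR (Z.of_nat n) (_ * x)).
  f_equal; ring.
Qed.

Lemma cs_derive (n : nat) (x : R) : is_derive (cs n) x (- (2 * PI * INR n * sn n x)).
Proof. unfold cs, sn; auto_derive; [auto | ring]. Qed.

Lemma sn_derive (n : nat) (x : R) : is_derive (sn n) x (2 * PI * INR n * cs n x).
Proof. unfold cs, sn; auto_derive; [auto | ring]. Qed.

Lemma cs2_sn2 (n : nat) (x : R) : cs n x ^ 2 + sn n x ^ 2 = 1.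
Proof.
  unfold cs, sn; pose proof (sin2_cos2 (2 * PI * INR n * x)) as H; unfold Rsqr in H.
  simpl; rewrite !Rmult_1_r, <- H; ring.
Qed.

Lemma RInt_cos_IZR (m : Z) : m <> 0%Z -> RInt (fun x => cos (2 * PI * IZR m * x)) 0 1 = 0.
Proof.
  intros Hm; assert (Hm' : IZR m <> 0) by (apply not_0_IZR; auto).
  pose proof PI_RGT_0.
  rewrite (RInt_FTC (fun x => sin (2 * PI * IZR m * x) / (2 * PI * IZR m))).
  - rewrite Rmult_1_r, Rmult_0_r.
    replace (2 * PI * IZR m) with (0 + 2 * PI * IZR m) at 1 by ring.
    rewrite sin_2PI_IZR; unfold Rdiv; rng.
  - intros x; auto_derive; [auto | field; lra].
  - cnt.
Qed.

Lemma RInt_sin_IZR (m : Z) : RInt (fun x => sin (2 * PI * IZR m * x)) 0 1 = 0.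
Proof.
  destruct (Z.eq_dec m 0) as [->|Hm].
  - rewrite (RInt_ext_R _ (fun _ => 0)); [rewrite RInt_const_R; rng|].
    intros x; rewrite Rmult_0_r, Rmult_0_l; apply sin_0.
  - assert (Hm' : IZR m <> 0) by (apply not_0_IZR; auto).
    pose proof PI_RGT_0.
    rewrite (RInt_FTC (fun x => - cos (2 * PI * IZR m * x) / (2 * PI * IZR m))).
    + rewrite Rmult_1_r, Rmult_0_r.
      replace (2 * PI * IZR m) with (0 + 2 * PI * IZR m) at 1 by ring.
      rewrite cos_2PI_IZR; unfold Rdiv; rng.
    + intros x; auto_derive; [auto | field; lra].
    + cnt.
Qed.

(** The product-to-sum formulas reduce orthogonality to the integral of one sine or cosine; its
    frequency [n - k] may be negative, hence [Z]. *)
Lemma cs_cs (n k : nat) (x : R) : cs n x * cs k x =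
  / 2 * cos (2 * PI * IZR (Z.of_nat n - Z.of_nat k) * x)
  + / 2 * cos (2 * PI * IZR (Z.of_nat n + Z.of_nat k) * x).
Proof.
  unfold cs; rewrite minus_IZR, plus_IZR, <- !INR_IZR_INZ.
  replace (2 * PI * (INR n - INR k) * x) with (2 * PI * INR n * x - 2 * PI * INR k * x) by ring.
  replace (2 * PI * (INR n + INR k) * x) with (2 * PI * INR n * x + 2 * PI * INR k * x) by ring.
  rewrite cos_minus, cos_plus; field.
Qed.

Lemma sn_sn (n k : nat) (x : R) : sn n x * sn k x =
  / 2 * cos (2 * PI * IZR (Z.of_nat n - Z.of_nat k) * x)
  - / 2 * cos (2 * PI * IZR (Z.of_nat n + Z.of_nat k) * x).
Proof.
  unfold sn; rewrite minus_IZR, plus_IZR, <- !INR_IZR_INZ.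
  replace (2 * PI * (INR n - INR k) * x) with (2 * PI * INR n * x - 2 * PI * INR k * x) by ring.
  replace (2 * PI * (INR n + INR k) * x) with (2 * PI * INR n * x + 2 * PI * INR k * x) by ring.
  rewrite cos_minus, cos_plus; field.
Qed.

Lemma cs_sn (n k : nat) (x : R) : cs n x * sn k x =
  / 2 * sin (2 * PI * IZR (Z.of_nat n + Z.of_nat k) * x)
  - / 2 * sin (2 * PI * IZR (Z.of_nat n - Z.of_nat k) * x).
Proof.
  unfold cs, sn; rewrite minus_IZR, plus_IZR, <- !INR_IZR_INZ.
  replace (2 * PI * (INR n - INR k) * x) with (2 * PI * INR n * x - 2 * PI * INR k * x) by ring.
  replace (2 * PI * (INR n + INR k) * x) with (2 * PI * INR n * x + 2 * PI * INR k * x) by ring.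
  rewrite sin_minus, sin_plus; field.
Qed.

Lemma RInt_cs_sn (n k : nat) : RInt (fun x => cs n x * sn k x) 0 1 = 0.
Proof.
  rewrite (RInt_ext_R _ _ _ _ (cs_sn n k)).
  rewrite RInt_minus_cont, !RInt_scal_cont by cnt.
  rewrite !RInt_sin_IZR; rng.
Qed.

Lemma RInt_sn_cs (n k : nat) : RInt (fun x => sn n x * cs k x) 0 1 = 0.
Proof.
  rewrite <- (RInt_cs_sn k n) at 2; apply RInt_ext_R; intros; apply Rmult_comm.
Qed.

Lemma RInt_cs_cs (n k : nat) : n <> k -> RInt (fun x => cs n x * cs k x) 0 1 = 0.
Proof.
  intros H; rewrite (RInt_ext_R _ _ _ _ (cs_cs n k)).
  rewrite RInt_plus_cont, !RInt_scal_cont by cnt.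
  rewrite !RInt_cos_IZR by lia; rng.
Qed.

Lemma RInt_sn_sn (n k : nat) : n <> k -> RInt (fun x => sn n x * sn k x) 0 1 = 0.
Proof.
  intros H; rewrite (RInt_ext_R _ _ _ _ (sn_sn n k)).
  rewrite RInt_minus_cont, !RInt_scal_cont by cnt.
  rewrite !RInt_cos_IZR by lia; rng.
Qed.

Lemma RInt_cs2 (n : nat) : RInt (fun x => cs n x * cs n x) 0 1 = if Nat.eqb n 0 then 1 else / 2.
Proof.
  rewrite (RInt_ext_R _ _ _ _ (cs_cs n n)).
  rewrite RInt_plus_cont, !RInt_scal_cont by cnt.
  rewrite (RInt_ext_R (fun x => cos (2 * PI * IZR (Z.of_nat n - Z.of_nat n) * x)) (fun _ => 1)).
  2:{ intros x; rewrite Z.sub_diag, Rmult_0_r, Rmult_0_l; apply cos_0. }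
  rewrite RInt_const_R; destruct (Nat.eqb_spec n 0) as [->|Hn].
  - rewrite (RInt_ext_R _ (fun _ => 1)).
    + rewrite RInt_const_R; rng.
    + intros x; simpl; rewrite Rmult_0_r, Rmult_0_l; apply cos_0.
  - rewrite RInt_cos_IZR by lia; rng.
Qed.

Lemma RInt_sn2 (n : nat) : RInt (fun x => sn n x * sn n x) 0 1 = if Nat.eqb n 0 then 0 else / 2.
Proof.
  rewrite (RInt_ext_R _ (fun x => 1 - cs n x * cs n x)).
  2:{ intros x; pose proof (cs2_sn2 n x); simpl in *; lra. }
  assert (C := cont_cs n).
  rewrite RInt_minus_cont, RInt_const_R, RInt_cs2 by cnt.
  destruct (Nat.eqb n 0); rng.
Qed.

Lemma cA_plus (f g : R -> R) (n : nat) : cont f -> cont g ->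
  cA (fun x => f x + g x) n = cA f n + cA g n.
Proof.
  intros Hf Hg; assert (C := cont_cs n); unfold cA; rewrite <- RInt_plus_cont by cnt.
  apply RInt_ext_R; intros; ring.
Qed.

Lemma cB_plus (f g : R -> R) (n : nat) : cont f -> cont g ->
  cB (fun x => f x + g x) n = cB f n + cB g n.
Proof.
  intros Hf Hg; assert (C := cont_sn n); unfold cB; rewrite <- RInt_plus_cont by cnt.
  apply RInt_ext_R; intros; ring.
Qed.

Lemma cA_scal (c : R) (f : R -> R) (n : nat) : cont f -> cA (fun x => c * f x) n = c * cA f n.
Proof.
  intros Hf; assert (C := cont_cs n); unfold cA; rewrite <- RInt_scal_cont by cnt.
  apply RInt_ext_R; intros; ring.
Qed.

Lemma cB_scal (c : R) (f : R -> R) (n : nat) : cont f -> cB (fun x => c * f x) n = c * cB f n.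
Proof.
  intros Hf; assert (C := cont_sn n); unfold cB; rewrite <- RInt_scal_cont by cnt.
  apply RInt_ext_R; intros; ring.
Qed.

Lemma cA_minus (f g : R -> R) (n : nat) : cont f -> cont g ->
  cA (fun x => f x - g x) n = cA f n - cA g n.
Proof.
  intros Hf Hg; assert (C := cont_cs n); unfold cA; rewrite <- RInt_minus_cont by cnt.
  apply RInt_ext_R; intros; ring.
Qed.

Lemma cB_minus (f g : R -> R) (n : nat) : cont f -> cont g ->
  cB (fun x => f x - g x) n = cB f n - cB g n.
Proof.
  intros Hf Hg; assert (C := cont_sn n); unfold cB; rewrite <- RInt_minus_cont by cnt.
  apply RInt_ext_R; intros; ring.
Qed.

Lemma cA_ext (f g : R -> R) (n : nat) : (forall x, f x = g x) -> cA f n = cA g n.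
Proof. intros H; apply RInt_ext_R; intros; rewrite H; reflexivity. Qed.

Lemma cB_ext (f g : R -> R) (n : nat) : (forall x, f x = g x) -> cB f n = cB g n.
Proof. intros H; apply RInt_ext_R; intros; rewrite H; reflexivity. Qed.

Lemma en_ext (f g : R -> R) (n : nat) : (forall x, f x = g x) -> en f n = en g n.
Proof. intros H; unfold en; rewrite (cA_ext f g), (cB_ext f g); auto. Qed.

Lemma en_ge0 (f : R -> R) (n : nat) : 0 <= en f n.
Proof. unfold en; pose proof (pow2_ge_0 (cA f n)); pose proof (pow2_ge_0 (cB f n)); lra. Qed.

Lemma hw_ge1 (n : nat) : 1 <= hw n.
Proof. unfold hw; pose proof (pow2_ge_0 (INR n)); lra. Qed.

(** * Trigonometric polynomials and Bessel's inequality *)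

Definition trig (a b : nat -> R) (n : nat) (x : R) : R := a n * cs n x + b n * sn n x.

Definition tpoly (a b : nat -> R) (N j : nat) (x : R) : R := bsum (fun n => trig a b n x) N j.

Lemma cont_trig (a b : nat -> R) (n : nat) : cont (trig a b n).
Proof. unfold trig; assert (C := cont_cs n); assert (C' := cont_sn n); cnt. Qed.

Lemma cont_tpoly (a b : nat -> R) (N j : nat) : cont (tpoly a b N j).
Proof.
  induction j as [|j IH]; unfold tpoly in *; simpl; [cnt|].
  apply cont_plus; [exact IH | apply (cont_trig a b)].
Qed.

Lemma tpoly_periodic1 (a b : nat -> R) (N j : nat) : periodic1 (tpoly a b N j).
Proof.
  intros x; apply bsum_ext; intros n _; unfold trig; rewrite cs_periodic1, sn_periodic1; auto.
Qed.

Lemma tpoly_derive (a b : nat -> R) (N j : nat) (x : R) : is_derive (tpoly a b N j) x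
  (tpoly (fun n => 2 * PI * INR n * b n) (fun n => - (2 * PI * INR n * a n)) N j x).
Proof.
  induction j as [|j IH].
  - apply is_derive_const_R.
  - unfold tpoly; simpl; apply (is_derive_plus_R (tpoly a b N j)); [exact IH|].
    unfold trig; eapply is_derive_eq.
    + apply is_derive_plus_R; apply is_derive_scal_R; [apply cs_derive | apply sn_derive].
    + ring.
Qed.

Lemma tpoly_ortho (a b : nat -> R) (N j k : nat) : (N + j <= k)%nat ->
  cA (tpoly a b N j) k = 0 /\ cB (tpoly a b N j) k = 0.
Proof.
  intros Hk; induction j as [|j IH].
  - unfold cA, cB; split; rewrite (RInt_ext_R _ (fun _ => 0)), ?RInt_const_R;
      try rng; intros; unfold tpoly; simpl; ring.
  - destruct IH as [IA IB]; [lia|].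
    assert (C := cont_tpoly a b N j); assert (Cc := cont_cs (N + j)); assert (Cn := cont_sn (N + j)).
    assert (E : forall x, tpoly a b N (S j) x
      = tpoly a b N j x + (a (N + j)%nat * cs (N + j) x + b (N + j)%nat * sn (N + j) x))
      by reflexivity.
    rewrite (cA_ext _ _ k E), (cB_ext _ _ k E).
    rewrite !cA_plus, !cB_plus, !cA_scal, !cB_scal, IA, IB by cnt.
    unfold cA, cB.
    rewrite RInt_cs_cs, RInt_sn_sn, RInt_cs_sn, RInt_sn_cs by lia.
    split; ring.
Qed.

(** Orthogonality removes the cross terms, and each frequency contributes at most $a_n^2 + b_n^2$ by
    a pointwise Cauchy-Schwarz inequality. This bound also covers frequency 0, where the factor 1/2
    of the other frequencies is absent. *)
Lemma tpoly_square_le (a b : nat -> R) (N j : nat) :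
  RInt (fun x => tpoly a b N j x ^ 2) 0 1 <= bsum (fun n => a n ^ 2 + b n ^ 2) N j.
Proof.
  induction j as [|j IH].
  - right; unfold tpoly; simpl; rewrite (RInt_ext_R _ (fun _ => 0)) by (intros; ring).
    rewrite RInt_const_R; rng.
  - assert (C := cont_tpoly a b N j).
    assert (Cc := cont_cs (N + j)); assert (Cn := cont_sn (N + j)).
    destruct (tpoly_ortho a b N j (N + j) (Nat.le_refl _)) as [OA OB].
    unfold cA, cB in OA, OB.
    rewrite (RInt_ext_R _ (fun x => tpoly a b N j x ^ 2
      + (2 * a (N + j)%nat * (tpoly a b N j x * cs (N + j) x)
         + 2 * b (N + j)%nat * (tpoly a b N j x * sn (N + j) x)
         + trig a b (N + j) x ^ 2)))
      by (intros; unfold tpoly at 1; simpl; fold (tpoly a b N j x); unfold trig; ring).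
    assert (Ct := cont_trig a b (N + j)).
    rewrite !RInt_plus_cont, !RInt_scal_cont, OA, OB by cnt.
    change (bsum (fun n => a n ^ 2 + b n ^ 2) N (S j)) with
      (bsum (fun n => a n ^ 2 + b n ^ 2) N j + (a (N + j)%nat ^ 2 + b (N + j)%nat ^ 2)).
    assert (E : RInt (fun x => trig a b (N + j) x ^ 2) 0 1
      <= RInt (fun _ => a (N + j)%nat ^ 2 + b (N + j)%nat ^ 2) 0 1).
    { apply RInt_le_cont; [lra | cnt | cnt |]; intros x _.
      pose proof (cs2_sn2 (N + j) x) as H; unfold trig.
      pose proof (pow2_ge_0 (a (N + j)%nat * sn (N + j) x - b (N + j)%nat * cs (N + j) x)).
      replace (a (N + j)%nat ^ 2 + b (N + j)%nat ^ 2) with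
        ((a (N + j)%nat ^ 2 + b (N + j)%nat ^ 2) * (cs (N + j) x ^ 2 + sn (N + j) x ^ 2))
        by (rewrite H; ring).
      lra. }
    rewrite RInt_const_R in E; lra.
Qed.

Lemma bessel (f : R -> R) (j : nat) : cont f ->
  bsum (en f) 0 j <= RInt (fun x => f x ^ 2) 0 1.
Proof.
  intros Cf.
  (* The coefficients are not doubled as in a Fourier series: with this choice the pairing of [f]
     with [P] equals the sum of the energies while the square of [P] integrates to at most that sum,
     and expanding the square of [f - P] gives the claim. *)
  set (P := tpoly (cA f) (cB f) 0 j).
  assert (CP : cont P) by apply cont_tpoly.
  assert (I : RInt (fun x => f x * P x) 0 1 = bsum (en f) 0 j).
  { unfold P; clear P CP; induction j as [|j IH].
    - unfold tpoly; simpl; rewrite (RInt_ext_R _ (fun _ => 0)) by (intros; ring).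
      rewrite RInt_const_R; rng.
    - assert (C := cont_tpoly (cA f) (cB f) 0 j).
      assert (Cc := cont_cs j); assert (Cn := cont_sn j).
      rewrite (RInt_ext_R _ (fun x => f x * tpoly (cA f) (cB f) 0 j x +
        (cA f j * (f x * cs j x) + cB f j * (f x * sn j x))))
        by (intros; unfold tpoly at 1; simpl; fold (tpoly (cA f) (cB f) 0 j x);
            unfold trig; ring).
      rewrite !RInt_plus_cont, !RInt_scal_cont, IH by cnt.
      simpl; unfold en; fold (cA f j) (cB f j); rng. }
  pose proof (tpoly_square_le (cA f) (cB f) 0 j) as Q; fold P in Q.
  assert (S0 : 0 <= RInt (fun x => (f x - P x) ^ 2) 0 1)
    by (apply RInt_ge_0_cont; [lra | cnt | intros; apply pow2_ge_0]).
  rewrite (RInt_ext_R _ (fun x => f x ^ 2 - 2 * (f x * P x) + P x ^ 2)) in S0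
    by (intros; ring).
  rewrite RInt_plus_cont, RInt_minus_cont, RInt_scal_cont, I in S0 by cnt.
  change (bsum (fun n => cA f n ^ 2 + cB f n ^ 2) 0 j) with (bsum (en f) 0 j) in Q.
  lra.
Qed.

(** * Fourier coefficients of derivatives *)

(** Integration by parts exchanges sine and cosine coefficients with a factor $2\pi n$. The constant
    [c] is invisible at frequencies [n >= 1]; it will absorb the constant terms in the derivatives
    of [velx] and [acc]. *)
Lemma en_derive (f h : R -> R) (c : R) (n : nat) : periodic1 f -> cont h ->
  (forall x, is_derive f x (h x + c)) -> (1 <= n)%nat ->
  (2 * PI * INR n) ^ 2 * en f n = en h n.
Proof.
  intros Pf Ch Hf Hn.
  set (w := 2 * PI * INR n).
  assert (Cf : cont f) by (apply (cont_derive f (fun x => h x + c)); auto).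
  assert (Cc := cont_cs n); assert (Cn := cont_sn n).
  assert (Zc : RInt (cs n) 0 1 = 0).
  { rewrite (RInt_ext_R _ (fun x => cos (2 * PI * IZR (Z.of_nat n) * x)))
      by (intros; unfold cs; rewrite INR_IZR_INZ; reflexivity).
    apply RInt_cos_IZR; lia. }
  assert (Zs : RInt (sn n) 0 1 = 0).
  { rewrite (RInt_ext_R _ (fun x => sin (2 * PI * IZR (Z.of_nat n) * x)))
      by (intros; unfold sn; rewrite INR_IZR_INZ; reflexivity).
    apply RInt_sin_IZR. }
  assert (EA : cA h n = w * cB f n).
  { unfold cA, cB.
    pose proof (RInt_by_parts_periodic1 f (fun x => h x + c) (cs n) _ Hf (cs_derive n)
      ltac:(cnt) ltac:(cnt) Pf (cs_periodic1 n)) as E.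
    rewrite (RInt_ext_R (fun x => (h x + c) * cs n x) (fun x => h x * cs n x + c * cs n x)) in E
      by (intros; ring).
    rewrite (RInt_ext_R (fun x => f x * - (2 * PI * INR n * sn n x))
      (fun x => - w * (f x * sn n x))) in E by (intros; unfold w; ring).
    rewrite RInt_plus_cont, !RInt_scal_cont, Zc in E by cnt; lra. }
  assert (EB : cB h n = - w * cA f n).
  { unfold cA, cB.
    pose proof (RInt_by_parts_periodic1 f (fun x => h x + c) (sn n) _ Hf (sn_derive n)
      ltac:(cnt) ltac:(cnt) Pf (sn_periodic1 n)) as E.
    rewrite (RInt_ext_R (fun x => (h x + c) * sn n x) (fun x => h x * sn n x + c * sn n x)) in E
      by (intros; ring).
    rewrite (RInt_ext_R (fun x => f x * (2 * PI * INR n * cs n x))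
      (fun x => w * (f x * cs n x))) in E by (intros; unfold w; ring).
    rewrite RInt_plus_cont, !RInt_scal_cont, Zs in E by cnt; lra. }
  unfold en; rewrite EA, EB; ring.
Qed.

Lemma hw_le (n : nat) : (1 <= n)%nat -> hw n <= (2 * PI * INR n) ^ 2.
Proof.
  intros Hn; apply le_INR in Hn; simpl (INR 1) in Hn.
  pose proof PI2_3_2; unfold hw.
  assert (2 * INR n <= 2 * PI * INR n) by nra.
  assert ((2 * INR n) ^ 2 <= (2 * PI * INR n) ^ 2) by (apply pow_incr; lra).
  nra.
Qed.

Lemma en_derive_le (f h : R -> R) (c : R) (n : nat) : periodic1 f -> cont h ->
  (forall x, is_derive f x (h x + c)) -> (1 <= n)%nat -> hw n * en f n <= en h n.
Proof.
  intros Pf Ch Hf Hn; rewrite <- (en_derive f h c n Pf Ch Hf Hn).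
  apply Rmult_le_compat_r; [apply en_ge0 | apply hw_le, Hn].
Qed.

Definition energy1 (f : R -> R) (n : nat) : R := hw n * en f n.

Lemma energy1_ge0 (f : R -> R) (n : nat) : 0 <= energy1 f n.
Proof. apply Rmult_le_pos; [pose proof (hw_ge1 n); lra | apply en_ge0]. Qed.

Lemma energy1_ext (f g : R -> R) (n : nat) : (forall x, f x = g x) -> energy1 f n = energy1 g n.
Proof. intros H; unfold energy1; rewrite (en_ext f g); auto. Qed.

(** Frequencies [n >= 1] are controlled by the derivative and frequency 0, where the weight is 1, by
    the function; Bessel's inequality bounds both sums. *)
Lemma energy1_C1 (f df : R -> R) (j : nat) : periodic1 f -> cont df ->
  (forall x, is_derive f x (df x)) ->
  bsum (energy1 f) 0 j <= RInt (fun x => f x ^ 2 + df x ^ 2) 0 1.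
Proof.
  intros Pf Cdf Hf.
  assert (Cf : cont f) by (apply (cont_derive f df); auto).
  rewrite RInt_plus_cont by cnt.
  eapply Rle_trans; [|apply Rplus_le_compat; [apply (bessel f j Cf) | apply (bessel df j Cdf)]].
  rewrite <- bsum_plus; apply bsum_le; intros n _.
  pose proof (en_ge0 f n); pose proof (en_ge0 df n).
  destruct (Nat.eq_dec n 0) as [->|Hn].
  - unfold energy1, hw; simpl; lra.
  - assert (energy1 f n <= en df n).
    { apply (en_derive_le f df 0); auto; [|lia].
      intros x; eapply is_derive_eq; [apply Hf | ring]. }
    lra.
Qed.

Lemma energy1_plus (f g : R -> R) (j : nat) (A B : R) : cont f -> cont g ->
  bsum (energy1 f) 0 j <= A -> bsum (energy1 g) 0 j <= B ->
  bsum (energy1 (fun x => f x + g x)) 0 j <= 2 * A + 2 * B.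
Proof.
  intros Cf Cg HA HB.
  apply Rle_trans with (bsum (fun n => 2 * energy1 f n + 2 * energy1 g n) 0 j).
  - apply bsum_le; intros n _; unfold energy1, en.
    rewrite cA_plus, cB_plus by auto.
    pose proof (hw_ge1 n).
    pose proof (pow2_ge_0 (cA f n - cA g n)); pose proof (pow2_ge_0 (cB f n - cB g n)).
    replace (2 * (hw n * (cA f n ^ 2 + cB f n ^ 2)) + 2 * (hw n * (cA g n ^ 2 + cB g n ^ 2)))
      with (hw n * (2 * (cA f n ^ 2 + cB f n ^ 2) + 2 * (cA g n ^ 2 + cB g n ^ 2))) by ring.
    apply Rmult_le_compat_l; lra.
  - rewrite bsum_plus, !bsum_scal; lra.
Qed.

Lemma energy1_scal (c : R) (f : R -> R) (n : nat) : cont f ->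
  energy1 (fun x => c * f x) n = c ^ 2 * energy1 f n.
Proof. intros Cf; unfold energy1, en; rewrite cA_scal, cB_scal by auto; ring. Qed.

(** * Uniqueness and uniform convergence of Fourier series *)

(** Frequencies range over [Z] because multiplication by [bump] shifts them by one in both
    directions. *)
Definition cz (k : Z) (x : R) : R := cos (2 * PI * IZR k * x).
Definition sz (k : Z) (x : R) : R := sin (2 * PI * IZR k * x).

Lemma cont_cz (k : Z) : cont (cz k).
Proof. unfold cz; cnt. Qed.

Lemma cont_sz (k : Z) : cont (sz k).
Proof. unfold sz; cnt. Qed.

(** This is $\cos^2(\pi(x - x_0))$, a trigonometric polynomial of degree 1 whose powers concentrate
    at [x0] modulo 1. *)
Definition bump (x0 x : R) : R := (1 + cos (2 * PI * (x - x0))) / 2.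

Lemma cont_bump (x0 : R) : cont (bump x0).
Proof. unfold bump; cnt. Qed.

Lemma bump_cz (x0 x : R) (k : Z) : bump x0 x * cz k x = / 2 * cz k x
  + / 4 * cos (2 * PI * x0) * (cz (k + 1) x + cz (k - 1) x)
  + / 4 * sin (2 * PI * x0) * (sz (k + 1) x - sz (k - 1) x).
Proof.
  unfold bump, cz, sz; rewrite plus_IZR, minus_IZR.
  replace (2 * PI * (x - x0)) with (2 * PI * x - 2 * PI * x0) by ring.
  replace (2 * PI * (IZR k + 1) * x) with (2 * PI * IZR k * x + 2 * PI * x) by ring.
  replace (2 * PI * (IZR k - 1) * x) with (2 * PI * IZR k * x - 2 * PI * x) by ring.
  rewrite !cos_minus, !cos_plus, !sin_plus, !sin_minus; field.
Qed.

Lemma bump_sz (x0 x : R) (k : Z) : bump x0 x * sz k x = / 2 * sz k x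
  + / 4 * cos (2 * PI * x0) * (sz (k + 1) x + sz (k - 1) x)
  + / 4 * sin (2 * PI * x0) * (cz (k - 1) x - cz (k + 1) x).
Proof.
  unfold bump, cz, sz; rewrite plus_IZR, minus_IZR.
  replace (2 * PI * (x - x0)) with (2 * PI * x - 2 * PI * x0) by ring.
  replace (2 * PI * (IZR k + 1) * x) with (2 * PI * IZR k * x + 2 * PI * x) by ring.
  replace (2 * PI * (IZR k - 1) * x) with (2 * PI * IZR k * x - 2 * PI * x) by ring.
  rewrite !cos_minus, !cos_plus, !sin_plus, !sin_minus; field.
Qed.

Definition null_coefs (g : R -> R) : Prop :=
  forall k, RInt (fun x => g x * cz k x) 0 1 = 0 /\ RInt (fun x => g x * sz k x) 0 1 = 0.

Lemma null_coefs_bump (g : R -> R) (x0 : R) : cont g -> null_coefs g ->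
  null_coefs (fun x => g x * bump x0 x).
Proof.
  intros Cg H k.
  destruct (H k) as [A B]; destruct (H (k + 1)%Z) as [A1 B1]; destruct (H (k - 1)%Z) as [A2 B2].
  assert (C := cont_cz k); assert (C1 := cont_cz (k + 1)); assert (C2 := cont_cz (k - 1)).
  assert (S := cont_sz k); assert (S1 := cont_sz (k + 1)); assert (S2 := cont_sz (k - 1)).
  split.
  - rewrite (RInt_ext_R _ (fun x => / 2 * (g x * cz k x)
      + / 4 * cos (2 * PI * x0) * (g x * cz (k + 1) x + g x * cz (k - 1) x)
      + / 4 * sin (2 * PI * x0) * (g x * sz (k + 1) x - g x * sz (k - 1) x)))
      by (intros x; rewrite Rmult_assoc, bump_cz; ring).
    rewrite !RInt_plus_cont, !RInt_scal_cont, RInt_plus_cont, RInt_minus_cont by cnt.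
    rewrite A, A1, A2, B1, B2; rng.
  - rewrite (RInt_ext_R _ (fun x => / 2 * (g x * sz k x)
      + / 4 * cos (2 * PI * x0) * (g x * sz (k + 1) x + g x * sz (k - 1) x)
      + / 4 * sin (2 * PI * x0) * (g x * cz (k - 1) x - g x * cz (k + 1) x)))
      by (intros x; rewrite Rmult_assoc, bump_sz; ring).
    rewrite !RInt_plus_cont, !RInt_scal_cont, RInt_plus_cont, RInt_minus_cont by cnt.
    rewrite B, B1, B2, A1, A2; rng.
Qed.

Lemma null_coefs_bump_pow (f : R -> R) (x0 : R) (n : nat) : cont f -> null_coefs f ->
  RInt (fun x => f x * bump x0 x ^ n) 0 1 = 0.
Proof.
  intros Cf H.
  assert (Cb := cont_bump x0).
  assert (N : null_coefs (fun x => f x * bump x0 x ^ n)).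
  { induction n as [|n IH]; intros k.
    - destruct (H k) as [A B].
      split; [eapply eq_trans; [|exact A] | eapply eq_trans; [|exact B]];
        apply RInt_ext_R; intros; simpl; ring.
    - destruct (null_coefs_bump (fun x => f x * bump x0 x ^ n) x0 ltac:(cnt) IH k) as [A B].
      split; [eapply eq_trans; [|exact A] | eapply eq_trans; [|exact B]];
        apply RInt_ext_R; intros; simpl; ring. }
  destruct (N 0%Z) as [A _]; eapply eq_trans; [|exact A]; apply RInt_ext_R; intros x.
  unfold cz; rewrite Rmult_0_r, Rmult_0_l, cos_0; ring.
Qed.

Lemma bump_bounds (x0 x : R) : 0 <= bump x0 x <= 1.
Proof. unfold bump; pose proof (COS_bound (2 * PI * (x - x0))); lra. Qed.

Lemma bump_decreasing (x0 x y : R) : Rabs (x - x0) <= Rabs (y - x0) -> Rabs (y - x0) <= / 2 ->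
  bump x0 y <= bump x0 x.
Proof.
  intros Hxy Hy; unfold bump.
  assert (E : forall z, cos (2 * PI * z) = cos (2 * PI * Rabs z)).
  { intros z; unfold Rabs; destruct Rcase_abs; [|reflexivity].
    rewrite <- cos_neg; f_equal; ring. }
  rewrite (E (x - x0)), (E (y - x0)).
  pose proof (Rabs_pos (x - x0)); pose proof PI_RGT_0.
  assert (cos (2 * PI * Rabs (y - x0)) <= cos (2 * PI * Rabs (x - x0)))
    by (apply cos_decr_1; nra).
  lra.
Qed.

Lemma bump_decreasing_strict (x0 d : R) : 0 < d <= / 2 -> bump x0 (x0 + d) < bump x0 (x0 + d / 2).
Proof.
  intros Hd; unfold bump.
  replace (x0 + d - x0) with d by ring; replace (x0 + d / 2 - x0) with (d / 2) by ring.
  pose proof PI_RGT_0.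
  assert (cos (2 * PI * d) < cos (2 * PI * (d / 2))) by (apply cos_decreasing_1; nra).
  lra.
Qed.

(** If [f x0 > 0], the integral of [f * bump ^ n] is still 0, yet the points within [d / 2] of [x0]
    contribute at least [c * d * r2 ^ n] while the negative contribution is at most [B * r1 ^ n]
    with [r1 < r2]. Large [n] gives a contradiction. *)
Lemma null_coefs_nonpos (f : R -> R) (x0 : R) : cont f -> periodic1 f -> null_coefs f -> f x0 <= 0.
Proof.
  intros Cf Pf H; apply Rnot_lt_le; intros Hx0.
  destruct (cont_eps f x0 (f x0 / 2) Cf ltac:(lra)) as [d0 [Hd0 Hd]].
  set (d := Rmin (d0 / 2) (/ 4)).
  assert (d_pos : 0 < d) by (apply Rmin_pos; lra).
  assert (d_le : d <= / 4) by apply Rmin_r.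
  assert (d_lt : d < d0) by (assert (d <= d0 / 2) by apply Rmin_l; lra).
  set (c := f x0 / 2).
  assert (f_c : forall x, Rabs (x - x0) <= d -> c <= f x).
  { intros x Hx; specialize (Hd x ltac:(lra)); apply Rabs_lt_between in Hd; unfold c; lra. }
  destruct (cont_bounded f (x0 - / 2) (x0 + / 2) ltac:(lra) Cf) as [B [HB f_B]].
  set (r1 := bump x0 (x0 + d)); set (r2 := bump x0 (x0 + d / 2)).
  assert (r12 : r1 < r2) by (apply bump_decreasing_strict; lra).
  assert (r1_0 : 0 <= r1) by apply bump_bounds.
  assert (Cb := cont_bump x0).
  assert (I : forall n, c * d * r2 ^ n <= B * r1 ^ n).
  { intros n.
    set (g := fun x => f x * bump x0 x ^ n).
    assert (Cg : cont g) by (unfold g; cnt).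
    assert (Z : RInt g (x0 - / 2) (x0 + / 2) = 0).
    { replace (x0 + / 2) with (x0 - / 2 + 1) by field.
      rewrite RInt_periodic1; auto; [apply null_coefs_bump_pow; auto|].
      intros x; unfold g; rewrite Pf; do 2 f_equal; unfold bump; do 2 f_equal.
      replace (2 * PI * (x + 1 - x0)) with (2 * PI * (x - x0) + 2 * PI * IZR 1) by ring.
      apply cos_2PI_IZR. }
    (* Between [d / 2] and [d] the integrand is still nonnegative; beyond [d] the bump is at most
       [r1]. *)
    assert (Out : forall x, d / 2 <= Rabs (x - x0) -> x0 - / 2 <= x <= x0 + / 2 ->
      - (B * r1 ^ n) <= g x).
    { intros x Hx Hx'.
      pose proof (bump_bounds x0 x) as Hb.
      pose proof (pow_le (bump x0 x) n (proj1 Hb)) as Hbn.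
      pose proof (pow_le r1 n r1_0) as Hrn.
      destruct (Rle_dec (Rabs (x - x0)) d) as [Hc|Hc].
      - pose proof (f_c x Hc); unfold g, c in *.
        apply Rle_trans with 0; [nra|]; apply Rmult_le_pos; lra.
      - assert (Hbr : bump x0 x <= r1).
        { apply bump_decreasing.
          - replace (x0 + d - x0) with d by ring; rewrite (Rabs_pos_eq d); lra.
          - apply Rabs_le_between; lra. }
        pose proof (pow_incr _ _ n (conj (proj1 Hb) Hbr)) as Hpow.
        specialize (f_B x Hx'); apply Rabs_le_between in f_B; unfold g; nra. }
    assert (I1 : - (B * r1 ^ n) * (/ 2 - d / 2) <= RInt g (x0 - / 2) (x0 - d / 2)).
    { apply Rle_trans with (RInt (fun _ => - (B * r1 ^ n)) (x0 - / 2) (x0 - d / 2)).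
      - rewrite RInt_const_R; apply Req_le; field.
      - apply RInt_le_cont; [lra | cnt | auto |]; intros x Hx; apply Out; [|lra].
        rewrite Rabs_left1; lra. }
    assert (I3 : - (B * r1 ^ n) * (/ 2 - d / 2) <= RInt g (x0 + d / 2) (x0 + / 2)).
    { apply Rle_trans with (RInt (fun _ => - (B * r1 ^ n)) (x0 + d / 2) (x0 + / 2)).
      - rewrite RInt_const_R; apply Req_le; field.
      - apply RInt_le_cont; [lra | cnt | auto |]; intros x Hx; apply Out; [|lra].
        rewrite Rabs_pos_eq; lra. }
    assert (I2 : c * r2 ^ n * d <= RInt g (x0 - d / 2) (x0 + d / 2)).
    { apply Rle_trans with (RInt (fun _ => c * r2 ^ n) (x0 - d / 2) (x0 + d / 2)).
      - rewrite RInt_const_R; apply Req_le; field.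
      - apply RInt_le_cont; [lra | cnt | auto |]; intros x Hx.
        assert (Hx' : Rabs (x - x0) <= d / 2) by (apply Rabs_le_between; lra).
        unfold g; apply Rmult_le_compat.
        + unfold c; lra.
        + apply pow_le; lra.
        + apply f_c; lra.
        + apply pow_incr; split; [lra|].
          apply bump_decreasing; replace (x0 + d / 2 - x0) with (d / 2) by ring;
            rewrite (Rabs_pos_eq (d / 2)) by lra; lra. }
    pose proof (RInt_Chasles_cont g (x0 - / 2) (x0 - d / 2) (x0 + d / 2) Cg).
    pose proof (RInt_Chasles_cont g (x0 - / 2) (x0 + d / 2) (x0 + / 2) Cg).
    pose proof (pow_le r1 n r1_0).
    assert (0 <= B * r1 ^ n) by nra.
    assert (c * d * r2 ^ n = c * r2 ^ n * d) by ring.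
    nra. }
  assert (r2_0 : 0 < r2) by lra.
  assert (q0 : 0 <= r1 / r2) by (apply Rdiv_le_0_compat; lra).
  assert (q1 : r1 / r2 < 1) 
    by (apply (Rmult_lt_reg_r r2); [lra|]; unfold Rdiv; rewrite Rmult_assoc, Rinv_l; lra).
  assert (cd : 0 < c * d / B).
  { apply Rdiv_lt_0_compat; [|lra]; apply Rmult_lt_0_compat; unfold c; lra. }
  destruct (pow_lt_1_zero (r1 / r2) ltac:(rewrite Rabs_pos_eq; lra) (c * d / B) cd) as [n Hn].
  specialize (Hn n (Nat.le_refl n)); specialize (I n).
  rewrite Rabs_pos_eq in Hn by (apply pow_le; lra).
  unfold Rdiv at 1 in Hn; rewrite Rpow_mult_distr, pow_inv in Hn.
  assert (r2n : 0 < r2 ^ n) by (apply pow_lt; lra).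
  apply (Rmult_lt_compat_r (B * r2 ^ n)) in Hn; [|nra].
  replace (r1 ^ n * / r2 ^ n * (B * r2 ^ n)) with (B * r1 ^ n) in Hn by (field; lra).
  replace (c * d / B * (B * r2 ^ n)) with (c * d * r2 ^ n) in Hn by (field; lra).
  lra.
Qed.

(** The one-sided comparison is applied in both orders; negative frequencies reduce to natural ones
    by parity. *)
Lemma fourier_unique (f g : R -> R) : cont f -> cont g -> periodic1 f -> periodic1 g ->
  (forall n, cA f n = cA g n) -> (forall n, cB f n = cB g n) -> forall x, f x = g x.
Proof.
  assert (Main : forall f g, cont f -> cont g -> periodic1 f -> periodic1 g ->
    (forall n, cA f n = cA g n) -> (forall n, cB f n = cB g n) -> forall x, f x <= g x).
  { clear f g; intros f g Cf Cg Pf Pg HA HB x.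
    apply Rminus_le; apply (null_coefs_nonpos (fun x => f x - g x)); [cnt | |].
    { intros y; rewrite Pf, Pg; reflexivity. }
    assert (HA' : forall n, RInt (fun x => (f x - g x) * cs n x) 0 1 = 0).
    { intros n; fold (cA (fun x => f x - g x) n); rewrite cA_minus, HA; auto; lra. }
    assert (HB' : forall n, RInt (fun x => (f x - g x) * sn n x) 0 1 = 0).
    { intros n; fold (cB (fun x => f x - g x) n); rewrite cB_minus, HB; auto; lra. }
    intros k; destruct (Z_le_dec 0 k) as [Hk|Hk].
    - rewrite <- (Z2Nat.id k) by lia; split.
      + eapply eq_trans; [|apply (HA' (Z.to_nat k))]; apply RInt_ext_R; intros y.
        unfold cs, cz; rewrite INR_IZR_INZ; reflexivity.
      + eapply eq_trans; [|apply (HB' (Z.to_nat k))]; apply RInt_ext_R; intros y.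
        unfold sn, sz; rewrite INR_IZR_INZ; reflexivity.
    - assert (E : IZR k = - INR (Z.to_nat (- k)))
        by (rewrite INR_IZR_INZ, Z2Nat.id, opp_IZR by lia; ring).
      split.
      + eapply eq_trans; [|apply (HA' (Z.to_nat (- k)))]; apply RInt_ext_R; intros y.
        unfold cs, cz; rewrite E, <- cos_neg; do 2 f_equal; ring.
      + assert (Cn := cont_sn (Z.to_nat (- k))).
        rewrite (RInt_ext_R _ (fun x => - ((f x - g x) * sn (Z.to_nat (- k)) x))).
        * rewrite RInt_opp_cont, HB' by cnt; rng.
        * intros y; unfold sn, sz; rewrite E.
          replace (2 * PI * - INR (Z.to_nat (- k)) * y)
            with (- (2 * PI * INR (Z.to_nat (- k)) * y)) by ring.
          rewrite sin_neg; ring. }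
  intros Cf Cg Pf Pg HA HB x; apply Rle_antisym; apply Main; auto.
Qed.

(** For real functions the frequencies [n] and [- n] merge, which doubles every coefficient except
    at [n = 0]; there the sine coefficient is 0 anyway. *)
Definition fa (f : R -> R) (n : nat) : R := (if Nat.eqb n 0 then 1 else 2) * cA f n.
Definition fb (f : R -> R) (n : nat) : R := 2 * cB f n.

Definition fsum (f : R -> R) (N j : nat) : R -> R := tpoly (fa f) (fb f) N j.

Lemma fa_fb_square_le (f : R -> R) (n : nat) : fa f n ^ 2 + fb f n ^ 2 <= 4 * en f n.
Proof.
  unfold fa, fb, en; destruct (Nat.eqb n 0);
    pose proof (pow2_ge_0 (cA f n)); pose proof (pow2_ge_0 (cB f n)); nra.
Qed.

Lemma tpoly_coef (a b : nat -> R) (j k : nat) : (k < j)%nat ->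
  cA (tpoly a b 0 j) k = (if Nat.eqb k 0 then 1 else / 2) * a k /\
  cB (tpoly a b 0 j) k = (if Nat.eqb k 0 then 0 else / 2) * b k.
Proof.
  induction j as [|j IH]; intros Hk; [lia|].
  assert (C := cont_tpoly a b 0 j); assert (Cc := cont_cs j); assert (Cn := cont_sn j).
  assert (E : forall x, tpoly a b 0 (S j) x = tpoly a b 0 j x + (a j * cs j x + b j * sn j x))
    by reflexivity.
  rewrite (cA_ext _ _ k E), (cB_ext _ _ k E).
  rewrite !cA_plus, !cB_plus, !cA_scal, !cB_scal by cnt.
  destruct (Nat.eq_dec k j) as [->|Hkj].
  - destruct (tpoly_ortho a b 0 j j ltac:(lia)) as [-> ->].
    unfold cA, cB; rewrite RInt_cs2, RInt_sn2, RInt_cs_sn, RInt_sn_cs.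
    destruct (Nat.eqb j 0); split; ring.
  - destruct IH as [-> ->]; [lia|].
    unfold cA, cB; rewrite RInt_cs_cs, RInt_sn_sn, RInt_cs_sn, RInt_sn_cs by lia; split; ring.
Qed.

Lemma cB_0 (f : R -> R) : cB f 0 = 0.
Proof.
  unfold cB; rewrite (RInt_ext_R _ (fun _ => 0)).
  - rewrite RInt_const_R; rng.
  - intros x; unfold sn; simpl; rewrite Rmult_0_r, Rmult_0_l, sin_0; ring.
Qed.

Lemma cA_0 (f : R -> R) : cA f 0 = RInt f 0 1.
Proof.
  unfold cA; apply RInt_ext_R; intros x.
  unfold cs; simpl; rewrite Rmult_0_r, Rmult_0_l, cos_0; ring.
Qed.

Lemma fsum_coef (f : R -> R) (j k : nat) : (k < j)%nat ->
  cA (fsum f 0 j) k = cA f k /\ cB (fsum f 0 j) k = cB f k.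
Proof.
  intros Hk; unfold fsum; destruct (tpoly_coef (fa f) (fb f) j k Hk) as [-> ->].
  unfold fa, fb; destruct (Nat.eqb_spec k 0) as [->|]; [rewrite cB_0|]; split; field.
Qed.

(** Comparison with a telescoping sum: $1/(1+j^2) \le 4/((j+1)(j+2))$. *)
Lemma ex_series_inv_hw : ex_series (fun n => / hw n).
Proof.
  apply (ex_series_bsum _ 4).
  - intros n; left; apply Rinv_0_lt_compat; pose proof (hw_ge1 n); lra.
  - intros j; apply Rle_trans with (4 - 4 / (INR j + 1)).
    + induction j as [|j IH]; [simpl; lra|].
      change (bsum (fun n => / hw n) 0 (S j)) with (bsum (fun n => / hw n) 0 j + / hw j).
      rewrite S_INR; change (hw j) with (1 + INR j ^ 2); pose proof (pos_INR j) as Hj.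
      assert (/ (1 + INR j ^ 2) <= 4 / (INR j + 1) - 4 / (INR j + 1 + 1)); [|lra].
      replace (4 / (INR j + 1) - 4 / (INR j + 1 + 1)) with (/ ((INR j + 1) * (INR j + 2) / 4))
        by (field; repeat split; lra).
      apply Rinv_le_contravar; [nra|]; pose proof (pow2_ge_0 (2 * INR j - 1)); nra.
    + pose proof (pos_INR j).
      assert (0 < 4 / (INR j + 1)) by (apply Rdiv_lt_0_compat; lra); lra.
Qed.

(** The term is at most $2\sqrt{en}$, and the inequality between arithmetic and geometric means
    splits this between the summable [/ hw n] and the energy, in place of a Cauchy-Schwarz
    inequality for series. *)
Lemma trig_abs_le (f : R -> R) (n : nat) (x : R) :
  Rabs (trig (fa f) (fb f) n x) <= 2 * / hw n + 2 * energy1 f n.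
Proof.
  assert (H : trig (fa f) (fb f) n x ^ 2 <= 4 * en f n).
  { eapply Rle_trans; [|apply fa_fb_square_le].
    unfold trig; pose proof (cs2_sn2 n x) as H.
    pose proof (pow2_ge_0 (fa f n * sn n x - fb f n * cs n x)).
    replace (fa f n ^ 2 + fb f n ^ 2) with
      ((fa f n ^ 2 + fb f n ^ 2) * (cs n x ^ 2 + sn n x ^ 2)) by (rewrite H; ring).
    lra. }
  rewrite <- pow2_abs in H.
  set (y := Rabs (trig (fa f) (fb f) n x)) in *.
  assert (Hy : 0 <= y) by apply Rabs_pos.
  pose proof (hw_ge1 n) as Hw; unfold energy1.
  assert (H1 : hw n * y ^ 2 <= 4 * (hw n * en f n)) by nra.
  assert (H2 : 2 * y <= 4 * / hw n + / 4 * (4 * (hw n * y ^ 2))).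
  { apply (Rmult_le_reg_l (hw n)); [lra|].
    replace (hw n * (4 * / hw n + / 4 * (4 * (hw n * y ^ 2)))) with (4 + (hw n * y) ^ 2)
      by (field; lra).
    pose proof (pow2_ge_0 (hw n * y - 1)); nra. }
  lra.
Qed.

Lemma fsum_split (f : R -> R) (N j : nat) (x : R) :
  fsum f 0 (N + j) x = fsum f 0 N x + fsum f N j x.
Proof. apply bsum_split. Qed.

(** The majorants of [trig_abs_le] give a uniform limit [g], continuous and periodic with the
    Fourier coefficients of [f], so uniqueness identifies it with [f]. *)
Lemma fsum_uniform (f : R -> R) : cont f -> periodic1 f -> ex_series (energy1 f) ->
  forall e, 0 < e -> exists N, forall n x, (N <= n)%nat -> Rabs (fsum f 0 n x - f x) <= e.
Proof.
  intros Cf Pf Hs.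
  set (bd := fun n => 2 * / hw n + 2 * energy1 f n).
  assert (bd0 : forall n, 0 <= bd n).
  { intros n; unfold bd; pose proof (energy1_ge0 f n); pose proof (hw_ge1 n).
    assert (0 < / hw n) by (apply Rinv_0_lt_compat; lra); lra. }
  assert (bds : ex_series bd).
  { apply (ex_series_plus (fun n => 2 * / hw n) (fun n => 2 * energy1 f n)).
    - apply (ex_series_scal 2 (fun n => / hw n)), ex_series_inv_hw.
    - apply (ex_series_scal 2 (energy1 f)), Hs. }
  assert (Hb : forall N j x, Rabs (fsum f N j x) <= bsum bd N j).
  { intros N j x; unfold fsum, tpoly; induction j as [|j IH]; simpl.
    - rewrite Rabs_R0; lra.
    - eapply Rle_trans; [apply Rabs_triang|]; apply Rplus_le_compat; [exact IH|].
      apply trig_abs_le. }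
  destruct (uniform_cauchy_limit (fun n => fsum f 0 n)) as [g Hg].
  { intros e He; destruct (bsum_tail bd e bd0 bds He) as [N HN]; exists N; intros n x Hn.
    replace n with (N + (n - N))%nat by lia; rewrite fsum_split.
    replace (fsum f 0 N x + fsum f N (n - N) x - fsum f 0 N x) with (fsum f N (n - N) x) by ring.
    eapply Rle_trans; [apply Hb | apply HN; lia]. }
  assert (Cg : cont g).
  { apply eps_cont; intros x e He.
    destruct (Hg (e / 4) ltac:(lra)) as [N HN].
    destruct (cont_eps (fsum f 0 N) x (e / 2) (cont_tpoly _ _ _ _) ltac:(lra)) as [d [Hd Hd']].
    exists d; split; [exact Hd|]; intros y Hy; specialize (Hd' y Hy).
    pose proof (HN N y (Nat.le_refl N)) as A1; pose proof (HN N x (Nat.le_refl N)) as A2.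
    apply Rabs_le_between in A1; apply Rabs_le_between in A2; apply Rabs_lt_between in Hd'.
    apply Rabs_lt_between; lra. }
  assert (Pg : periodic1 g).
  { intros x; apply cond_eq; intros e He.
    destruct (Hg (e / 4) ltac:(lra)) as [N HN].
    pose proof (HN N x (Nat.le_refl N)) as A1; pose proof (HN N (x + 1) (Nat.le_refl N)) as A2.
    unfold fsum in A1, A2; rewrite tpoly_periodic1 in A2.
    apply Rabs_le_between in A1; apply Rabs_le_between in A2; apply Rabs_lt_between; lra. }
  (* Each coefficient of the partial sums is eventually constant, hence equal to that of the uniform
     limit. *)
  assert (Int : forall th, cont th -> (forall x, Rabs (th x) <= 1) ->
    forall c N, (forall n, (N <= n)%nat -> RInt (fun x => fsum f 0 n x * th x) 0 1 = c) ->
    c = RInt (fun x => g x * th x) 0 1).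
  { intros th Cth Bth c N Hc; apply cond_eq; intros e He.
    destruct (Hg (e / 2) ltac:(lra)) as [M HM].
    set (n := (M + N)%nat); rewrite <- (Hc n) by (unfold n; lia).
    assert (Cs : cont (fsum f 0 n)) by apply cont_tpoly.
    rewrite <- RInt_minus_cont by cnt.
    apply Rle_lt_trans with (Rabs (1 - 0) * (e / 2)).
    - apply RInt_abs_le_cont; [cnt|]; intros x _.
      replace (fsum f 0 n x * th x - g x * th x) with ((fsum f 0 n x - g x) * th x) by ring.
      rewrite Rabs_mult, <- (Rmult_1_r (e / 2)).
      apply Rmult_le_compat; auto using Rabs_pos; apply HM; unfold n; lia.
    - rewrite Rminus_0_r, Rabs_R1; lra. }
  assert (E : forall x, g x = f x).
  { apply fourier_unique; auto; intros k; symmetry.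
    - apply (Int (cs k) (cont_cs k)) with (N := S k).
      + intros x; apply Rabs_le_between, COS_bound.
      + intros n Hn; apply (fsum_coef f n k); lia.
    - apply (Int (sn k) (cont_sn k)) with (N := S k).
      + intros x; apply Rabs_le_between, SIN_bound.
      + intros n Hn; apply (fsum_coef f n k); lia. }
  intros e He; destruct (Hg e He) as [N HN]; exists N; intros n x Hn; rewrite <- E; auto.
Qed.

(** * Sobolev norms *)

Lemma Cmod_fourier (f : R -> R) (k : Z) : Cmod (fourier f k) ^ 2 =
  RInt (fun x => f x * cz k x) 0 1 ^ 2 + RInt (fun x => f x * sz k x) 0 1 ^ 2.
Proof.
  unfold Cmod, fourier; rewrite pow2_sqrt.
  - simpl fst; simpl snd; unfold cz, sz; ring.
  - simpl; nra.
Qed.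

Lemma sobolev_term_pos (s : R) (f : R -> R) (n : nat) :
  sobolev_term s f (Z.of_nat n) = Rpower (hw n) s * en f n.
Proof.
  unfold sobolev_term; rewrite Cmod_fourier; unfold hw, en, cA, cB, cz, sz, cs, sn.
  rewrite <- INR_IZR_INZ; reflexivity.
Qed.

Lemma sobolev_term_neg (s : R) (f : R -> R) (n : nat) : cont f ->
  sobolev_term s f (- Z.of_nat n - 1) = Rpower (hw (S n)) s * en f (S n).
Proof.
  intros Cf; unfold sobolev_term; rewrite Cmod_fourier.
  assert (E : IZR (- Z.of_nat n - 1) = - INR (S n))
    by (rewrite minus_IZR, opp_IZR, <- INR_IZR_INZ, S_INR; ring).
  unfold hw; rewrite E; f_equal; [f_equal; ring|].
  assert (Cn := cont_sn (S n)).
  unfold en, cA, cB; f_equal.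
  - f_equal; apply RInt_ext_R; intros x; unfold cz, cs; rewrite E, <- cos_neg.
    do 2 f_equal; ring.
  - rewrite (RInt_ext_R _ (fun x => - (f x * sn (S n) x))).
    + rewrite RInt_opp_cont by cnt.
      set (I := RInt _ 0 1); change (((- I)%R : R) ^ 2 = I ^ 2); ring.
    + intros x; unfold sz, sn; rewrite E.
      replace (2 * PI * - INR (S n) * x) with (- (2 * PI * INR (S n) * x)) by ring.
      rewrite sin_neg; ring.
Qed.

Definition energy (s : R) (f : R -> R) (n : nat) : R := Rpower (hw n) s * en f n.

Lemma energy_ge0 (s : R) (f : R -> R) (n : nat) : 0 <= energy s f n.
Proof. apply Rmult_le_pos; [left; apply exp_pos | apply en_ge0]. Qed.

Lemma sobolev_series_energy (s : R) (f : R -> R) (n : nat) : cont f ->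
  sobolev_series s f n = energy s f n + energy s f (S n).
Proof.
  intros Cf; unfold sobolev_series; rewrite sobolev_term_pos, sobolev_term_neg by auto; auto.
Qed.

(** Every nonzero frequency occurs twice in [sobolev_series], which accounts for the factor 2 on the
    bound over natural indices. *)
Lemma sobolev_bound (s : R) (f : R -> R) (B : R) : cont f ->
  (forall j, bsum (energy s f) 0 j <= B) ->
  ex_series (sobolev_series s f) /\ H_norm s f <= sqrt (2 * B).
Proof.
  intros Cf HB.
  destruct (ex_series_bsum (sobolev_series s f) (2 * B)) as [E1 E2].
  - intros n; rewrite sobolev_series_energy by auto.
    pose proof (energy_ge0 s f n); pose proof (energy_ge0 s f (S n)); lra.
  - intros j; rewrite (bsum_ext _ (fun n => energy s f n + energy s f (S n)))
      by (intros; apply sobolev_series_energy; auto).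
    rewrite bsum_plus, <- bsum_shift.
    pose proof (HB j); pose proof (HB (S j)) as HS; rewrite bsum_cons in HS.
    pose proof (energy_ge0 s f 0); lra.
  - split; [exact E1 | apply sqrt_le_1_alt, E2].
Qed.

Lemma in_H1_energy1 (f : R -> R) : in_H 1 f -> ex_series (energy1 f).
Proof.
  intros [_ [Cf Hf]]; apply (ex_series_le (energy1 f) (sobolev_series 1 f)); [|exact Hf].
  intros n; rewrite sobolev_series_energy by exact Cf.
  pose proof (energy_ge0 1 f (S n)); pose proof (energy1_ge0 f n).
  change (norm (energy1 f n)) with (Rabs (energy1 f n)); rewrite Rabs_pos_eq by auto.
  unfold energy at 1; rewrite Rpower_1 by (pose proof (hw_ge1 n); lra).
  unfold energy1; lra.
Qed.

Lemma energy_mono (s s' : R) (f : R -> R) (n : nat) : s <= s' -> energy s f n <= energy s' f n.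
Proof.
  intros Hs; apply Rmult_le_compat_r; [apply en_ge0|].
  apply Rle_Rpower; [apply hw_ge1 | exact Hs].
Qed.

Lemma energy_nat (k : nat) (f : R -> R) (n : nat) : energy (INR k) f n = hw n ^ k * en f n.
Proof. unfold energy; rewrite Rpower_pow; auto; pose proof (hw_ge1 n); lra. Qed.

Lemma energy_le_pow (k : nat) (s : R) (f : R -> R) (n : nat) : s <= INR k ->
  energy s f n <= hw n ^ k * en f n.
Proof. intros Hs; rewrite <- energy_nat; apply energy_mono, Hs. Qed.

(** Index 0 is separated because derivatives carry no information about the mean. *)
Lemma bsum_le_head (F G : nat -> R) (A : R) (j : nat) : F 0%nat <= A -> 0 <= A ->
  (forall n, 0 <= G n) -> (forall n, (1 <= n)%nat -> F n <= G n) ->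
  bsum F 0 j <= A + bsum G 0 j.
Proof.
  intros F0 A0 G0 H; induction j as [|j IH]; simpl; [lra|].
  destruct j as [|j].
  - simpl; specialize (G0 0%nat); lra.
  - specialize (H (S j) ltac:(lia)); lra.
Qed.

Lemma hw_pow_en_0 (k : nat) (f : R -> R) : hw 0 ^ k * en f 0 = RInt f 0 1 ^ 2.
Proof.
  unfold en, hw; rewrite cB_0, cA_0; simpl INR.
  replace (1 + 0 ^ 2) with 1 by ring; rewrite pow1; ring.
Qed.

Lemma energy_le_2 (s : R) (f h : R -> R) (c : R) (j : nat) : s <= 2 -> periodic1 f -> cont h ->
  (forall x, is_derive f x (h x + c)) ->
  bsum (energy s f) 0 j <= RInt f 0 1 ^ 2 + bsum (energy1 h) 0 j.
Proof.
  intros Hs Pf Ch Hf.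
  assert (E : forall n, energy s f n <= hw n ^ 2 * en f n)
    by (intros n; apply energy_le_pow; simpl; lra).
  apply bsum_le_head; auto using energy1_ge0, pow2_ge_0.
  - rewrite <- (hw_pow_en_0 2); apply E.
  - intros n Hn; eapply Rle_trans; [apply E|].
    pose proof (en_derive_le f h c n Pf Ch Hf Hn); pose proof (hw_ge1 n); unfold energy1.
    replace (hw n ^ 2 * en f n) with (hw n * (hw n * en f n)) by ring.
    apply Rmult_le_compat_l; lra.
Qed.

(** Each of the two derivatives gains a weight [hw n], so the $H^3$ energy reduces to the mean and
    to the $H^1$ energy of the second derivative up to a constant. *)
Lemma energy_le_3 (s : R) (f df h : R -> R) (c : R) (j : nat) : s <= 3 -> periodic1 f ->
  cont h -> (forall x, is_derive f x (df x)) -> (forall x, is_derive df x (h x + c)) ->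
  bsum (energy s f) 0 j <= RInt f 0 1 ^ 2 + bsum (energy1 h) 0 j.
Proof.
  intros Hs Pf Ch Hf Hdf.
  assert (E : forall n, energy s f n <= hw n ^ 3 * en f n)
    by (intros n; apply energy_le_pow; simpl; lra).
  assert (Cdf : cont df) by (apply (cont_derive df (fun x => h x + c)); auto).
  assert (Pdf : periodic1 df) by (apply (periodic1_derive f); auto).
  apply bsum_le_head; auto using energy1_ge0, pow2_ge_0.
  - rewrite <- (hw_pow_en_0 3); apply E.
  - intros n Hn; eapply Rle_trans; [apply E|].
    assert (D1 : hw n * en f n <= en df n).
    { apply (en_derive_le f df 0); auto; intros x; eapply is_derive_eq; [apply Hf | ring]. }
    pose proof (en_derive_le df h c n Pdf Ch Hdf Hn) as D2.
    pose proof (hw_ge1 n); unfold energy1.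
    replace (hw n ^ 3 * en f n) with (hw n * (hw n * (hw n * en f n))) by ring.
    apply Rmult_le_compat_l; [lra|].
    apply Rle_trans with (hw n * en df n); [apply Rmult_le_compat_l; lra | exact D2].
Qed.

Lemma H_norm_filterlim (s t : R) (D : R -> Prop) (F : R -> R -> R) : (forall r, cont (F r)) ->
  (forall e, 0 < e -> exists d, 0 < d /\ forall r, Rabs (r - t) < d -> D r ->
    forall j, bsum (energy s (F r)) 0 j <= e) ->
  filterlim (fun r => H_norm s (F r)) (within D (locally t)) (locally 0).
Proof.
  intros CF H; apply filterlim_locally; intros [e He].
  (* Chosen so that the bound [sqrt (2 * B)] of [sobolev_bound] becomes [e / 2]. *)
  destruct (H ((e / 2) ^ 2 / 2)) as [d [Hd Hr]].
  { apply Rdiv_lt_0_compat; [apply pow_lt|]; lra. }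
  exists (mkposreal d Hd); intros r Br Dr.
  destruct (sobolev_bound s (F r) _ (CF r) (Hr r Br Dr)) as [_ B].
  replace (2 * ((e / 2) ^ 2 / 2)) with ((e / 2) ^ 2) in B by field.
  rewrite sqrt_pow2 in B by lra.
  change (Rabs (H_norm s (F r) - 0) < e); rewrite Rminus_0_r, Rabs_pos_eq by apply sqrt_pos; lra.
Qed.

Lemma bsum_derive (f df : nat -> R -> R) (N j : nat) (t : R) :
  (forall n, is_derive (f n) t (df n t)) ->
  is_derive (fun s => bsum (fun n => f n s) N j) t (bsum (fun n => df n t) N j).
Proof.
  intros H; induction j as [|j IH]; simpl; [apply is_derive_const_R|].
  apply (is_derive_plus_R (fun s => bsum (fun n => f n s) N j) (f (N + j)%nat)); auto.
Qed.

(** The mean value theorem for the scalar function obtained by pairing the curve of Fourier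
    coefficients with the increment itself bounds a difference quotient in norm. *)
Lemma energy_difference_quotient (s t r : R) (u v : R -> R -> R) (j : nat) : r <> t ->
  (forall t, cont (u t)) -> (forall t, cont (v t)) ->
  (forall n t, is_derive (fun s => cA (u s) n) t (cA (v t) n)) ->
  (forall n t, is_derive (fun s => cB (u s) n) t (cB (v t) n)) ->
  exists z, Rmin t r <= z <= Rmax t r /\
    bsum (energy s (fun x => (u r x - u t x) / (r - t) - v t x)) 0 j
      <= bsum (energy s (fun x => v z x - v t x)) 0 j.
Proof.
  intros Hr Cu Cv DA DB.
  assert (Hrt : r - t <> 0) by lra.
  set (X := fun n => (cA (u r) n - cA (u t) n) / (r - t) - cA (v t) n).
  set (Y := fun n => (cB (u r) n - cB (u t) n) / (r - t) - cB (v t) n).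
  set (w := fun n => Rpower (hw n) s).
  assert (w0 : forall n, 0 < w n) by (intros; apply exp_pos).
  assert (Cr := Cu r); assert (Ct := Cu t); assert (Cvt := Cv t).
  assert (Q : forall x, / (r - t) * (u r x - u t x) - v t x
    = (u r x - u t x) / (r - t) - v t x) by (intros; unfold Rdiv; ring).
  assert (EX : forall n, cA (fun x => (u r x - u t x) / (r - t) - v t x) n = X n).
  { intros n; rewrite <- (cA_ext _ _ n Q), cA_minus, cA_scal, cA_minus by cnt.
    unfold X, Rdiv; ring. }
  assert (EY : forall n, cB (fun x => (u r x - u t x) / (r - t) - v t x) n = Y n).
  { intros n; rewrite <- (cB_ext _ _ n Q), cB_minus, cB_scal, cB_minus by cnt.
    unfold Y, Rdiv; ring. }
  (* Subtracting the linear functions with slopes [cA (v t) n] and [cB (v t) n] makes the increment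
     from [t] to [r] equal to [r - t] times the weighted square of [(X, Y)], while the derivative at
     [z] pairs [(X, Y)] with the coefficients of [v z - v t]. *)
  set (f := fun n z => w n * (X n * (cA (u z) n - cA (v t) n * z)
    + Y n * (cB (u z) n - cB (v t) n * z))).
  set (df := fun n z => w n * (X n * (cA (v z) n - cA (v t) n)
    + Y n * (cB (v z) n - cB (v t) n))).
  assert (D : forall z, is_derive (fun z => bsum (fun n => f n z) 0 j) z
    (bsum (fun n => df n z) 0 j)).
  { intros z; apply bsum_derive; intros n; unfold f, df.
    assert (Id : forall c, is_derive (fun z => c * z) z c)
      by (intros c; auto_derive; [auto | ring]).
    apply is_derive_scal_R, is_derive_plus_R; apply is_derive_scal_R, is_derive_minus_R; auto. }
  destruct (MVT_R _ _ t r D) as [z [Hz E]].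
  exists z; split; [exact Hz|].
  assert (Cvz := Cv z).
  assert (E1 : bsum (fun n => f n r) 0 j - bsum (fun n => f n t) 0 j
    = (r - t) * bsum (fun n => w n * (X n ^ 2 + Y n ^ 2)) 0 j).
  { clear E D; induction j as [|j IH]; [simpl; ring|].
    rewrite !bsum_S, Nat.add_0_l, Rmult_plus_distr_l, <- IH.
    unfold f, X, Y; field; exact Hrt. }
  assert (E2 : bsum (fun n => w n * (X n ^ 2 + Y n ^ 2)) 0 j = bsum (fun n => df n z) 0 j).
  { apply (Rmult_eq_reg_l (r - t)); [|exact Hrt]; lra. }
  (* Young's inequality leaves half of the square of [(X, Y)] on the right, where it is absorbed. *)
  assert (E3 : bsum (fun n => df n z) 0 j <= bsum (fun n => / 2 * (w n * (X n ^ 2 + Y n ^ 2))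
    + / 2 * energy s (fun x => v z x - v t x) n) 0 j).
  { apply bsum_le; intros n _; unfold df, energy, en.
    rewrite cA_minus, cB_minus by auto; fold (w n).
    set (al := cA (v z) n - cA (v t) n); set (be := cB (v z) n - cB (v t) n).
    specialize (w0 n).
    pose proof (pow2_ge_0 (X n - al)); pose proof (pow2_ge_0 (Y n - be)).
    replace (/ 2 * (w n * (X n ^ 2 + Y n ^ 2)) + / 2 * (w n * (al ^ 2 + be ^ 2)))
      with (w n * (/ 2 * (X n ^ 2 + Y n ^ 2 + al ^ 2 + be ^ 2))) by ring.
    apply Rmult_le_compat_l; lra. }
  rewrite bsum_plus, !bsum_scal in E3.
  assert (E4 : bsum (energy s (fun x => (u r x - u t x) / (r - t) - v t x)) 0 j
    = bsum (fun n => w n * (X n ^ 2 + Y n ^ 2)) 0 j).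
  { apply bsum_ext; intros n _; unfold energy, en; rewrite EX, EY; reflexivity. }
  lra.
Qed.

(** * The Lagrangian map and its inverse *)

(** Each Fourier coefficient is continuous under uniform convergence, so a bound on finitely many
    energies passes to the limit without any convergence of derivatives. *)
Lemma bsum_energy1_limit (h : nat -> R -> R) (g : R -> R) (j : nat) (B : R) :
  (forall M, cont (h M)) -> cont g ->
  (forall e, 0 < e -> exists N, forall M x, (N <= M)%nat -> Rabs (h M x - g x) <= e) ->
  (forall M, bsum (energy1 (h M)) 0 j <= B) -> bsum (energy1 g) 0 j <= B.
Proof.
  intros Ch Cg Hu HB.
  assert (Int : forall th, cont th -> (forall x, Rabs (th x) <= 1) ->
    is_lim_seq (fun M => RInt (fun x => h M x * th x) 0 1) (RInt (fun x => g x * th x) 0 1)).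
  { intros th Cth Bth; apply is_lim_seq_spec; intros [e He]; simpl.
    destruct (Hu (e / 2) ltac:(lra)) as [N HN]; exists N; intros M HM.
    assert (CM := Ch M).
    rewrite <- RInt_minus_cont by cnt.
    apply Rle_lt_trans with (Rabs (1 - 0) * (e / 2)).
    - apply RInt_abs_le_cont; [cnt|]; intros x _.
      replace (h M x * th x - g x * th x) with ((h M x - g x) * th x) by ring.
      rewrite Rabs_mult, <- (Rmult_1_r (e / 2)).
      apply Rmult_le_compat; auto using Rabs_pos.
    - rewrite Rminus_0_r, Rabs_R1; lra. }
  assert (L : is_lim_seq (fun M => bsum (energy1 (h M)) 0 j) (bsum (energy1 g) 0 j)).
  { clear HB; induction j as [|j IH]; simpl.
    - apply is_lim_seq_const.
    - apply is_lim_seq_plus'; [exact IH|].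
      unfold energy1, en; apply is_lim_seq_mult'; [apply is_lim_seq_const|].
      assert (LA : is_lim_seq (fun M => cA (h M) j) (cA g j)).
      { apply Int; [apply cont_cs|]; intros x; apply Rabs_le_between, COS_bound. }
      assert (LB : is_lim_seq (fun M => cB (h M) j) (cB g j)).
      { apply Int; [apply cont_sn|]; intros x; apply Rabs_le_between, SIN_bound. }
      apply is_lim_seq_plus'; simpl.
      + apply is_lim_seq_mult'; [exact LA|].
        apply is_lim_seq_mult'; [exact LA | apply is_lim_seq_const].
      + apply is_lim_seq_mult'; [exact LB|].
        apply is_lim_seq_mult'; [exact LB | apply is_lim_seq_const]. }
  apply (is_lim_seq_le _ (fun _ => B) _ B HB L (is_lim_seq_const B)).
Qed.

Section Lagrange.

Variables (phi V : R -> R -> R) (nu : R -> R) (lam mu0 : R).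
Hypotheses (Cphi : cont2 phi) (CV : cont2 V)
  (Pphi : forall t, periodic1 (phi t)) (PV : forall t, periodic1 (V t))
  (phi_0 : forall x, phi 0 x = 0)
  (phi_t : forall t x, is_derive (fun s => phi s x) t (V t x))
  (V_x : forall t x, is_derive (V t) x (lam * exp (phi t x) - nu x * exp (- phi t x)))
  (mass : forall t, RInt (fun x => exp (phi t x)) 0 1 = 1)
  (mean : forall t, RInt (fun x => V t x * exp (phi t x)) 0 1 = 0)
  (Cnu : cont nu) (Pnu : periodic1 nu).

(** In Lagrangian coordinates $U_x = u_x(q)\,q_x = V e^{\phi}$. The constant [U0] is fixed by the
    mean of [u], which becomes the integral of [U] against $e^{\phi}$, and [q] is rebuilt from $q_x
    = e^{\phi}$ and the velocity [U0] of the label 0. *)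
Definition Uint (t x : R) : R := RInt (fun y => V t y * exp (phi t y)) 0 x.
Definition U0 (t : R) : R := mu0 - RInt (fun x => exp (phi t x) * Uint t x) 0 1.
Definition U (t x : R) : R := U0 t + Uint t x.
Definition q (t x : R) : R := RInt U0 0 t + RInt (fun y => exp (phi t y)) 0 x.

Let Cphi1 (t : R) : cont (phi t) := cont2_slice phi t Cphi.
Let CV1 (t : R) : cont (V t) := cont2_slice V t CV.

Lemma cont2_Uint : cont2 Uint.
Proof. apply (cont2_RInt (fun t y => V t y * exp (phi t y))); cnt2. Qed.

Lemma cont_U0 : cont U0.
Proof.
  apply cont_minus; [cnt|].
  apply (cont_RInt_param (fun t x => exp (phi t x) * Uint t x)).
  pose proof cont2_Uint; cnt2.
Qed.

Lemma cont2_U : cont2 U.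
Proof.
  unfold U; apply cont2_plus; [apply (cont2_fst U0), cont_U0 | apply cont2_Uint].
Qed.

Lemma cont_Ve (t : R) : cont (fun y => V t y * exp (phi t y)).
Proof. pose proof (Cphi1 t); pose proof (CV1 t); cnt. Qed.

Lemma cont_e (t : R) : cont (fun y => exp (phi t y)).
Proof. pose proof (Cphi1 t); cnt. Qed.

Lemma Uint_derive (t x : R) : is_derive (Uint t) x (V t x * exp (phi t x)).
Proof. apply (is_derive_prim (fun y => V t y * exp (phi t y))), cont_Ve. Qed.

Lemma U_derive (t x : R) : is_derive (U t) x (V t x * exp (phi t x)).
Proof.
  eapply is_derive_eq.
  - apply (is_derive_plus_R (fun _ => U0 t) (Uint t));
      [apply is_derive_const_R | apply Uint_derive].
  - ring.
Qed.

Lemma U_periodic1 (t : R) : periodic1 (U t).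
Proof.
  intros x; unfold U; f_equal.
  apply (periodic1_prim (fun y => V t y * exp (phi t y))); [|apply cont_Ve | apply mean].
  intros y; rewrite PV, Pphi; reflexivity.
Qed.

Lemma U_mean (t : R) : RInt (fun x => U t x * exp (phi t x)) 0 1 = mu0.
Proof.
  assert (C1 := cont_e t).
  assert (C2 := cont2_slice _ t cont2_Uint).
  rewrite (RInt_ext_R _ (fun x => U0 t * exp (phi t x) + exp (phi t x) * Uint t x))
    by (intros; unfold U; ring).
  pose proof (Cphi1 t).
  rewrite RInt_plus_cont, RInt_scal_cont, mass by cnt; unfold U0; rng.
Qed.

Lemma cont2_q : cont2 q.
Proof.
  unfold q; apply cont2_plus.
  - apply (cont2_fst (fun t => RInt U0 0 t)), cont_prim, cont_U0.
  - apply (cont2_RInt (fun t y => exp (phi t y))); cnt2.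
Qed.

Lemma q_x (t x : R) : is_derive (q t) x (exp (phi t x)).
Proof.
  eapply is_derive_eq.
  - apply (is_derive_plus_R (fun _ => RInt U0 0 t) (fun x => RInt (fun y => exp (phi t y)) 0 x));
      [apply is_derive_const_R | apply (is_derive_prim (fun y => exp (phi t y))), cont_e].
  - ring.
Qed.

Lemma q_t (t x : R) : is_derive (fun s => q s x) t (U t x).
Proof.
  apply (is_derive_plus_R (fun s => RInt U0 0 s) (fun s => RInt (fun y => exp (phi s y)) 0 x)).
  - apply is_derive_prim, cont_U0.
  - apply (is_derive_RInt_param_cont (fun s y => exp (phi s y))
      (fun s y => V s y * exp (phi s y))).
    + intros s y; apply (is_derive_exp_R (fun s => phi s y)), phi_t.
    + apply cont_e.
    + cnt2.
Qed.

Lemma q_0 (x : R) : q 0 x = x.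
Proof.
  unfold q; rewrite (RInt_ext_R (fun y => exp (phi 0 y)) (fun _ => 1))
    by (intros; rewrite phi_0; apply exp_0).
  rewrite RInt_const_R; pose proof (RInt_point 0 U0) as E; change zero with 0 in E.
  rewrite E; ring.
Qed.

(** The Jacobian has mass 1, so [q t] minus the identity is periodic: [q t] is the lift of a circle
    map of degree 1. *)
Lemma q_shift (t : R) (k : Z) (x : R) : q t (x + IZR k) = q t x + IZR k.
Proof.
  assert (P : periodic1 (fun x => q t x - x)).
  { intros y; unfold q.
    pose proof (RInt_Chasles_cont _ 0 y (y + 1) (cont_e t)) as E.
    rewrite (RInt_periodic1 (fun y => exp (phi t y)) y), mass in E.
    - lra.
    - intros z; rewrite Pphi; reflexivity.
    - apply cont_e. }
  pose proof (periodic1_IZR _ P k x) as E; simpl in E; lra.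
Qed.

Lemma q_incr (t x y : R) : x < y -> q t x < q t y.
Proof.
  intros H; destruct (MVT_R (q t) _ x y (q_x t)) as [c [_ E]].
  pose proof (exp_pos (phi t c)); nra.
Qed.

Lemma q_incr_le (t x y : R) : q t x < q t y -> x < y.
Proof.
  intros H; apply Rnot_le_lt; intros [L | ->]; [apply (q_incr t) in L|]; lra.
Qed.

Lemma q_inj (t x y : R) : q t x = q t y -> x = y.
Proof.
  intros H; destruct (Rtotal_order x y) as [L|[L|L]]; [|exact L|];
    apply (q_incr t) in L; lra.
Qed.

(** The integers [k - 1] and [k] bracket a preimage, since [q t] sends them to the translates of
    [q t 0] by the same integers. The form [sig] lets the inverse be extracted as a function. *)
Lemma q_surj (t y : R) : {x | q t x = y}.
Proof.
  set (k := up (y - q t 0)).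
  destruct (archimed (y - q t 0)) as [H1 H2]; fold k in H1, H2.
  pose proof (q_shift t k 0) as E1; pose proof (q_shift t (k - 1) 0) as E2.
  rewrite Rplus_0_l in E1, E2; rewrite minus_IZR in E2.
  destruct (IVT_gen (q t) (IZR (k - 1)) (IZR k) y) as [x [_ Hx]].
  - intros x; apply cont_continuity_pt, cont2_slice, cont2_q.
  - rewrite minus_IZR, E1, E2, Rmin_left, Rmax_right; lra.
  - exists x; exact Hx.
Qed.

Definition qinv (t y : R) : R := proj1_sig (q_surj t y).

Lemma q_qinv (t y : R) : q t (qinv t y) = y.
Proof. exact (proj2_sig (q_surj t y)). Qed.

Lemma qinv_q (t x : R) : qinv t (q t x) = x.
Proof. apply (q_inj t), q_qinv. Qed.

Lemma qinv_0 (y : R) : qinv 0 y = y.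
Proof. rewrite <- (q_0 y) at 1; apply qinv_q. Qed.

Lemma qinv_shift (t y : R) : qinv t (y + 1) = qinv t y + 1.
Proof. apply (q_inj t); rewrite q_qinv, (q_shift t 1), q_qinv; reflexivity. Qed.

(** Strict monotonicity puts [y] strictly between the values of [q t] at [x - e / 2] and
    [x + e / 2]; these inequalities persist for nearby times and points and trap the inverse. *)
Lemma cont2_qinv : cont2 qinv.
Proof.
  intros t y [e He]; simpl.
  set (x := qinv t y).
  assert (L : q t (x - e / 2) < y) by (rewrite <- (q_qinv t y); apply q_incr; fold x; lra).
  assert (R : y < q t (x + e / 2)) by (rewrite <- (q_qinv t y) at 1; apply q_incr; fold x; lra).
  set (g := Rmin ((y - q t (x - e / 2)) / 2) ((q t (x + e / 2) - y) / 2)).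
  assert (Hg : 0 < g) by (apply Rmin_pos; lra).
  assert (Hg1 : g <= (y - q t (x - e / 2)) / 2) by apply Rmin_l.
  assert (Hg2 : g <= (q t (x + e / 2) - y) / 2) by apply Rmin_r.
  destruct (cont_eps (fun s => q s (x - e / 2)) t g (cont2_slice_l _ _ cont2_q) Hg) as [d1 [Hd1 H1]].
  destruct (cont_eps (fun s => q s (x + e / 2)) t g (cont2_slice_l _ _ cont2_q) Hg) as [d2 [Hd2 H2]].
  assert (Hd : 0 < Rmin g (Rmin d1 d2)) by (repeat apply Rmin_pos; lra).
  exists (mkposreal _ Hd); simpl; intros r z Hr Hz.
  assert (Hz' : Rabs (z - y) < g) by (eapply Rlt_le_trans; [apply Hz | apply Rmin_l]).
  specialize (H1 r ltac:(eapply Rlt_le_trans; [apply Hr|];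
    eapply Rle_trans; [apply Rmin_r | apply Rmin_l])).
  specialize (H2 r ltac:(eapply Rlt_le_trans; [apply Hr|];
    eapply Rle_trans; [apply Rmin_r | apply Rmin_r])).
  apply Rabs_lt_between in H1; apply Rabs_lt_between in H2; apply Rabs_lt_between in Hz'.
  assert (x - e / 2 < qinv r z) by (apply (q_incr_le r); rewrite q_qinv; lra).
  assert (qinv r z < x + e / 2) by (apply (q_incr_le r); rewrite q_qinv; lra).
  apply Rabs_lt_between; lra.
Qed.

Lemma qinv_derive (t y : R) : is_derive (qinv t) y (exp (- phi t (qinv t y))).
Proof.
  rewrite exp_Ropp; set (x := qinv t y); set (p := exp (phi t x)).
  assert (Hp : 0 < p) by apply exp_pos.
  apply is_derive_Reals; intros e He.
  assert (Dq := proj1 (is_derive_Reals _ _ _) (q_x t x)); fold p in Dq.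
  (* The bound [p / 2] keeps the difference quotient [z = h / k] of [q] above [p / 2]; the bound
     [e * p * p / 4] then brings [/ z] within [e] of [/ p]. *)
  set (e' := Rmin (p / 2) (e * p * p / 4)).
  assert (He' : 0 < e') by (apply Rmin_pos; [lra|]; repeat apply Rmult_lt_0_compat; lra).
  destruct (Dq e' He') as [d Hd].
  destruct (cont_eps (qinv t) y d (cont2_slice _ _ cont2_qinv) (cond_pos d)) as [d' [Hd' H]].
  exists (mkposreal d' Hd'); simpl; intros h Hh Hh'.
  specialize (H (y + h)); replace (y + h - y) with h in H by ring; specialize (H Hh').
  set (k := qinv t (y + h) - x) in *; fold x in H.
  assert (Hk : qinv t (y + h) = x + k) by (unfold k; ring).
  assert (Hq : q t (x + k) - q t x = h) by (rewrite <- Hk; unfold x; rewrite !q_qinv; ring).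
  assert (Hk0 : k <> 0).
  { intros K; rewrite K, Rplus_0_r in Hq; lra. }
  specialize (Hd k Hk0 ltac:(unfold k; fold x; exact H)); rewrite Hq in Hd.
  fold x; rewrite Hk; replace (x + k - x) with k by ring.
  assert (e1 : e' <= p / 2) by apply Rmin_l.
  assert (e2 : e' <= e * p * p / 4) by apply Rmin_r.
  apply Rabs_lt_between in Hd.
  set (z := h / k) in *.
  assert (Hz : p / 2 < z) by lra.
  replace (k / h - / p) with ((p - z) * / (z * p)).
  2:{ unfold z; field; repeat split; lra. }
  rewrite Rabs_mult, (Rabs_pos_eq (/ (z * p))).
  2:{ left; apply Rinv_0_lt_compat; nra. }
  apply (Rmult_lt_reg_r (z * p)); [nra|].
  rewrite Rmult_assoc, Rinv_l, Rmult_1_r by nra.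
  apply Rlt_le_trans with (e * (p / 2 * p)).
  - apply Rabs_lt_between; nra.
  - apply Rmult_le_compat_l; nra.
Qed.

Lemma RInt_comp_q (t : R) (G : R -> R) : cont G -> periodic1 G ->
  RInt (fun x => G (q t x) * exp (phi t x)) 0 1 = RInt G 0 1.
Proof.
  intros CG PG.
  assert (Cq := cont2_slice _ t cont2_q); pose proof (Cphi1 t) as Cp.
  transitivity (RInt G 0 (q t 1) - RInt G 0 (q t 0)).
  - apply (RInt_FTC (fun x => RInt G 0 (q t x))); [|cnt].
    intros x; apply (is_derive_comp_R (fun y => RInt G 0 y)); [apply is_derive_prim, CG | apply q_x].
  - replace 1 with (0 + IZR 1) at 1 by (simpl; ring); rewrite q_shift.
    pose proof (RInt_Chasles_cont G 0 (q t 0) (q t 0 + 1) CG).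
    pose proof (RInt_periodic1 G (q t 0) PG CG).
    simpl; lra.
Qed.

Lemma pull_periodic1 (K : R -> R) (t : R) : periodic1 K -> periodic1 (fun y => K (qinv t y)).
Proof. intros PK y; rewrite qinv_shift; apply PK. Qed.

Lemma cont_pull (K : R -> R) (t : R) : cont K -> cont (fun y => K (qinv t y)).
Proof. intros CK; apply (cont_comp K (qinv t)); [exact CK | apply cont2_slice, cont2_qinv]. Qed.

Lemma cont2_pull (H : R -> R -> R) : cont2 H -> cont2 (fun t y => H t (qinv t y)).
Proof.
  intros CH; apply (cont2_comp2 H (fun t _ => t) qinv); [exact CH | | apply cont2_qinv].
  apply (cont2_fst (fun t => t)), cont_id.
Qed.

Lemma RInt_pull (K : R -> R) (t : R) : cont K -> periodic1 K ->
  RInt (fun y => K (qinv t y)) 0 1 = RInt (fun x => K x * exp (phi t x)) 0 1.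
Proof.
  intros CK PK; rewrite <- (RInt_comp_q t (fun y => K (qinv t y)));
    [|apply cont_pull; auto | apply pull_periodic1; auto].
  apply RInt_ext_R; intros x; rewrite qinv_q; reflexivity.
Qed.

Lemma pull_derive (K dK : R -> R) (t y : R) : (forall x, is_derive K x (dK x)) ->
  is_derive (fun y => K (qinv t y)) y (dK (qinv t y) * exp (- phi t (qinv t y))).
Proof. intros HK; apply (is_derive_comp_R K (qinv t)); [apply HK | apply qinv_derive]. Qed.

(** * Continuity in time, in the space [H^1] *)

(** For data that are $C^1$ in [x], the pulled-back function and its derivative depend continuously
    on time, uniformly over a period, and this dominates the $H^1$ energy. *)
Lemma pull_C1_continuous (H Hx : R -> R -> R) (t e : R) : cont2 H -> cont2 Hx ->
  (forall t, periodic1 (H t)) -> (forall t x, is_derive (H t) x (Hx t x)) -> 0 < e ->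
  exists d, 0 < d /\ forall r, Rabs (r - t) < d ->
    forall j, bsum (energy1 (fun y => H r (qinv r y) - H t (qinv t y))) 0 j <= e.
Proof.
  intros CH CHx PH DH He.
  set (K := fun t y => Hx t (qinv t y) * exp (- phi t (qinv t y))).
  assert (CK : cont2 K) by (apply (cont2_pull (fun t x => Hx t x * exp (- phi t x))); cnt2).
  assert (CP := cont2_pull H CH); simpl in CP.
  (* With [e' <= 1] the square of a number below [e'] is at most [e'], so the two squares in the
     energy add up to at most [e]. *)
  set (e' := Rmin 1 (e / 2)).
  assert (He' : 0 < e') by (apply Rmin_pos; lra).
  assert (e1 : e' <= 1) by apply Rmin_l.
  assert (e2 : e' <= e / 2) by apply Rmin_r.
  destruct (cont2_unif _ t 0 1 e' CP He') as [d1 [Hd1 H1]].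
  destruct (cont2_unif _ t 0 1 e' CK He') as [d2 [Hd2 H2]].
  exists (Rmin d1 d2); split; [apply Rmin_pos; auto|]; intros r Hr j.
  specialize (H1 r (Rlt_le_trans _ _ _ Hr (Rmin_l _ _))).
  specialize (H2 r (Rlt_le_trans _ _ _ Hr (Rmin_r _ _))).
  assert (CPr := cont2_slice _ r CP); assert (CPt := cont2_slice _ t CP).
  assert (CKr := cont2_slice _ r CK); assert (CKt := cont2_slice _ t CK).
  simpl in CPr, CPt.
  eapply Rle_trans; [apply (energy1_C1 _ (fun y => K r y - K t y)); [| cnt |]|].
  - intros y; rewrite !qinv_shift, !PH; reflexivity.
  - intros y; apply is_derive_minus_R; apply (pull_derive (H _)); auto.
  - apply Rle_trans with (RInt (fun _ => e) 0 1); [|right; rewrite RInt_const_R; rng].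
    apply RInt_le_cont; [lra | cnt | cnt |]; intros x Hx0.
    specialize (H1 x Hx0); specialize (H2 x Hx0).
    rewrite <- (pow2_abs (H r (qinv r x) - _)), <- (pow2_abs (K r x - _)).
    pose proof (Rabs_pos (H r (qinv r x) - H t (qinv t x))); pose proof (Rabs_pos (K r x - K t x)).
    nra.
Qed.

Section Density.

Variables (g gx : R -> R -> R).
Hypotheses (Cg : cont2 g) (Cgx : cont2 gx) (Pg : forall t, periodic1 (g t))
  (g_x : forall t x, is_derive (g t) x (gx t x)).

(** Back in Lagrangian coordinates, the square of the function carries the weight $e^{\phi}$ and
    that of the derivative the weight $e^{-2\phi} e^{\phi} = e^{-\phi}$. All factors are bounded for
    [r] near [t], so the constant is uniform in [r] and [f]. *)
Lemma pull_mult_bound (t : R) : exists d C, 0 < d /\ 0 < C /\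
  forall r, Rabs (r - t) < d -> forall f df j,
    periodic1 f -> cont df -> (forall x, is_derive f x (df x)) ->
    bsum (energy1 (fun y => f (qinv r y) * g r (qinv r y))) 0 j
      <= C * RInt (fun x => f x ^ 2 + df x ^ 2) 0 1.
Proof.
  destruct (cont2_bounded g t Cg) as [d1 [B1 [Hd1 [HB1 H1]]]].
  destruct (cont2_bounded gx t Cgx) as [d2 [B2 [Hd2 [HB2 H2]]]].
  destruct (cont2_bounded (fun t x => exp (phi t x)) t ltac:(cnt2)) as [d3 [B3 [Hd3 [HB3 H3]]]].
  destruct (cont2_bounded (fun t x => exp (- phi t x)) t ltac:(cnt2)) as [d4 [B4 [Hd4 [HB4 H4]]]].
  exists (Rmin (Rmin d1 d2) (Rmin d3 d4)), (B1 ^ 2 * B3 + 2 * (B1 ^ 2 + B2 ^ 2) * B4).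
  split; [repeat apply Rmin_pos; auto|]; split.
  { assert (0 < B1 ^ 2) by (apply pow_lt; auto); assert (0 < B2 ^ 2) by (apply pow_lt; auto); nra. }
  intros r Hr f df j Pf Cdf Hf.
  specialize (H1 r ltac:(eapply Rlt_le_trans; [apply Hr|];
    eapply Rle_trans; [apply Rmin_l | apply Rmin_l])).
  specialize (H2 r ltac:(eapply Rlt_le_trans; [apply Hr|];
    eapply Rle_trans; [apply Rmin_l | apply Rmin_r])).
  specialize (H3 r ltac:(eapply Rlt_le_trans; [apply Hr|];
    eapply Rle_trans; [apply Rmin_r | apply Rmin_l])).
  specialize (H4 r ltac:(eapply Rlt_le_trans; [apply Hr|];
    eapply Rle_trans; [apply Rmin_r | apply Rmin_r])).
  assert (Cf : cont f) by (apply (cont_derive f df); auto).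
  assert (Cgr := cont2_slice _ r Cg); assert (Cgxr := cont2_slice _ r Cgx).
  pose proof (Cphi1 r) as Cp.
  set (k := fun x => df x * g r x + f x * gx r x).
  assert (Ck : cont k) by (unfold k; cnt).
  assert (Pdf : periodic1 df) by (apply (periodic1_derive f); auto).
  assert (Pgx : periodic1 (gx r)) by (apply (periodic1_derive (g r)); auto).
  set (K := fun x => (f x * g r x) ^ 2 + (k x * exp (- phi r x)) ^ 2).
  eapply Rle_trans.
  - apply (energy1_C1 _ (fun y => k (qinv r y) * exp (- phi r (qinv r y)))).
    + apply (pull_periodic1 (fun x => f x * g r x)), periodic1_mult; auto.
    + apply (cont_pull (fun x => k x * exp (- phi r x))); cnt.
    + intros y; apply (pull_derive (fun x => f x * g r x)).
      intros x; apply is_derive_mult_R; auto.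
  - match goal with |- _ <= ?c => change (RInt (fun y => K (qinv r y)) 0 1 <= c) end.
    rewrite (RInt_pull K); [|unfold K; cnt|].
    2:{ intros x; unfold K, k; rewrite Pf, Pdf, Pg, Pgx, Pphi; reflexivity. }
    rewrite <- RInt_scal_cont by cnt.
    apply RInt_le_cont; [lra | unfold K; cnt | cnt |]; intros x Hx.
    specialize (H1 x Hx); specialize (H2 x Hx); specialize (H3 x Hx); specialize (H4 x Hx).
    pose proof (exp_pos (phi r x)) as E; pose proof (exp_pos (- phi r x)) as E'.
    rewrite (Rabs_pos_eq (exp (phi r x))) in H3 by lra.
    rewrite (Rabs_pos_eq (exp (- phi r x))) in H4 by lra.
    assert (EE : exp (- phi r x) * exp (phi r x) = 1)
      by (rewrite <- exp_plus, Rplus_opp_l; apply exp_0).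
    assert (G1 : g r x ^ 2 <= B1 ^ 2)
      by (rewrite <- pow2_abs; apply pow_incr; split; [apply Rabs_pos | auto]).
    assert (G2 : gx r x ^ 2 <= B2 ^ 2)
      by (rewrite <- pow2_abs; apply pow_incr; split; [apply Rabs_pos | auto]).
    replace (K x * exp (phi r x)) with
      (f x ^ 2 * g r x ^ 2 * exp (phi r x)
       + k x ^ 2 * (exp (- phi r x) * (exp (- phi r x) * exp (phi r x))))
      by (unfold K; ring).
    rewrite EE, Rmult_1_r.
    pose proof (pow2_ge_0 (f x)) as F0; pose proof (pow2_ge_0 (df x)) as F1.
    pose proof (pow2_ge_0 (g r x)) as F2; pose proof (pow2_ge_0 (gx r x)) as F3.
    assert (K1 : k x ^ 2 <= 2 * (B1 ^ 2 + B2 ^ 2) * (f x ^ 2 + df x ^ 2)).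
    { unfold k; pose proof (pow2_ge_0 (df x * g r x - f x * gx r x)).
      assert (df x ^ 2 * g r x ^ 2 <= df x ^ 2 * B1 ^ 2) by (apply Rmult_le_compat_l; auto).
      assert (f x ^ 2 * gx r x ^ 2 <= f x ^ 2 * B2 ^ 2) by (apply Rmult_le_compat_l; auto).
      assert (0 <= f x ^ 2 * B1 ^ 2) by (apply Rmult_le_pos; lra).
      assert (0 <= df x ^ 2 * B2 ^ 2) by (apply Rmult_le_pos; lra).
      nra. }
    assert (A1 : f x ^ 2 * g r x ^ 2 * exp (phi r x) <= f x ^ 2 * B1 ^ 2 * B3).
    { apply Rmult_le_compat; [apply Rmult_le_pos; auto | lra | | auto].
      apply Rmult_le_compat_l; auto. }
    assert (A2 : k x ^ 2 * exp (- phi r x)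
      <= 2 * (B1 ^ 2 + B2 ^ 2) * (f x ^ 2 + df x ^ 2) * B4).
    { apply Rmult_le_compat; auto; [apply pow2_ge_0 | lra]. }
    assert (0 <= df x ^ 2 * B1 ^ 2 * B3)
      by (apply Rmult_le_pos; [apply Rmult_le_pos; [auto | apply pow2_ge_0] | lra]).
    lra.
Qed.

Hypothesis Hnu : ex_series (energy1 nu).

(** Relative to [en nu n], the function costs 4 by [fa_fb_square_le] and the derivative $64 \cdot
    4\, n^2$ since [PI <= 4]; hence $260 = 4 + 256$. *)
Lemma fsum_energy (N j : nat) : exists df, cont df /\
  (forall x, is_derive (fsum nu N j) x (df x)) /\
  RInt (fun x => fsum nu N j x ^ 2 + df x ^ 2) 0 1 <= 260 * bsum (energy1 nu) N j.
Proof.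
  set (da := fun n => 2 * PI * INR n * fb nu n); set (db := fun n => - (2 * PI * INR n * fa nu n)).
  exists (tpoly da db N j).
  assert (C1 : cont (fsum nu N j)) by apply cont_tpoly.
  assert (C2 := cont_tpoly da db N j).
  split; [exact C2|]; split; [intros x; apply tpoly_derive|].
  rewrite RInt_plus_cont by cnt.
  eapply Rle_trans; [apply Rplus_le_compat; apply tpoly_square_le|].
  rewrite <- bsum_plus, <- bsum_scal; apply bsum_le; intros n _; unfold da, db.
  pose proof (fa_fb_square_le nu n) as Hab; pose proof (en_ge0 nu n) as Hen.
  pose proof PI_RGT_0 as Hpi; pose proof PI_4 as Hpi4.
  assert (Hw : (2 * PI * INR n) ^ 2 <= 64 * INR n ^ 2).
  { replace (64 * INR n ^ 2) with ((8 * INR n) ^ 2) by ring.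
    pose proof (pos_INR n); apply pow_incr; nra. }
  set (X := fa nu n ^ 2 + fb nu n ^ 2) in *.
  replace ((2 * PI * INR n * fb nu n) ^ 2 + (- (2 * PI * INR n * fa nu n)) ^ 2)
    with ((2 * PI * INR n) ^ 2 * X) by (unfold X; ring).
  assert (X0 : 0 <= X)
    by (unfold X; pose proof (pow2_ge_0 (fa nu n)); pose proof (pow2_ge_0 (fb nu n)); lra).
  unfold energy1, hw; pose proof (pow2_ge_0 (INR n)).
  assert ((2 * PI * INR n) ^ 2 * X <= 64 * INR n ^ 2 * (4 * en nu n))
    by (apply Rmult_le_compat; auto; apply pow2_ge_0).
  nra.
Qed.

(** The tail of [nu] is merely in $H^1$, so the bound for $C^1$ functions is applied to the finite
    blocks [fsum nu N M], which converge uniformly to the tail; the bound on finitely many energies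
    passes to the limit. *)
Lemma pull_remainder (t : R) : exists d C, 0 < d /\ 0 < C /\
  forall r, Rabs (r - t) < d -> forall N tau,
    (forall j, bsum (energy1 nu) N j <= tau) ->
    forall j, bsum (energy1 (fun y => (nu (qinv r y) - fsum nu 0 N (qinv r y)) * g r (qinv r y))) 0 j
      <= C * tau.
Proof.
  destruct (pull_mult_bound t) as [d [C [Hd [HC H]]]].
  exists d, (260 * C); split; [exact Hd|]; split; [lra|].
  intros r Hr N tau Htau j.
  assert (Cgr := cont2_slice _ r Cg).
  apply (bsum_energy1_limit (fun M y => fsum nu N M (qinv r y) * g r (qinv r y))).
  - intros M; apply (cont_pull (fun x => fsum nu N M x * g r x)).
    assert (C1 : cont (fsum nu N M)) by apply cont_tpoly; cnt.
  - apply (cont_pull (fun x => (nu x - fsum nu 0 N x) * g r x)).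
    assert (C1 : cont (fsum nu 0 N)) by apply cont_tpoly; cnt.
  - intros e He.
    destruct (cont_bounded (g r) 0 1 Rle_0_1 Cgr) as [B [HB HB']].
    destruct (fsum_uniform nu Cnu Pnu Hnu (e / B)) as [M0 HM]; [apply Rdiv_lt_0_compat; auto|].
    exists M0; intros M y HM0.
    specialize (HM (N + M)%nat (qinv r y) ltac:(lia)); rewrite fsum_split in HM.
    replace (fsum nu N M (qinv r y) * g r (qinv r y)
      - (nu (qinv r y) - fsum nu 0 N (qinv r y)) * g r (qinv r y))
      with ((fsum nu 0 N (qinv r y) + fsum nu N M (qinv r y) - nu (qinv r y)) * g r (qinv r y)) by ring.
    rewrite Rabs_mult; replace e with (e / B * B) by (field; lra).
    apply Rmult_le_compat; auto using Rabs_pos.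
    apply (periodic1_ind (g r) (fun z => Rabs z <= B)); auto.
  - intros M; destruct (fsum_energy N M) as [df [Cdf [Hdf E]]].
    eapply Rle_trans; [apply (H r Hr _ df); auto; apply tpoly_periodic1|].
    specialize (Htau M); nra.
Qed.

Definition pull (t y : R) : R := nu (qinv t y) * g t (qinv t y).

Lemma cont_pull_nu (t : R) : cont (pull t).
Proof.
  apply (cont_pull (fun x => nu x * g t x)); pose proof (cont2_slice _ t Cg); cnt.
Qed.

Lemma pull_energy1_bounded (t : R) : exists B, forall j, bsum (energy1 (pull t)) 0 j <= B.
Proof.
  destruct (pull_remainder t) as [d [C [Hd [_ H]]]].
  exists (C * Series (energy1 nu)); intros j.
  (* With [N = 0] the partial sum is empty and the remainder is the whole of [nu]. *)
  specialize (H t ltac:(rewrite Rminus_diag, Rabs_R0; exact Hd) 0%nat _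
    (bsum_bounded _ (energy1_ge0 nu) Hnu) j).
  eapply Rle_trans; [right; apply bsum_ext; intros n _; apply energy1_ext|exact H].
  intros y; unfold pull, fsum, tpoly; simpl; ring.
Qed.

(** The Fourier series of [nu] is split: the partial sum is smooth, and the energy of
    the tail stays small under composition with [qinv r], uniformly in [r]. *)
Lemma pull_continuous (t e : R) : 0 < e ->
  exists d, 0 < d /\ forall r, Rabs (r - t) < d ->
    forall j, bsum (energy1 (fun y => pull r y - pull t y)) 0 j <= e.
Proof.
  intros He.
  destruct (pull_remainder t) as [d1 [C [Hd1 [HC H1]]]].
  (* Each tail then has energy at most [e / 16]. By [energy1_plus] the difference of the tails has
     at most [4 * (e / 16) = e / 4], and together with the smooth part at most
     [2 * (e / 4) + 2 * (e / 4) = e]. *)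
  destruct (bsum_tail (energy1 nu) (e / (16 * C)) (energy1_ge0 nu) Hnu) as [N HN].
  { apply Rdiv_lt_0_compat; lra. }
  destruct (fsum_energy 0 N) as [dS [CdS [HdS _]]].
  assert (CS : cont (fsum nu 0 N)) by apply cont_tpoly.
  assert (PS : periodic1 (fsum nu 0 N)) by apply tpoly_periodic1.
  destruct (pull_C1_continuous (fun t x => fsum nu 0 N x * g t x)
    (fun t x => dS x * g t x + fsum nu 0 N x * gx t x) t (e / 4)) as [d2 [Hd2 H2]].
  - cnt2.
  - cnt2.
  - intros s; apply (periodic1_mult (fsum nu 0 N) (g s)); auto.
  - intros s x; apply (is_derive_mult_R (fsum nu 0 N) (g s)); auto.
  - lra.
  - exists (Rmin d1 d2); split; [apply Rmin_pos; auto|]; intros r Hr j.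
    specialize (H2 r (Rlt_le_trans _ _ _ Hr (Rmin_r _ _)) j).
    assert (Ht : Rabs (t - t) < d1) by (rewrite Rminus_diag, Rabs_R0; exact Hd1).
    assert (R1 := H1 r (Rlt_le_trans _ _ _ Hr (Rmin_l _ _)) N _
      (fun j => HN N j (Nat.le_refl N)) j).
    assert (R2 := H1 t Ht N _ (fun j => HN N j (Nat.le_refl N)) j).
    assert (CR : forall s, cont (fun y => (nu (qinv s y) - fsum nu 0 N (qinv s y)) * g s (qinv s y))).
    { intros s; apply (cont_pull (fun x => (nu x - fsum nu 0 N x) * g s x)).
      pose proof (cont2_slice _ s Cg); cnt. }
    assert (CP : forall s, cont (fun y => fsum nu 0 N (qinv s y) * g s (qinv s y))).
    { intros s; apply (cont_pull (fun x => fsum nu 0 N x * g s x)).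
      pose proof (cont2_slice _ s Cg); cnt. }
    pose proof (CR r) as CRr; pose proof (CR t) as CRt.
    pose proof (CP r) as CPr; pose proof (CP t) as CPt.
    set (Rr := fun y => (nu (qinv r y) - fsum nu 0 N (qinv r y)) * g r (qinv r y)) in *.
    set (Rt := fun y => (nu (qinv t y) - fsum nu 0 N (qinv t y)) * g t (qinv t y)) in *.
    set (P := fun y => fsum nu 0 N (qinv r y) * g r (qinv r y)
      - fsum nu 0 N (qinv t y) * g t (qinv t y)) in *.
    assert (CPP : cont P) by (apply cont_minus; assumption).
    assert (R2' : bsum (energy1 (fun y => -1 * Rt y)) 0 j <= C * (e / (16 * C))).
    { eapply Rle_trans; [right; apply bsum_ext; intros n _|exact R2].
      rewrite energy1_scal by auto; ring. }
    assert (RR := energy1_plus Rr (fun y => -1 * Rt y) j _ _ CRr ltac:(cnt) R1 R2').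
    assert (T := energy1_plus P (fun y => Rr y + -1 * Rt y) j _ _ CPP ltac:(cnt) H2 RR).
    eapply Rle_trans; [right; apply bsum_ext; intros n _; apply energy1_ext
      |eapply Rle_trans; [exact T|]].
    + intros y; unfold pull, P, Rr, Rt; ring.
    + replace (C * (e / (16 * C))) with (e / 16) by (field; lra); lra.
Qed.

End Density.

(** * The velocity field and its acceleration *)

Hypothesis Hnu : ex_series (energy1 nu).

(** Since [phi] vanishes at time 0 and has time derivative [V], its space derivative is the time
    integral of $V_x$. *)
Definition phix (t x : R) : R :=
  RInt (fun s => lam * exp (phi s x) - nu x * exp (- phi s x)) 0 t.

Lemma cont2_phix : cont2 phix.
Proof.
  apply (cont2_RInt_l (fun s x => lam * exp (phi s x) - nu x * exp (- phi s x))); cnt2.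
Qed.

Lemma phi_x (t x : R) : is_derive (phi t) x (phix t x).
Proof.
  apply (is_derive_ext (fun x => RInt (fun s => V s x) 0 t)).
  - intros y; rewrite (RInt_FTC (fun s => phi s y)).
    + rewrite phi_0; rng.
    + intros s; apply phi_t.
    + apply (cont2_slice_l V y CV).
  - apply (is_derive_RInt_param_cont (fun x s => V s x)
      (fun x s => lam * exp (phi s x) - nu x * exp (- phi s x))).
    + intros y s; apply V_x.
    + intros y; apply (cont2_slice_l V y CV).
    + apply (cont2_swap (fun s x => lam * exp (phi s x) - nu x * exp (- phi s x))); cnt2.
Qed.

Definition e2 (t x : R) : R := exp (-2 * phi t x).

Lemma cont2_e2 : cont2 e2.
Proof. unfold e2; cnt2. Qed.

Lemma e2_derive (t x : R) : is_derive (e2 t) x (-2 * phix t x * e2 t x).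
Proof. apply is_derive_exp_R, is_derive_scal_R, phi_x. Qed.

Lemma e2_periodic1 (t : R) : periodic1 (e2 t).
Proof. intros x; unfold e2; rewrite Pphi; reflexivity. Qed.

Lemma e2_exp (t x : R) : e2 t x * exp (phi t x) = exp (- phi t x).
Proof. unfold e2; rewrite <- exp_plus; f_equal; ring. Qed.

Definition vel (t y : R) : R := U t (qinv t y).
Definition velx (t y : R) : R := V t (qinv t y).
(** This is $m + \kappa$ rather than $m$: the relation $(m + \kappa)(q) = \nu\, e^{-2\phi}$ read at
    [qinv]. *)
Definition mom : R -> R -> R := pull e2.

Lemma exp_cancel (t x : R) : exp (phi t x) * exp (- phi t x) = 1.
Proof. rewrite <- exp_plus, Rplus_opp_r; apply exp_0. Qed.

Lemma vel_derive (t y : R) : is_derive (vel t) y (velx t y).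
Proof.
  eapply is_derive_eq; [apply (pull_derive (U t)); intros; apply U_derive|].
  cbv beta; rewrite Rmult_assoc, exp_cancel; apply Rmult_1_r.
Qed.

Lemma velx_derive (t y : R) : is_derive (velx t) y (lam - mom t y).
Proof.
  eapply is_derive_eq; [apply (pull_derive (V t)); intros; apply V_x|].
  cbv beta; unfold mom, pull, e2; rewrite Rmult_minus_distr_r, Rmult_assoc, exp_cancel.
  replace (-2 * phi t (qinv t y)) with (- phi t (qinv t y) + - phi t (qinv t y)) by ring.
  rewrite exp_plus; ring.
Qed.

Lemma cont_velx (t : R) : cont (velx t).
Proof. apply (cont_derive _ _ (velx_derive t)). Qed.

Lemma cont_vel (t : R) : cont (vel t).
Proof. apply (cont_derive _ _ (vel_derive t)). Qed.

Lemma cont_mom (t : R) : cont (mom t).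
Proof. apply cont_pull_nu, cont2_e2. Qed.

Lemma vel_periodic1 (t : R) : periodic1 (vel t).
Proof. apply (pull_periodic1 (U t)), U_periodic1. Qed.

Lemma velx_periodic1 (t : R) : periodic1 (velx t).
Proof. apply (pull_periodic1 (V t)), PV. Qed.

Lemma mom_periodic1 (t : R) : periodic1 (mom t).
Proof.
  apply (pull_periodic1 (fun x => nu x * e2 t x)), periodic1_mult; auto using e2_periodic1.
Qed.

Lemma vel_mean (t : R) : RInt (vel t) 0 1 = mu0.
Proof.
  unfold vel; rewrite (RInt_pull (U t)); [apply U_mean | | apply U_periodic1].
  apply cont2_slice, cont2_U.
Qed.

(** The momentum density is transported: its integral against a test function is
    an integral in Lagrangian coordinates against a density known explicitly. *)
Lemma RInt_mom (t : R) (th : R -> R) : cont th -> periodic1 th ->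
  RInt (fun y => mom t y * th y) 0 1 =
  RInt (fun x => nu x * (exp (- phi t x) * th (q t x))) 0 1.
Proof.
  intros Cth Pth; pose proof (cont_mom t).
  rewrite <- (RInt_comp_q t (fun y => mom t y * th y));
    [|cnt | apply periodic1_mult; auto using mom_periodic1].
  apply RInt_ext_R; intros x; unfold mom, pull; rewrite qinv_q, <- e2_exp; ring.
Qed.

(** Weak form of $n_t + (u n)_x + u_x n = 0$ for [n = mom]. In Lagrangian coordinates the time
    dependence sits in [exp (- phi)] and in [th] along [q], so no derivative of [mom] is taken. *)
Lemma RInt_mom_derive (t : R) (th dth : R -> R) : (forall x, is_derive th x (dth x)) ->
  cont dth -> periodic1 th ->
  is_derive (fun s => RInt (fun y => mom s y * th y) 0 1) t
    (RInt (fun y => mom t y * (vel t y * dth y - velx t y * th y)) 0 1).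
Proof.
  intros Dth Cdth Pth.
  assert (Cth : cont th) by (apply (cont_derive th dth); auto).
  assert (Pdth : periodic1 dth) by (apply (periodic1_derive th); auto).
  apply (is_derive_ext (fun s => RInt (fun x => nu x * (exp (- phi s x) * th (q s x))) 0 1)).
  { intros s; symmetry; apply RInt_mom; auto. }
  pose proof (cont_vel t); pose proof (cont_velx t).
  assert (Cq := cont2_q); assert (CU := cont2_U).
  rewrite (RInt_mom t (fun y => vel t y * dth y - velx t y * th y));
    [|cnt | intros x; rewrite vel_periodic1, velx_periodic1, Pth, Pdth; reflexivity].
  eapply is_derive_eq.
  - apply (is_derive_RInt_param_cont (fun s x => nu x * (exp (- phi s x) * th (q s x)))
      (fun s x => nu x * (- V s x * exp (- phi s x) * th (q s x)
        + exp (- phi s x) * (dth (q s x) * U s x)))).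
    + intros s x; apply is_derive_scal_R.
      apply (is_derive_mult_R (fun s => exp (- phi s x)) (fun s => th (q s x))).
      * apply (is_derive_exp_R (fun s => - phi s x)), (is_derive_opp (fun s => phi s x)), phi_t.
      * apply (is_derive_comp_R th (fun s => q s x)); [apply Dth | apply q_t].
    + intros s; pose proof (Cphi1 s); pose proof (cont2_slice _ s Cq); cnt.
    + cnt2.
  - apply RInt_ext_R; intros x; unfold vel, velx; rewrite qinv_q; ring.
Qed.

(** The primitive of mean zero, which inverts the derivative on periodic functions of mean zero. *)
Definition zprim (g : R -> R) (x : R) : R :=
  RInt g 0 x - RInt (fun y => RInt g 0 y) 0 1.

Lemma zprim_derive (g : R -> R) (x : R) : cont g -> is_derive (zprim g) x (g x).
Proof.
  intros Cg; eapply is_derive_eq.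
  - apply is_derive_minus_R; [apply is_derive_prim, Cg | apply is_derive_const_R].
  - ring.
Qed.

Lemma zprim_periodic1 (g : R -> R) : cont g -> periodic1 g -> RInt g 0 1 = 0 ->
  periodic1 (zprim g).
Proof. intros Cg Pg Hg x; unfold zprim; f_equal; apply (periodic1_prim g); auto. Qed.

Lemma zprim_mean (g : R -> R) : cont g -> RInt (zprim g) 0 1 = 0.
Proof.
  intros Cg; unfold zprim.
  rewrite (RInt_minus_cont (fun x => RInt g 0 x));
    [rewrite RInt_const_R; rng | apply (cont_prim g 0), Cg | apply cont_const].
Qed.

(** Right-hand side of the pressure equation: $2\mu(u)u$ and $2\kappa u$ combine into the term with
    [lam]. Taking means shows that the pressure has the mean of [force], and its second derivative
    is then that mean minus [force]; two primitives of mean zero solve this. [acc] is the value of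
    $u_t$ prescribed by the equation. *)
Definition force (t y : R) : R := 2 * lam * vel t y + / 2 * velx t y ^ 2.
Definition press_x (t : R) : R -> R := zprim (fun y => RInt (force t) 0 1 - force t y).
Definition press (t y : R) : R := RInt (force t) 0 1 + zprim (press_x t) y.
Definition acc (t y : R) : R := - (vel t y * velx t y) - press_x t y.

Lemma cont_force (t : R) : cont (force t).
Proof. unfold force; pose proof (cont_vel t); pose proof (cont_velx t); cnt. Qed.

Lemma force_periodic1 (t : R) : periodic1 (force t).
Proof. intros x; unfold force; rewrite vel_periodic1, velx_periodic1; reflexivity. Qed.

Lemma press_x_derive (t y : R) : is_derive (press_x t) y (RInt (force t) 0 1 - force t y).
Proof.
  apply (zprim_derive (fun y => RInt (force t) 0 1 - force t y)).
  pose proof (cont_force t); cnt.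
Qed.

Lemma cont_press_x (t : R) : cont (press_x t).
Proof. apply (cont_derive _ _ (press_x_derive t)). Qed.

Lemma press_x_periodic1 (t : R) : periodic1 (press_x t).
Proof.
  pose proof (cont_force t); apply zprim_periodic1; [cnt | |].
  - intros y; rewrite force_periodic1; reflexivity.
  - rewrite RInt_minus_cont, RInt_const_R by cnt; rng.
Qed.

Lemma press_x_mean (t : R) : RInt (press_x t) 0 1 = 0.
Proof. apply zprim_mean; pose proof (cont_force t); cnt. Qed.

Lemma press_derive (t y : R) : is_derive (press t) y (press_x t y).
Proof.
  eapply is_derive_eq.
  - apply is_derive_plus_R; [apply is_derive_const_R | apply zprim_derive, cont_press_x].
  - ring.
Qed.

Lemma press_periodic1 (t : R) : periodic1 (press t).
Proof.
  intros y; unfold press; f_equal; apply zprim_periodic1;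
    [apply cont_press_x | apply press_x_periodic1 | apply press_x_mean].
Qed.

Lemma press_mean (t : R) : RInt (press t) 0 1 = RInt (force t) 0 1.
Proof.
  assert (C : cont (zprim (press_x t)))
    by (apply (cont_derive _ (press_x t)); intros y; apply zprim_derive, cont_press_x).
  unfold press; rewrite RInt_plus_cont, RInt_const_R, zprim_mean by (auto using cont_press_x; cnt).
  rng.
Qed.

(** Makes $u_x (m + \kappa)$ an exact derivative in [x], so that the momentum equation becomes a
    conservation law whose flux is [vel * mom] plus this term. *)
Definition smooth_part (t y : R) : R := lam * vel t y - / 2 * velx t y ^ 2.

Lemma smooth_part_derive (t y : R) : is_derive (smooth_part t) y (velx t y * mom t y).
Proof.
  eapply is_derive_eq.
  - apply is_derive_minus_R; apply is_derive_scal_R; [apply vel_derive|].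
    apply (is_derive_ext (fun y => velx t y * velx t y)); [intros; simpl; ring|].
    apply is_derive_mult_R; apply velx_derive.
  - field.
Qed.

Lemma cont_smooth_part (t : R) : cont (smooth_part t).
Proof. apply (cont_derive _ _ (smooth_part_derive t)). Qed.

Lemma acc_derive (t y : R) : is_derive (acc t) y
  ((vel t y * mom t y + smooth_part t y) + - RInt (force t) 0 1).
Proof.
  eapply is_derive_eq.
  - apply is_derive_minus_R; [|apply press_x_derive].
    apply (is_derive_opp (fun y => vel t y * velx t y)), is_derive_mult_R;
      [apply vel_derive | apply velx_derive].
  - unfold opp, force, smooth_part; simpl; set (I := RInt _ 0 1); field.
Qed.

Lemma cont_acc (t : R) : cont (acc t).
Proof. apply (cont_derive _ _ (acc_derive t)). Qed.

Lemma acc_periodic1 (t : R) : periodic1 (acc t).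
Proof.
  intros y; unfold acc; rewrite vel_periodic1, velx_periodic1, press_x_periodic1; reflexivity.
Qed.

Lemma acc_mean (t : R) : RInt (acc t) 0 1 = 0.
Proof.
  pose proof (cont_vel t); pose proof (cont_velx t); pose proof (cont_press_x t).
  unfold acc; rewrite RInt_minus_cont, RInt_opp_cont, press_x_mean by cnt.
  pose proof (RInt_by_parts_periodic1 (vel t) (velx t) (vel t) (velx t) (vel_derive t)
    (vel_derive t) ltac:(cnt) ltac:(cnt) (vel_periodic1 t) (vel_periodic1 t)) as E.
  rewrite (RInt_ext_R (fun x => velx t x * vel t x) (fun x => vel t x * velx t x)) in E
    by (intros; ring).
  lra.
Qed.

(** The test function is an eigenfunction of the second derivative, so two integrations by parts
    turn the pairing with [vel] into $w^{-2}$ times the pairing with [mom]; the constant [lam] drops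
    out because [th] has mean zero. The weak momentum equation then applies, and integration by
    parts leads back to [acc]. *)
Lemma vel_test_derive (t w : R) (th dth : R -> R) : w <> 0 ->
  (forall x, is_derive th x (dth x)) -> (forall x, is_derive dth x (- w ^ 2 * th x)) ->
  periodic1 th ->
  is_derive (fun s => RInt (fun y => vel s y * th y) 0 1) t (RInt (fun y => acc t y * th y) 0 1).
Proof.
  intros Hw Dth Ddth Pth.
  assert (Cth : cont th) by (apply (cont_derive th dth); auto).
  assert (Cdth : cont dth) by (apply (cont_derive dth (fun x => - w ^ 2 * th x)); auto).
  assert (Pdth : periodic1 dth) by (apply (periodic1_derive th); auto).
  assert (Hw2 : w ^ 2 <> 0) by (apply pow_nonzero; auto).
  assert (Z1 : RInt dth 0 1 = 0) by (apply (RInt_derive_periodic1 th); auto).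
  assert (Z0 : RInt th 0 1 = 0).
  { pose proof (RInt_derive_periodic1 dth _ Ddth ltac:(cnt) Pdth) as E.
    rewrite RInt_scal_cont in E by auto.
    apply (Rmult_eq_reg_l (- w ^ 2)); lra. }
  assert (IBP : forall f df, (forall x, is_derive f x (df x)) -> cont df -> periodic1 f ->
    RInt (fun y => df y * dth y) 0 1 = w ^ 2 * RInt (fun y => f y * th y) 0 1).
  { intros f df Df Cdf Pf.
    assert (Cf : cont f) by (apply (cont_derive f df); auto).
    rewrite (RInt_by_parts_periodic1 f df dth (fun x => - w ^ 2 * th x)) by (auto; cnt).
    rewrite (RInt_ext_R _ (fun y => - w ^ 2 * (f y * th y))) by (intros; ring).
    rewrite RInt_scal_cont by cnt; rng. }
  assert (EV : forall s, RInt (fun y => vel s y * th y) 0 1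
    = / w ^ 2 * RInt (fun y => mom s y * th y) 0 1).
  { intros s.
    pose proof (cont_velx s); pose proof (cont_mom s).
    pose proof (IBP (vel s) (velx s) (vel_derive s) ltac:(auto) (vel_periodic1 s)) as E1.
    pose proof (RInt_by_parts_periodic1 (velx s) _ th dth (velx_derive s) Dth ltac:(cnt)
      ltac:(cnt) (velx_periodic1 s) Pth) as E2.
    rewrite (RInt_ext_R _ (fun x => lam * th x - mom s x * th x)) in E2 by (intros; ring).
    rewrite RInt_minus_cont, RInt_scal_cont, Z0 in E2 by cnt.
    apply (Rmult_eq_reg_l (w ^ 2)); [|exact Hw2].
    rewrite <- Rmult_assoc, Rinv_r by exact Hw2; lra. }
  apply (is_derive_ext (fun s => / w ^ 2 * RInt (fun y => mom s y * th y) 0 1)).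
  { intros s; symmetry; apply EV. }
  eapply is_derive_eq; [apply is_derive_scal_R, (RInt_mom_derive t th dth); auto|].
  pose proof (cont_vel t); pose proof (cont_velx t); pose proof (cont_mom t).
  pose proof (cont_smooth_part t).
  apply (Rmult_eq_reg_l (w ^ 2)); [|exact Hw2].
  rewrite <- Rmult_assoc, Rinv_r, Rmult_1_l by exact Hw2.
  rewrite <- (IBP (acc t) _ (acc_derive t)); [|cnt | apply acc_periodic1].
  rewrite (RInt_ext_R (fun y => (vel t y * mom t y + smooth_part t y + - RInt (force t) 0 1) * dth y)
    (fun y => vel t y * mom t y * dth y + smooth_part t y * dth y - RInt (force t) 0 1 * dth y))
    by (intros; ring).
  rewrite RInt_minus_cont, RInt_plus_cont, (RInt_scal_cont (RInt (force t) 0 1)), Z1 by cnt.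
  (* Paired with [dth], the smooth part yields exactly the term in [velx t y * mom t y * th y] of
     the weak equation. *)
  pose proof (RInt_by_parts_periodic1 (smooth_part t) _ th dth (smooth_part_derive t) Dth
    ltac:(cnt) ltac:(cnt)) as E.
  rewrite (RInt_ext_R (fun y => mom t y * (vel t y * dth y - velx t y * th y))
    (fun y => vel t y * mom t y * dth y - velx t y * mom t y * th y)) by (intros; ring).
  rewrite RInt_minus_cont by cnt.
  rewrite E; [lra | | exact Pth].
  intros y; unfold smooth_part; rewrite vel_periodic1, velx_periodic1; reflexivity.
Qed.

(** Frequency 0 is the conserved mean, matched by the zero mean of [acc]; at the other frequencies
    [cs] is an eigenfunction. *)
Lemma vel_cA_derive (n : nat) (t : R) : is_derive (fun s => cA (vel s) n) t (cA (acc t) n).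
Proof.
  destruct n as [|n].
  - rewrite cA_0, acc_mean.
    apply (is_derive_ext (fun _ => mu0)); [|apply is_derive_const_R].
    intros s; rewrite cA_0, vel_mean; reflexivity.
  - apply (vel_test_derive t (2 * PI * INR (S n)) (cs (S n))
      (fun x => - (2 * PI * INR (S n) * sn (S n) x))).
    + pose proof PI_RGT_0; assert (0 < INR (S n)) by (apply lt_0_INR; lia); nra.
    + apply cs_derive.
    + intros x; eapply is_derive_eq.
      * apply (is_derive_opp (fun x => 2 * PI * INR (S n) * sn (S n) x)), is_derive_scal_R, sn_derive.
      * unfold opp; cbn -[INR]; ring.
    + apply cs_periodic1.
Qed.

Lemma vel_cB_derive (n : nat) (t : R) : is_derive (fun s => cB (vel s) n) t (cB (acc t) n).
Proof.
  destruct n as [|n].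
  - rewrite cB_0.
    apply (is_derive_ext (fun _ => 0)); [|apply is_derive_const_R].
    intros s; rewrite cB_0; reflexivity.
  - apply (vel_test_derive t (2 * PI * INR (S n)) (sn (S n))
      (fun x => 2 * PI * INR (S n) * cs (S n) x)).
    + pose proof PI_RGT_0; assert (0 < INR (S n)) by (apply lt_0_INR; lia); nra.
    + apply sn_derive.
    + intros x; eapply is_derive_eq.
      * apply is_derive_scal_R, cs_derive.
      * ring.
    + apply sn_periodic1.
Qed.

(** Second derivatives agree at time 0 because [q 0] is the identity; periodicity then kills the
    constant in the first derivative, and the common mean [mu0] the constant in the function. *)
Lemma vel_0 (u du : R -> R) : periodic1 u -> (forall x, is_derive u x (du x)) ->
  (forall x, is_derive du x (lam - nu x)) -> RInt u 0 1 = mu0 -> forall x, vel 0 x = u x.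
Proof.
  intros Pu Du Ddu Mu x.
  assert (Cdu : cont du) by (apply (cont_derive du (fun x => lam - nu x)); auto).
  assert (Cu : cont u) by (apply (cont_derive u du); auto).
  pose proof (cont_vel 0); pose proof (cont_velx 0).
  assert (K1 : forall x y, velx 0 x - du x = velx 0 y - du y).
  { apply (is_derive_zero_const (fun x => velx 0 x - du x)); intros y.
    eapply is_derive_eq; [apply is_derive_minus_R; [apply velx_derive | apply Ddu]|].
    unfold mom, pull, e2; rewrite qinv_0, phi_0, Rmult_0_r, exp_0; ring. }
  assert (D : forall y, is_derive (fun y => vel 0 y - u y) y (velx 0 y - du y))
    by (intros y; apply is_derive_minus_R; [apply vel_derive | apply Du]).
  assert (K0 : forall y, velx 0 y - du y = 0).
  { assert (E : RInt (fun y => velx 0 y - du y) 0 1 = 0).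
    { apply (RInt_derive_periodic1 (fun y => vel 0 y - u y)); [exact D | cnt |].
      intros y; rewrite vel_periodic1, Pu; reflexivity. }
    intros y; rewrite (RInt_ext_R _ (fun _ => velx 0 y - du y)), RInt_const_R in E
      by (intros; apply K1); lra. }
  assert (K : forall y z, vel 0 y - u y = vel 0 z - u z).
  { apply (is_derive_zero_const (fun x => vel 0 x - u x)); intros y.
    eapply is_derive_eq; [apply D | apply K0]. }
  assert (E : RInt (fun y => vel 0 y - u y) 0 1 = 0)
    by (rewrite RInt_minus_cont, vel_mean, Mu by auto; rng).
  rewrite (RInt_ext_R _ (fun _ => vel 0 x - u x)), RInt_const_R in E by (intros; apply K); lra.
Qed.

Lemma mom_continuous (t e : R) : 0 < e ->
  exists d, 0 < d /\ forall r, Rabs (r - t) < d ->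
    forall j, bsum (energy1 (fun y => mom r y - mom t y)) 0 j <= e.
Proof.
  pose proof cont2_e2; pose proof cont2_phix.
  apply (pull_continuous e2 (fun t x => -2 * phix t x * e2 t x)); auto using e2_periodic1, e2_derive.
  cnt2.
Qed.

Lemma mom_bounded (t : R) : exists B, forall j, bsum (energy1 (mom t)) 0 j <= B.
Proof.
  pose proof cont2_e2; pose proof cont2_phix.
  apply (pull_energy1_bounded e2 (fun t x => -2 * phix t x * e2 t x));
    auto using e2_periodic1, e2_derive.
  cnt2.
Qed.

Definition flux (t y : R) : R := vel t y * mom t y + smooth_part t y.

(** Chosen so that [pull g] is [vel * mom], which brings this product under the estimates for
    [pull]. *)
Let g (t x : R) : R := U t x * e2 t x.
Let gx (t x : R) : R := V t x * exp (phi t x) * e2 t x + U t x * (-2 * phix t x * e2 t x).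

Lemma cont2_g : cont2 g.
Proof. pose proof cont2_U; pose proof cont2_e2; unfold g; cnt2. Qed.

Lemma cont2_gx : cont2 gx.
Proof. pose proof cont2_U; pose proof cont2_e2; pose proof cont2_phix; unfold gx; cnt2. Qed.

Lemma g_periodic1 (t : R) : periodic1 (g t).
Proof. apply (periodic1_mult (U t) (e2 t)); [apply U_periodic1 | apply e2_periodic1]. Qed.

Lemma g_derive (t x : R) : is_derive (g t) x (gx t x).
Proof. apply is_derive_mult_R; [apply U_derive | apply e2_derive]. Qed.

Lemma pull_g (t y : R) : pull g t y = vel t y * mom t y.
Proof. unfold mom, pull, g, vel; ring. Qed.

Lemma cont_flux_pull (t : R) : cont (pull g t).
Proof. apply cont_pull_nu, cont2_g. Qed.

Lemma smooth_part_periodic1 (t : R) : periodic1 (smooth_part t).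
Proof. intros y; unfold smooth_part; rewrite vel_periodic1, velx_periodic1; reflexivity. Qed.

(** The product containing [nu] is covered by [pull_continuous], the smooth part by its $C^1$ form
    in Lagrangian coordinates. *)
Lemma flux_continuous (t e : R) : 0 < e ->
  exists d, 0 < d /\ forall r, Rabs (r - t) < d ->
    forall j, bsum (energy1 (fun y => flux r y - flux t y)) 0 j <= e.
Proof.
  intros He.
  destruct (pull_continuous g gx cont2_g cont2_gx g_periodic1 g_derive Hnu t (e / 4) ltac:(lra))
    as [d1 [Hd1 H1]].
  destruct (pull_C1_continuous (fun t x => lam * U t x - / 2 * V t x ^ 2)
    (fun t x => lam * (V t x * exp (phi t x))
      - / 2 * (2 * V t x * (lam * exp (phi t x) - nu x * exp (- phi t x)))) t (e / 4))
    as [d2 [Hd2 H2]].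
  - pose proof cont2_U; cnt2.
  - cnt2.
  - intros s x; rewrite U_periodic1, PV; reflexivity.
  - intros s x; apply is_derive_minus_R; apply is_derive_scal_R; [apply U_derive|].
    apply (is_derive_ext (fun y => V s y * V s y)); [intros; simpl; ring|].
    eapply is_derive_eq; [apply is_derive_mult_R; apply V_x | ring].
  - lra.
  - exists (Rmin d1 d2); split; [apply Rmin_pos; auto|]; intros r Hr j.
    specialize (H1 r (Rlt_le_trans _ _ _ Hr (Rmin_l _ _)) j).
    specialize (H2 r (Rlt_le_trans _ _ _ Hr (Rmin_r _ _)) j).
    pose proof (cont_flux_pull r); pose proof (cont_flux_pull t).
    pose proof (cont_smooth_part r); pose proof (cont_smooth_part t).
    assert (T := energy1_plus (fun y => pull g r y - pull g t y)
      (fun y => smooth_part r y - smooth_part t y) j _ _ ltac:(cnt) ltac:(cnt) H1 H2).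
    eapply Rle_trans; [right; apply bsum_ext; intros n _; apply energy1_ext
      |eapply Rle_trans; [exact T | lra]].
    intros y; unfold flux; rewrite !pull_g; ring.
Qed.

Lemma flux_bounded (t : R) : exists B, forall j, bsum (energy1 (flux t)) 0 j <= B.
Proof.
  destruct (pull_energy1_bounded g gx cont2_g cont2_gx g_periodic1 g_derive Hnu t) as [B HB1].
  pose proof (cont_flux_pull t); pose proof (cont_smooth_part t).
  pose proof (cont_velx t); pose proof (cont_mom t).
  exists (2 * B + 2 * RInt (fun y => smooth_part t y ^ 2 + (velx t y * mom t y) ^ 2) 0 1).
  intros j.
  assert (HB2 := energy1_C1 (smooth_part t) (fun y => velx t y * mom t y) j
    (smooth_part_periodic1 t) ltac:(cnt) (smooth_part_derive t)).
  assert (T := energy1_plus (pull g t) (smooth_part t) j _ _ ltac:(auto) ltac:(auto) (HB1 j) HB2).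
  eapply Rle_trans; [right; apply bsum_ext; intros n _; apply energy1_ext | exact T].
  intros y; unfold flux; rewrite pull_g; ring.
Qed.

(** * The velocity field is a strong solution *)

(** The mean is conserved, so the difference has no frequency 0 and is controlled by its second
    derivative, a difference of [mom]. *)
Lemma vel_energy_close (s t r B : R) (j : nat) : s <= 3 ->
  (forall j, bsum (energy1 (fun y => mom t y - mom r y)) 0 j <= B) ->
  bsum (energy s (fun y => vel r y - vel t y)) 0 j <= B.
Proof.
  intros Hs HB.
  pose proof (cont_mom r); pose proof (cont_mom t).
  assert (E := energy_le_3 s (fun y => vel r y - vel t y) (fun y => velx r y - velx t y)
    (fun y => mom t y - mom r y) 0 j Hs).
  rewrite RInt_minus_cont, !vel_mean, Rminus_diag in E by apply cont_vel.
  rewrite pow_i, Rplus_0_l in E by lia.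
  eapply Rle_trans; [apply E | apply HB]; [| cnt | |].
  - intros y; rewrite !vel_periodic1; reflexivity.
  - intros y; apply is_derive_minus_R; apply vel_derive.
  - intros y; eapply is_derive_eq; [apply is_derive_minus_R; apply velx_derive | ring].
Qed.

(** The mean of [force] may change with time, but it enters the derivative of [acc] only as a
    constant. *)
Lemma acc_energy_close (s t r B : R) (j : nat) : s <= 2 ->
  (forall j, bsum (energy1 (fun y => flux r y - flux t y)) 0 j <= B) ->
  bsum (energy s (fun y => acc r y - acc t y)) 0 j <= B.
Proof.
  intros Hs HB.
  assert (Cf : forall t, cont (flux t)).
  { intros z; unfold flux; pose proof (cont_vel z); pose proof (cont_mom z).
    pose proof (cont_smooth_part z); cnt. }
  pose proof (Cf r); pose proof (Cf t).
  assert (E := energy_le_2 s (fun y => acc r y - acc t y) (fun y => flux r y - flux t y)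
    (RInt (force t) 0 1 - RInt (force r) 0 1) j Hs).
  rewrite RInt_minus_cont, !acc_mean, Rminus_diag in E by apply cont_acc.
  rewrite pow_i, Rplus_0_l in E by lia.
  eapply Rle_trans; [apply E | apply HB]; [| cnt |].
  - intros y; rewrite !acc_periodic1; reflexivity.
  - intros y; eapply is_derive_eq; [apply is_derive_minus_R; apply acc_derive|].
    unfold flux; rng.
Qed.

Lemma vel_C0_H (s : R) (T : Rbar) : s <= 3 -> C0_H s T vel.
Proof.
  intros Hs t _; split.
  - split; [apply vel_periodic1|]; split; [apply cont_vel|].
    destruct (mom_bounded t) as [B HB].
    eapply (sobolev_bound s (vel t)); [apply cont_vel|].
    intros j; eapply Rle_trans.
    + apply (energy_le_3 s (vel t) (velx t) (fun y => -1 * mom t y) lam j Hs).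
      * apply vel_periodic1.
      * pose proof (cont_mom t); cnt.
      * apply vel_derive.
      * intros y; eapply is_derive_eq; [apply velx_derive | ring].
    + apply Rplus_le_compat_l; eapply Rle_trans; [|apply (HB j)].
      right; apply bsum_ext; intros n _; rewrite energy1_scal by apply cont_mom; ring.
  - apply H_norm_filterlim.
    + intros r; pose proof (cont_vel r); pose proof (cont_vel t); cnt.
    + intros e He; destruct (mom_continuous t e He) as [d [Hd H]].
      exists d; split; [exact Hd|]; intros r Hr _ j; apply vel_energy_close; auto.
      intros k; eapply Rle_trans; [|apply (H r Hr k)].
      pose proof (cont_mom r); pose proof (cont_mom t).
      right; apply bsum_ext; intros n _.
      rewrite (energy1_ext _ (fun y => -1 * (mom r y - mom t y))) by (intros; ring).
      rewrite energy1_scal by cnt; ring.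
Qed.

Lemma acc_C0_H (s : R) (T : Rbar) : s <= 2 -> C0_H s T acc.
Proof.
  intros Hs t _; split.
  - split; [apply acc_periodic1|]; split; [apply cont_acc|].
    destruct (flux_bounded t) as [B HB].
    eapply (sobolev_bound s (acc t)); [apply cont_acc|].
    intros j; eapply Rle_trans.
    + apply (energy_le_2 s (acc t) (flux t) (- RInt (force t) 0 1) j Hs).
      * apply acc_periodic1.
      * unfold flux; pose proof (cont_vel t); pose proof (cont_mom t).
        pose proof (cont_smooth_part t); cnt.
      * apply acc_derive.
    + apply Rplus_le_compat_l, HB.
  - apply H_norm_filterlim.
    + intros r; pose proof (cont_acc r); pose proof (cont_acc t); cnt.
    + intros e He; destruct (flux_continuous t e He) as [d [Hd H]].
      exists d; split; [exact Hd|]; intros r Hr _ j; apply acc_energy_close; auto.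
Qed.

(** The error of the difference quotient is dominated by [acc z - acc t] at an intermediate time,
    and [acc] is continuous in time. The fields are defined for all real times, so the limit is
    taken over a full punctured neighbourhood, which includes the one-sided limit at 0. *)
Lemma vel_time_derive_H (s : R) (T : Rbar) : s <= 2 -> is_time_derive_H s T vel acc.
Proof.
  intros Hs t _.
  apply (filterlim_filter_le_1 (F := locally' t)).
  { intros P HP; apply filter_le_within; exact HP. }
  apply H_norm_filterlim.
  - intros r; pose proof (cont_vel r); pose proof (cont_vel t); pose proof (cont_acc t); cnt.
  - intros e He; destruct (flux_continuous t e He) as [d [Hd H]].
    exists d; split; [exact Hd|]; intros r Hr Hrt j.
    destruct (energy_difference_quotient s t r vel acc j Hrt cont_vel cont_acc
      vel_cA_derive vel_cB_derive) as [z [Hz E]].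
    eapply Rle_trans; [exact E|]; apply acc_energy_close; auto; apply H.
    apply Rabs_lt_between in Hr; apply Rabs_lt_between.
    revert Hz; unfold Rmin, Rmax; destruct Rle_dec; lra.
Qed.

Lemma press_is_pressure (t : R) : is_pressure (lam - mu0) (vel t) (press t).
Proof.
  assert (E : forall y, Derive (press t) y = press_x t y)
    by (intros y; apply is_derive_unique, press_derive).
  assert (D : forall y, is_derive (Derive (press t)) y (RInt (force t) 0 1 - force t y)).
  { intros y; apply (is_derive_ext (press_x t)); [symmetry; apply E | apply press_x_derive]. }
  split; [apply press_periodic1|]; split.
  - intros y; split; [eexists; apply press_derive | eexists; apply D].
  - intros y; unfold mu_op, mu; rewrite press_mean, vel_mean.
    rewrite (is_derive_unique _ _ _ (vel_derive t y)).
    change (Derive_n (press t) 2 y) with (Derive (Derive (press t)) y).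
    rewrite (is_derive_unique _ _ _ (D y)); unfold force; rng.
Qed.

Lemma vel_strong_solution (s : R) (T : Rbar) (u0 : R -> R) : 3 / 2 < s <= 3 -> Rbar_lt 0 T ->
  (forall x, vel 0 x = u0 x) -> strong_solution (lam - mu0) s u0 T vel.
Proof.
  intros Hs HT H0; split; [exact HT|]; split; [apply vel_C0_H; lra|]; split; [|exact H0].
  exists acc; split; [apply acc_C0_H; lra|]; split; [apply vel_time_derive_H; lra|].
  intros t _; exists (press t); split; [apply press_is_pressure|].
  intros x.
  rewrite (is_derive_unique _ _ _ (vel_derive t x)), (is_derive_unique _ _ _ (press_derive t x)).
  unfold acc; ring.
Qed.

End Lagrange.

(** [rho] is arbitrary when [lam = 0], because [nu] vanishes in that case. *)
Lemma signed_density (nu : R -> R) (lam : R) : cont nu -> periodic1 nu ->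
  RInt nu 0 1 = lam -> (forall x, 0 <= nu x) \/ (forall x, nu x <= 0) ->
  exists rho, cont rho /\ periodic1 rho /\ (forall x, 0 <= rho x) /\ RInt rho 0 1 = 1 /\
    forall x, nu x = lam * rho x.
Proof.
  intros C P I S.
  destruct (Req_dec lam 0) as [L|L].
  - exists (fun _ => 1).
    assert (Z : forall x, nu x = 0).
    { destruct S as [S|S].
      - apply RInt_eq_0_nonneg; auto; lra.
      - intros x; assert (- nu x = 0); [|lra].
        apply (RInt_eq_0_nonneg (fun x => - nu x)).
        + intros y; rewrite P; reflexivity.
        + cnt.
        + intros y; specialize (S y); lra.
        + rewrite RInt_opp_cont by auto; lra. }
    split; [cnt|]; split; [intros x; reflexivity|]; split; [intros; lra|]; split.
    + rewrite RInt_const_R; rng.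
    + intros x; rewrite Z, L; ring.
  - exists (fun x => nu x / lam).
    split; [cnt|]; split; [intros x; rewrite P; reflexivity|]; split; [|split].
    + intros x; destruct S as [S|S].
      * assert (0 <= lam) by (rewrite <- I; apply RInt_ge_0_cont; auto; lra).
        apply Rdiv_le_0_compat; auto; lra.
      * assert (0 <= - lam).
        { rewrite <- I, <- RInt_opp_cont by auto; apply RInt_ge_0_cont; [lra | cnt |].
          intros y _; specialize (S y); lra. }
        replace (nu x / lam) with (- nu x / - lam) by (field; lra).
        specialize (S x); apply Rdiv_le_0_compat; lra.
    + rewrite (RInt_ext_R _ (fun x => / lam * nu x)) by (intros; unfold Rdiv; ring).
      rewrite RInt_scal_cont, I by auto; apply Rinv_l, L.
    + intros x; field; exact L.
Qed.

Lemma energy1_plus_const (f : R -> R) (c : R) : cont f ->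
  ex_series (energy1 f) -> ex_series (energy1 (fun x => f x + c)).
Proof.
  intros Cf Hf.
  apply (ex_series_bsum _ (2 * Series (energy1 f) + 2 * c ^ 2)); [apply energy1_ge0|].
  intros j; apply energy1_plus; [auto | cnt | |].
  - apply bsum_bounded; auto using energy1_ge0.
  - eapply Rle_trans; [apply (energy1_C1 (fun _ => c) (fun _ => 0))|].
    + intros x; reflexivity.
    + cnt.
    + intros x; apply is_derive_const_R.
    + rewrite RInt_const_R; right; rng.
Qed.

(** The field is built for all real times at once, so one function serves every [T]. The bound
    [s <= 3] reflects the regularity of [u0], two derivatives above $H^1$. *)
Theorem global_strong_solution (kappa s : R) (u0 : R -> R) : 3 / 2 < s <= 3 ->
  periodic1 u0 -> twice_derivable u0 -> in_H 1 (mu_op u0) ->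
  (forall x, 0 <= mu_op u0 x + kappa) \/ (forall x, mu_op u0 x + kappa <= 0) ->
  exists u, forall T, Rbar_lt 0 T -> strong_solution kappa s u0 T u.
Proof.
  intros Hs P0 D0 Hm Sg.
  set (mu0 := mu u0); set (lam := mu0 + kappa).
  set (nu := fun x => mu_op u0 x + kappa).
  destruct (Hm) as [Pm [Cm _]].
  assert (Cnu : cont nu) by (unfold nu; apply cont_plus; [exact Cm | cnt]).
  assert (Pnu : periodic1 nu) by (intros x; unfold nu; rewrite Pm; reflexivity).
  assert (Du : forall x, is_derive u0 x (Derive u0 x)) by (intros x; apply Derive_correct, D0).
  assert (Ddu : forall x, is_derive (Derive u0) x (lam - nu x)).
  { intros x; eapply is_derive_eq; [apply Derive_correct, D0|].
    unfold lam, nu, mu_op, mu0; change (Derive_n u0 2 x) with (Derive (Derive u0) x); ring. }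
  assert (Inu : RInt nu 0 1 = lam).
  { pose proof (RInt_derive_periodic1 (Derive u0) _ Ddu ltac:(cnt)
      (periodic1_derive u0 _ P0 Du)) as E.
    rewrite RInt_minus_cont, RInt_const_R in E by cnt; lra. }
  destruct (signed_density nu lam Cnu Pnu Inu Sg) as [rho [Cr [Pr [r0 [r1 Er]]]]].
  destruct (lagrangian_flow rho lam Cr Pr r0 r1)
    as [phi [V [Cphi [CV [Pphi [PV [phi0 [phit [Vx [mass mean]]]]]]]]]].
  assert (Vx' : forall t x, is_derive (V t) x (lam * exp (phi t x) - nu x * exp (- phi t x))).
  { intros t x; eapply is_derive_eq; [apply Vx | rewrite Er; ring]. }
  assert (Hnu : ex_series (energy1 nu)) by (apply energy1_plus_const, in_H1_energy1; auto).
  replace kappa with (lam - mu0) by (unfold lam; ring).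
  exists (vel phi V mu0 Cphi CV Pphi mass); intros T HT.
  apply (vel_strong_solution phi V nu lam mu0 Cphi CV Pphi PV phi0 phit Vx' mass mean); auto.
  apply (vel_0 phi V nu lam mu0 Cphi CV Pphi PV phi0 Vx' mass mean u0 (Derive u0)); auto.
Qed.

Theorem theorem4p1 (kappa s : R) (u0 : R -> R)
    (hs : 3 / 2 < s <= 3)
    (hper : periodic1 u0)
    (hu0 : twice_derivable u0)
    (hm0 : in_H 1 (mu_op u0))
    (hsign : (forall x, 0 <= mu_op u0 x + kappa) \/
             (forall x, mu_op u0 x + kappa <= 0)) :
  (exists u : R -> R -> R, strong_solution kappa s u0 p_infty u) /\
  max_existence_time kappa s u0 = p_infty.
Proof.
  destruct (global_strong_solution kappa s u0 hs hper hu0 hm0 hsign) as [u Hu].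
  split; [exists u; apply Hu; exact I|].
  unfold max_existence_time.
  destruct (Lub_Rbar_correct (fun T : R => exists u, strong_solution kappa s u0 T u)) as [B _].
  (* Every real [T > 0] is an existence time: a finite bound [M] is exceeded by [Rabs M + 1], and
     minus infinity by 1. *)
  destruct (Lub_Rbar _) as [M | |]; [exfalso| reflexivity | exfalso].
  - assert (HT : 0 < Rabs M + 1) by (pose proof (Rabs_pos M); lra).
    specialize (B (Rabs M + 1) (ex_intro _ u (Hu (Finite (Rabs M + 1)) HT))); simpl in B.
    pose proof (Rle_abs M); lra.
  - exact (B 1 (ex_intro _ u (Hu (Finite 1) Rlt_0_1))).
Qed.
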